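(* Let $B_1,B_2$ be densely defined closed operators in a separable complex Hilbert space $\mathfrak{H}$ with $\rho(B_1)\cap\rho(B_2)\neq\emptyset$. Assume that $S=B_1\cap B_2$ is densely defined and symmetric in $\mathfrak{H}$ with equal deficiency indices, and that $A_0$ is a self-adjoint extension of $S$ in $\mathfrak{H}$ such that $S=A_0\cap B_1=A_0\cap B_2=A_0\cap B_1^*=A_0\cap B_2^*$. Let $\{\mathcal{G},\Gamma_0,\Gamma_1\}$ be a boundary triple for $S^*$ and let $\Theta_1,\Theta_2$ be densely defined closed operators in $\mathcal{G}$ (with adjoints $\Theta_1^*,\Theta_2^*$ also densely defined and closed) such that $A_0=S^*\upharpoonright\ker(\Gamma_0)$ and, for $j=1,2$, $$B_j=S^*\upharpoonright\ker(\Gamma_1-\Theta_j\Gamma_0),\qquad B_j^*=S^*\upharpoonright\ker(\Gamma_1-\Theta_j^*\Gamma_0).$$ Let $M(\cdot)$ be the Weyl--Titchmarsh function corresponding to $\{\mathcal{G},\Gamma_0,\Gamma_1\}$, and assume that $z_0\in\sigma_d(B_j)\cup\rho(B_j)$ for $j=1,2$ and $z_0\in\sigma_d(A_0)\cup\rho(A_0)$. Then there exists $\varepsilon_0>0$ such that both functions $\Theta_j-M(\cdot)$, $j=1,2$, satisfy conditions (a)--(e) of the context with $U=D(z_0;\varepsilon_0)$ and $\mathcal{D}_0=\{z_0\}$, and, for all sufficiently small $\varepsilon>0$, $$\widetilde{\mathrm{ind}}_{C(z_0;\varepsilon)}(\Theta_1-M(\cdot))-\widetilde{\mathrm{ind}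}_{C(z_0;\varepsilon)}(\Theta_2-M(\cdot))=m_a(z_0;B_1)-m_a(z_0;B_2).$$
   Context: Inner products are linear in the first entry. $\mathcal{B}(\mathcal{H})$, $\mathcal{B}(\mathcal{H},\mathcal{K})$ denote bounded operators; $\mathcal{C}(\mathcal{H})$ denotes the densely defined closed operators in $\mathcal{H}$; $\overline T$ is the closure of a closable operator $T$. For operators $B,C$ in $\mathfrak{H}$, $B\cap C$ is the operator with domain $\{f\in\mathrm{dom}(B)\cap\mathrm{dom}(C): Bf=Cf\}$ acting as $B$ (equivalently $C$). $D(z_0;\varepsilon_0)$ is the open disc of radius $\varepsilon_0$ about $z_0$. $\sigma_d(T)$ is the set of eigenvalues of $T$ of finite algebraic multiplicity that are isolated in $\sigma(T)$; $m_a(z_0;T)$ is the algebraic multiplicity of $z_0\in\sigma_d(T)$, and $m_a(z_0;T)=0$ if $z_0\in\rho(T)$. Boundary triple. For a densely defined closed symmetric operator $S$ in $\mathfrak{H}$, a boundary triple $\{\mathcal{G},\Gamma_0,\Gamma_1\}$ for $S^*$ consists of a Hilbert space $\mathcal{G}$ and linear maps $\Gamma_0,\Gamma_1:\mathrm{dom}(S^* )\to\mathcal{G}$ such that $(S^*f,g)_{\mathfrak{H}}-(f,S^*g)_{\mathfrak{H}}=(\Gamma_1f,\Gamma_0g)_{\mathcal{G}}-(\Gamma_0f,\Gamma_1g)_{\mathcal{G}}$ for all $f,g\in\mathrm{dom}(S^* )$ and $f\mapsto(\Gamma_0f,\Gamma_1f)$ maps $\mathrm{dom}(S^* )$ onto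 $\mathcal{G}\times\mathcal{G}$. For an operator $\Theta$ in $\mathcal{G}$, $\ker(\Gamma_1-\Theta\Gamma_0)=\{f\in\mathrm{dom}(S^* ):\Gamma_0f\in\mathrm{dom}(\Theta),\ \Gamma_1f=\Theta\Gamma_0f\}$. Weyl--Titchmarsh function. With $A_0=S^*\upharpoonright\ker(\Gamma_0)$ and $z\in\rho(A_0)$, $\Gamma_0\upharpoonright\ker(S^*-zI_{\mathfrak{H}})$ is a bijection onto $\mathcal{G}$ with bounded inverse, and $M(z)=\Gamma_1(\Gamma_0\upharpoonright\ker(S^*-zI_{\mathfrak{H}}))^{-1}\in\mathcal{B}(\mathcal{G})$. Finitely meromorphic. A $\mathcal{B}(\mathcal{H})$-valued meromorphic function is finitely meromorphic at $z_0$ if it is analytic in a punctured disc around $z_0$ with a norm convergent Laurent expansion $\sum_{k\ge -N_0}(z-z_0)^kM_k$ in which $M_k$ has finite rank for all $k\le -1$; it is finitely meromorphic on an open set if it is meromorphic there and finitely meromorphic at each of its poles. Generalized index. Let $U\subseteq\mathbb{C}$ be open and connected and $\mathcal{D}_0\subset U$ a set without limit points in $U$. For a function $N:U\setminus\mathcal{D}_0\to\mathcal{C}(\mathcal{H})$ consider the conditions: (a) $\mathrm{dom}(N(z))=\mathcal{N}_0$ is independent of $z$; (b) $N(z)^{-1}\in\mathcal{B}(\mathcal{H})$ for all $z\in U\setminus\mathcal{D}_0$; (c) $N(\cdot)^{-1}$ is analytic on $U\setminus\mathcal{D}_0$ and finitely meromorphic on $U$; (d) $z\mapsto N(z)\varphi$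 is analytic on $U\setminus\mathcal{D}_0$ for every $\varphi\in\mathcal{N}_0$; (e) the operators $N'(z)$, defined on $\mathcal{N}_0$, extend to $\overline{N'(z)}\in\mathcal{B}(\mathcal{H})$, and $\overline{N'(\cdot)}$ is analytic on $U\setminus\mathcal{D}_0$ and finitely meromorphic on $U$. If (a)--(e) hold, then for $z_0\in U$ and $\varepsilon>0$ sufficiently small, with $C(z_0;\varepsilon)$ the counterclockwise oriented circle of radius $\varepsilon$ around $z_0$, $$\widetilde{\mathrm{ind}}_{C(z_0;\varepsilon)}(N(\cdot))=\mathrm{tr}_{\mathcal{H}}\Big(\frac1{2\pi i}\oint_{C(z_0;\varepsilon)}\overline{N'(\zeta)}N(\zeta)^{-1}\,d\zeta\Big)=\mathrm{tr}_{\mathcal{H}}\Big(\frac1{2\pi i}\oint_{C(z_0;\varepsilon)}N(\zeta)^{-1}\overline{N'(\zeta)}\,d\zeta\Big).$$ *)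

(* Defs.v *)
From Stdlib Require Import Reals Lra List.
From Stdlib Require Import ClassicalEpsilon FunctionalExtensionality ProofIrrelevance.
From Coquelicot Require Import Coquelicot.

Open Scope R_scope.

(** Coquelicot's [is_linear] means "linear and bounded". *)

Record Bop (U V : NormedModule C_AbsRing) := mkBop {
  bop_fun :> U -> V;
  bop_lin : is_linear bop_fun }.

Arguments mkBop {U V} _ _.
Arguments bop_fun {U V} _ _.
Arguments bop_lin {U V} _.

Lemma bop_ext (U V : NormedModule C_AbsRing) (S T : Bop U V) :
  (forall x, S x = T x) -> S = T.
Proof.
  destruct S as [s hs], T as [t ht]; simpl; intro E.
  assert (s = t) as <- by (apply functional_extensionality; exact E).
  f_equal; apply proof_irrelevance.
Qed.

Section BopStructure.

Context {U V : NormedModule C_AbsRing}.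

Lemma is_linear_bop_plus (S T : Bop U V) : is_linear (fun x => plus (S x) (T x)).
Proof.
  pose proof (bop_lin S) as [ps ss [A [hA bA]]].
  pose proof (bop_lin T) as [pt st [B [hB bB]]].
  split.
  - intros x y; rewrite ps, pt, !plus_assoc; f_equal.
    rewrite <- !plus_assoc; f_equal; apply plus_comm.
  - intros k x; rewrite ss, st; symmetry; apply (scal_distr_l (V := NormedModule.ModuleSpace C_AbsRing V) k).
  - exists (A + B); split; [lra|].
    intro x; eapply Rle_trans; [apply norm_triangle|].
    specialize (bA x); specialize (bB x); lra.
Qed.

Lemma is_linear_bop_scal (k : C) (T : Bop U V) :
  is_linear (fun x => @scal C_Ring V k (T x)).
Proof.
  pose proof (bop_lin T) as [pt st [B [hB bB]]].
  split.
  - intros x y; rewrite pt; apply (scal_distr_l (V := NormedModule.ModuleSpace C_AbsRing V) (k : C_Ring)).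
  - intros c x; rewrite st, !scal_assoc; f_equal; apply Cmult_comm.
  - exists (Cmod k * B + 1); split.
    + pose proof (Cmod_ge_0 k); nra.
    + intro x; eapply Rle_trans; [apply (norm_scal (K := C_AbsRing))|].
      change (@abs C_AbsRing k) with (Cmod k).
      pose proof (Cmod_ge_0 k); pose proof (norm_ge_0 x); specialize (bB x).
      apply Rle_trans with (Cmod k * (B * norm x)); [now apply Rmult_le_compat_l | nra].
Qed.

Lemma is_linear_bop_zero : is_linear (fun _ : U => @zero V).
Proof.
  split.
  - intros; now rewrite plus_zero_l.
  - intros; symmetry; apply (scal_zero_r (V := NormedModule.ModuleSpace C_AbsRing V)).
  - exists 1; split; [lra|]; intro x; rewrite norm_zero.
    pose proof (norm_ge_0 x); lra.
Qed.

Lemma is_linear_bop_opp (T : Bop U V) : is_linear (fun x => @opp (NormedModule.AbelianGroup C_AbsRing V) (T x)).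
Proof.
  apply (is_linear_comp T (@opp (NormedModule.AbelianGroup C_AbsRing V)));
    [apply bop_lin | apply is_linear_opp].
Qed.

Definition bop_plus (S T : Bop U V) : Bop U V := mkBop _ (is_linear_bop_plus S T).
Definition bop_scal (k : C) (T : Bop U V) : Bop U V := mkBop _ (is_linear_bop_scal k T).
Definition bop_zero : Bop U V := mkBop _ is_linear_bop_zero.
Definition bop_opp (T : Bop U V) : Bop U V := mkBop _ (is_linear_bop_opp T).

Lemma bop_plus_comm S T : bop_plus S T = bop_plus T S.
Proof. apply bop_ext; intro x; apply plus_comm. Qed.

Lemma bop_plus_assoc S T W : bop_plus S (bop_plus T W) = bop_plus (bop_plus S T) W.
Proof. apply bop_ext; intro x; apply plus_assoc. Qed.

Lemma bop_plus_zero_r T : bop_plus T bop_zero = T.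
Proof. apply bop_ext; intro x; apply plus_zero_r. Qed.

Lemma bop_plus_opp_r T : bop_plus T (bop_opp T) = bop_zero.
Proof.
  apply bop_ext; intro x; apply (plus_opp_r (G := NormedModule.AbelianGroup C_AbsRing V)).
Qed.

Definition Bop_AbelianMonoid_mixin :=
  AbelianMonoid.Mixin (Bop U V) bop_plus bop_zero
    bop_plus_comm bop_plus_assoc bop_plus_zero_r.

Canonical Bop_AbelianMonoid :=
  AbelianMonoid.Pack (Bop U V) Bop_AbelianMonoid_mixin (Bop U V).

Definition Bop_AbelianGroup_mixin :=
  AbelianGroup.Mixin Bop_AbelianMonoid bop_opp bop_plus_opp_r.

Canonical Bop_AbelianGroup :=
  AbelianGroup.Pack (Bop U V)
    (AbelianGroup.Class _ Bop_AbelianMonoid_mixin Bop_AbelianGroup_mixin) (Bop U V).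

Lemma bop_scal_assoc (k l : C_Ring) (T : Bop U V) :
  bop_scal k (bop_scal l T) = bop_scal (mult k l) T.
Proof. apply bop_ext; intro x; apply (scal_assoc (V := NormedModule.ModuleSpace C_AbsRing V)). Qed.

Lemma bop_scal_one (T : Bop U V) : bop_scal (@one C_Ring) T = T.
Proof. apply bop_ext; intro x; apply (scal_one (V := NormedModule.ModuleSpace C_AbsRing V)). Qed.

Lemma bop_scal_distr_l (k : C_Ring) (S T : Bop U V) :
  bop_scal k (plus S T) = plus (bop_scal k S) (bop_scal k T).
Proof. apply bop_ext; intro x; apply (scal_distr_l (V := NormedModule.ModuleSpace C_AbsRing V)). Qed.

Lemma bop_scal_distr_r (k l : C_Ring) (T : Bop U V) :
  bop_scal (plus k l) T = plus (bop_scal k T) (bop_scal l T).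
Proof. apply bop_ext; intro x; apply (scal_distr_r (V := NormedModule.ModuleSpace C_AbsRing V)). Qed.

Definition Bop_ModuleSpace_mixin :=
  ModuleSpace.Mixin C_Ring Bop_AbelianGroup bop_scal
    bop_scal_assoc bop_scal_one bop_scal_distr_l bop_scal_distr_r.

Canonical Bop_ModuleSpace :=
  ModuleSpace.Pack C_Ring (Bop U V)
    (ModuleSpace.Class C_Ring _ _ Bop_ModuleSpace_mixin) (Bop U V).

Definition is_op_bound (T : Bop U V) (c : R) : Prop :=
  0 <= c /\ forall x, norm (T x) <= c * norm x.

Definition op_norm (T : Bop U V) : R := real (Glb_Rbar (is_op_bound T)).

Lemma op_norm_glb (T : Bop U V) : is_glb_Rbar (is_op_bound T) (op_norm T).
Proof.
  unfold op_norm.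
  pose proof (Glb_Rbar_correct (is_op_bound T)) as G.
  destruct (Glb_Rbar (is_op_bound T)) as [r | |]; simpl; auto; exfalso.
  - pose proof (bop_lin T) as [_ _ [B [hB bB]]].
    apply (proj1 G B); split; auto; lra.
  - apply (proj2 G (Finite 0)); intros c [hc _]; exact hc.
Qed.

Lemma op_norm_le (T : Bop U V) (c : R) : is_op_bound T c -> op_norm T <= c.
Proof. intro h; exact (proj1 (op_norm_glb T) c h). Qed.

Lemma op_norm_ge_0 (T : Bop U V) : 0 <= op_norm T.
Proof. apply (proj2 (op_norm_glb T) (Finite 0)); intros c [hc _]; exact hc. Qed.

Lemma op_norm_bound (T : Bop U V) : is_op_bound T (op_norm T).
Proof.
  split; [apply op_norm_ge_0|]; intro x.
  destruct (Req_dec (norm x) 0) as [E|N].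
  - pose proof (bop_lin T) as [_ _ [B [hB bB]]].
    specialize (bB x); rewrite E in *; lra.
  - pose proof (norm_ge_0 x) as P.
    assert (L : norm (T x) / norm x <= op_norm T).
    { apply (proj2 (op_norm_glb T) (Finite (norm (T x) / norm x))).
      intros c [hc bc]; simpl; specialize (bc x).
      apply Rmult_le_reg_r with (norm x); [lra|].
      replace (norm (T x) / norm x * norm x) with (norm (T x)) by (field; lra); lra. }
    apply Rmult_le_compat_r with (r := norm x) in L; auto.
    replace (norm (T x) / norm x * norm x) with (norm (T x)) in L by (field; lra); lra.
Qed.

Lemma op_norm_triangle (S T : Bop U V) : op_norm (plus S T) <= op_norm S + op_norm T.
Proof.
  destruct (op_norm_bound S) as [hS bS], (op_norm_bound T) as [hT bT].
  apply op_norm_le; split; [lra|]; intro x.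
  eapply Rle_trans; [apply norm_triangle|].
  specialize (bS x); specialize (bT x); lra.
Qed.

Lemma op_norm_scal (k : C_AbsRing) (T : Bop U V) :
  op_norm (scal k T) <= abs k * op_norm T.
Proof.
  destruct (op_norm_bound T) as [hT bT].
  pose proof (abs_ge_0 k) as hk.
  apply op_norm_le; split; [now apply Rmult_le_pos|]; intro x.
  eapply Rle_trans; [apply (norm_scal (K := C_AbsRing))|].
  rewrite Rmult_assoc; apply Rmult_le_compat_l; auto.
Qed.

Lemma op_norm_eq_0 (T : Bop U V) : op_norm T = 0 -> T = zero.
Proof.
  intro E; apply bop_ext; intro x; apply norm_eq_zero.
  destruct (op_norm_bound T) as [_ b]; specialize (b x); rewrite E in b.
  pose proof (norm_ge_0 (T x)); lra.
Qed.

Lemma op_norm_zero : op_norm bop_zero = 0.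
Proof.
  apply Rle_antisym; [|apply op_norm_ge_0].
  apply op_norm_le; split; [lra|]; intro x; simpl; rewrite norm_zero; lra.
Qed.

Lemma op_norm_opp (T : Bop U V) : op_norm (opp T) <= op_norm T.
Proof.
  destruct (op_norm_bound T) as [hT bT].
  apply op_norm_le; split; auto; intro x; simpl; rewrite norm_opp; apply bT.
Qed.

Definition bop_ball (S : Bop U V) (e : R) (T : Bop U V) : Prop := op_norm (minus T S) < e.

Lemma bop_ball_center (T : Bop U V) (e : posreal) : bop_ball T e T.
Proof.
  unfold bop_ball; rewrite minus_eq_zero.
  change (op_norm bop_zero < e); rewrite op_norm_zero; apply cond_pos.
Qed.

Lemma bop_ball_sym (S T : Bop U V) (e : R) : bop_ball S e T -> bop_ball T e S.
Proof.
  unfold bop_ball; intro h; eapply Rle_lt_trans; [|exact h].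
  rewrite <- (opp_minus T S); apply op_norm_opp.
Qed.

Lemma bop_ball_triangle (S T W : Bop U V) (e1 e2 : R) :
  bop_ball S e1 T -> bop_ball T e2 W -> bop_ball S (e1 + e2) W.
Proof.
  unfold bop_ball; intros h1 h2.
  rewrite (minus_trans T W S).
  eapply Rle_lt_trans; [apply op_norm_triangle|]; lra.
Qed.

Definition Bop_UniformSpace_mixin :=
  UniformSpace.Mixin (Bop U V) bop_zero bop_ball
    bop_ball_center bop_ball_sym bop_ball_triangle.

Canonical Bop_UniformSpace :=
  UniformSpace.Pack (Bop U V) Bop_UniformSpace_mixin (Bop U V).

Canonical Bop_NormedModuleAux :=
  NormedModuleAux.Pack C_AbsRing (Bop U V)
    (NormedModuleAux.Class C_AbsRing _ (ModuleSpace.class C_Ring Bop_ModuleSpace)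
      Bop_UniformSpace_mixin) (Bop U V).

Lemma bop_norm_compat1 (S T : Bop U V) (e : R) :
  op_norm (minus T S) < e -> ball S e T.
Proof. intro h; exact h. Qed.

Lemma bop_norm_compat2 (S T : Bop U V) (e : posreal) :
  ball S e T -> op_norm (minus T S) < 1 * e.
Proof. intro h; rewrite Rmult_1_l; exact h. Qed.

Definition Bop_NormedModule_mixin :=
  NormedModule.Mixin C_AbsRing Bop_NormedModuleAux op_norm 1
    op_norm_triangle op_norm_scal bop_norm_compat1 bop_norm_compat2 op_norm_eq_0.

Canonical Bop_NormedModule :=
  NormedModule.Pack C_AbsRing (Bop U V)
    (NormedModule.Class C_AbsRing _
      (NormedModuleAux.class C_AbsRing Bop_NormedModuleAux)
      Bop_NormedModule_mixin) (Bop U V).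

End BopStructure.

Arguments Bop_NormedModule U V : clear implicits.

Lemma is_linear_bop_comp (U V W : NormedModule C_AbsRing) (S : Bop V W) (T : Bop U V) :
  is_linear (fun x => S (T x)).
Proof. apply is_linear_comp; apply bop_lin. Qed.

Definition bop_comp {U V W : NormedModule C_AbsRing} (S : Bop V W) (T : Bop U V) : Bop U W :=
  mkBop _ (is_linear_bop_comp U V W S T).

(** Restriction of scalars, because Coquelicot's [is_RInt] integrates functions
    with values in a real normed space. *)

Section RestrictScalars.

Variable V : NormedModule C_AbsRing.

Definition rscal (r : R_Ring) (x : V) : V := @scal C_Ring V (RtoC r) x.

Lemma rscal_assoc (r s : R_Ring) (x : V) : rscal r (rscal s x) = rscal (mult r s) x.
Proof.
  unfold rscal; rewrite scal_assoc; f_equal; symmetry; apply RtoC_mult.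
Qed.

Lemma rscal_one (x : V) : rscal (@one R_Ring) x = x.
Proof. apply (scal_one (V := NormedModule.ModuleSpace C_AbsRing V)). Qed.

Lemma rscal_distr_l (r : R_Ring) (x y : V) :
  rscal r (plus x y) = plus (rscal r x) (rscal r y).
Proof. apply (scal_distr_l (V := NormedModule.ModuleSpace C_AbsRing V)). Qed.

Lemma rscal_distr_r (r s : R_Ring) (x : V) :
  rscal (plus r s) x = plus (rscal r x) (rscal s x).
Proof.
  unfold rscal; etransitivity; [|apply (scal_distr_r (V := NormedModule.ModuleSpace C_AbsRing V))].
  f_equal; apply RtoC_plus.
Qed.

Definition real_ModuleSpace_mixin :=
  ModuleSpace.Mixin R_Ring (NormedModule.AbelianGroup C_AbsRing V) rscal
    rscal_assoc rscal_one rscal_distr_l rscal_distr_r.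

Definition real_NormedModuleAux :=
  NormedModuleAux.Pack R_AbsRing V
    (NormedModuleAux.Class R_AbsRing V
      (ModuleSpace.Class R_Ring V _ real_ModuleSpace_mixin)
      (UniformSpace.class (NormedModule.UniformSpace C_AbsRing V))) V.

Lemma real_norm_scal (r : R_AbsRing) (x : V) : norm (rscal r x) <= abs r * norm x.
Proof.
  eapply Rle_trans; [apply (norm_scal (K := C_AbsRing))|].
  change (@abs C_AbsRing (RtoC r)) with (Cmod (RtoC r)).
  rewrite Cmod_R; apply Rle_refl.
Qed.

Definition real_NormedModule_mixin :=
  NormedModule.Mixin R_AbsRing real_NormedModuleAux (@norm C_AbsRing V)
    (@norm_factor C_AbsRing V)
    norm_triangle real_norm_scal norm_compat1 norm_compat2 norm_eq_zero.

Definition real_NormedModule : NormedModule R_AbsRing :=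
  NormedModule.Pack R_AbsRing V
    (NormedModule.Class R_AbsRing V
      (NormedModuleAux.class R_AbsRing real_NormedModuleAux)
      real_NormedModule_mixin) V.

End RestrictScalars.

Record HilbertSpace := mkHilbert {
  hcarrier :> CompleteNormedModule C_AbsRing;
  inner : hcarrier -> hcarrier -> C;
  inner_plus_l : forall x y z, inner (plus x y) z = Cplus (inner x z) (inner y z);
  inner_scal_l : forall (k : C) x z,
    inner (@scal C_Ring hcarrier k x) z = Cmult k (inner x z);
  inner_conj : forall x y, inner y x = Cconj (inner x y);
  inner_norm : forall x, inner x x = RtoC (norm x ^ 2) }.

Arguments inner {_} _ _.

Definition separable (H : HilbertSpace) : Prop :=
  exists u : nat -> H, forall (x : H) (eps : posreal),
    exists n, norm (minus (u n) x) < eps.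

(** Maximal orthonormal subset of a closed subspace [V]. *)
Definition orthonormal_basis {H : HilbertSpace} (V E : H -> Prop) : Prop :=
  (forall e, E e -> V e) /\
  (forall e, E e -> inner e e = RtoC 1) /\
  (forall e f, E e -> E f -> e <> f -> inner e f = RtoC 0) /\
  (forall x, V x -> (forall e, E e -> inner x e = RtoC 0) -> x = zero).

(** Equality of Hilbert dimensions as cardinals: [phi] is a bijection of bases. *)
Definition same_hilbert_dim {H K : HilbertSpace} (V : H -> Prop) (W : K -> Prop) : Prop :=
  exists (E : H -> Prop) (F : K -> Prop) (phi : H -> K),
    orthonormal_basis V E /\ orthonormal_basis W F /\
    (forall e, E e -> F (phi e)) /\
    (forall e e', E e -> E e' -> phi e = phi e' -> e = e') /\
    (forall f, F f -> exists e, E e /\ phi e = f).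

(** [has_dim V n]: the set [V] is a subspace with a basis [e 1, ..., e n]. *)
Definition has_dim {M : ModuleSpace C_Ring} (V : M -> Prop) (n : nat) : Prop :=
  exists e : nat -> M,
    (forall x, V x <->
       exists c : nat -> C_Ring, x = sum_n_m (fun k => scal (c k) (e k)) 1 n) /\
    (forall c : nat -> C_Ring, sum_n_m (fun k => scal (c k) (e k)) 1 n = zero ->
       forall k, (1 <= k <= n)%nat -> c k = zero).

Definition ran {U V : NormedModule C_AbsRing} (T : Bop U V) : V -> Prop :=
  fun y => exists x, T x = y.

Definition finite_rank {U V : NormedModule C_AbsRing} (T : Bop U V) : Prop :=
  exists n, has_dim (ran T) n.

(** The list consists of pairs [(e_i, f_i)] from two finite orthonormal systems;
    the least such [c] is the trace norm of [T]. *)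
Definition trace_class {H : HilbertSpace} (T : Bop H H) : Prop :=
  exists c : R, forall (l : list (H * H)),
    (forall i j, (i < length l)%nat -> (j < length l)%nat ->
       let e k := fst (nth k l (zero, zero)) in
       let f k := snd (nth k l (zero, zero)) in
       let d := RtoC (if Nat.eqb i j then 1 else 0) in
       inner (e i) (e j) = d /\ inner (f i) (f j) = d) ->
    fold_right (fun p s => Cmod (inner (T (fst p)) (snd p)) + s) 0 l <= c.

Definition is_unordered_sum {X : Type} (E : X -> Prop) (a : X -> C) (s : C) : Prop :=
  forall eps : posreal, exists l0 : list X,
    (forall x, In x l0 -> E x) /\
    forall l : list X, NoDup l -> (forall x, In x l -> E x) -> incl l0 l ->
      Cmod (Cminus (fold_right (fun x t => Cplus (a x) t) (RtoC 0) l) s) < eps.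

Definition is_trace {H : HilbertSpace} (T : Bop H H) (t : C) : Prop :=
  trace_class T /\
  forall E : H -> Prop, orthonormal_basis (fun _ => True) E ->
    is_unordered_sum E (fun e => inner (T e) e) t.

(** An operator from [U] to [V] is a domain together with a function whose
    values outside the domain are irrelevant; [op_eq] is equality of operators. *)

Record op (U V : Type) := mkOp {
  dom : U -> Prop;
  ap :> U -> V }.

Arguments mkOp {U V} _ _.
Arguments dom {U V} _ _.
Arguments ap {U V} _ _.

Definition op_eq {U V : Type} (A B : op U V) : Prop :=
  (forall f, dom A f <-> dom B f) /\ (forall f, dom A f -> A f = B f).

Definition op_ext {U V : Type} (A B : op U V) : Prop :=
  forall f, dom A f -> dom B f /\ A f = B f.

Definition op_inter {U V : Type} (B C : op U V) : op U V :=
  mkOp (fun f => dom B f /\ dom C f /\ B f = C f) B.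

Definition op_restr {U V : Type} (A : op U V) (D : U -> Prop) : op U V :=
  mkOp (fun f => dom A f /\ D f) A.

Definition op_minus {U : Type} {V : AbelianGroup} (A B : op U V) : op U V :=
  mkOp (fun f => dom A f /\ dom B f) (fun f => minus (A f) (B f)).

Definition op_shift {H : HilbertSpace} (T : op H H) (z : C_Ring) : op H H :=
  mkOp (dom T) (fun f => minus (T f) (scal z f)).

Definition linear_op {U V : HilbertSpace} (T : op U V) : Prop :=
  dom T zero /\
  (forall f g, dom T f -> dom T g -> dom T (plus f g) /\ T (plus f g) = plus (T f) (T g)) /\
  (forall (k : C_Ring) f, dom T f -> dom T (scal k f) /\ T (scal k f) = scal k (T f)).

Definition densely_defined {U V : HilbertSpace} (T : op U V) : Prop :=
  forall (x : U) (eps : posreal), exists f, dom T f /\ norm (minus f x) < eps.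

Definition closed_op {U V : HilbertSpace} (T : op U V) : Prop :=
  closed (fun p : U * V => dom T (fst p) /\ T (fst p) = snd p).

Definition dd_closed {H : HilbertSpace} (T : op H H) : Prop :=
  linear_op T /\ densely_defined T /\ closed_op T.

(** The adjoint (of a densely defined operator, for which the choice made by
    [epsilon] is unique). *)
Definition adjoint {U V : HilbertSpace} (T : op U V) : op V U :=
  let is_adj g h := forall f, dom T f -> inner (T f) g = inner f h in
  mkOp (fun g => exists h, is_adj g h)
       (fun g => epsilon (inhabits zero) (is_adj g)).

Definition symmetric {H : HilbertSpace} (T : op H H) : Prop :=
  linear_op T /\ forall f g, dom T f -> dom T g -> inner (T f) g = inner f (T g).

Definition self_adjoint {H : HilbertSpace} (T : op H H) : Prop :=
  linear_op T /\ densely_defined T /\ op_eq T (adjoint T).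

Definition eigenspace {H : HilbertSpace} (T : op H H) (z : C_Ring) : H -> Prop :=
  fun f => dom T f /\ T f = scal z f.

Definition equal_deficiency {H : HilbertSpace} (S : op H H) : Prop :=
  same_hilbert_dim (eigenspace (adjoint S) Ci) (eigenspace (adjoint S) (Copp Ci)).

Definition is_inverse {H : HilbertSpace} (T : op H H) (R : Bop H H) : Prop :=
  (forall f, dom T f -> R (T f) = f) /\ (forall g, dom T (R g) /\ T (R g) = g).

Definition boundedly_invertible {H : HilbertSpace} (T : op H H) : Prop :=
  exists R, is_inverse T R.

Definition op_inv {H : HilbertSpace} (T : op H H) : Bop H H :=
  epsilon (inhabits zero) (is_inverse T).

Definition resolvent_set {H : HilbertSpace} (T : op H H) (z : C) : Prop :=
  boundedly_invertible (op_shift T z).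

Definition resolvent {H : HilbertSpace} (T : op H H) (z : C) : Bop H H :=
  op_inv (op_shift T z).

Definition circle (z0 : C) (eps t : R) : C :=
  Cplus z0 (Cmult (RtoC eps) (cos t, sin t)).

(** The integral of [F] over the counterclockwise circle, parametrized by
    [t |-> z0 + eps e^(i t)], converging in the norm of [V]. *)
Definition is_contour_integral {V : NormedModule C_AbsRing}
    (F : C -> V) (z0 : C) (eps : R) (T : V) : Prop :=
  @is_RInt (real_NormedModule V)
    (fun t => @scal C_Ring V (Cmult Ci (Cmult (RtoC eps) (cos t, sin t)))
                (F (circle z0 eps t)))
    0 (2 * PI) T.

Definition two_pi_i : C := Cmult (RtoC (2 * PI)) Ci.

Definition punctured (z0 : C) (r : R) (z : C) : Prop :=
  0 < Cmod (Cminus z z0) < r.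

Definition isolated_in_spectrum {H : HilbertSpace} (T : op H H) (z0 : C) : Prop :=
  ~ resolvent_set T z0 /\
  exists r, 0 < r /\ forall z, punctured z0 r z -> resolvent_set T z.

(** The Riesz projection of [T] at a point [z0] isolated in the spectrum:
    [-1/(2 pi i)] times the integral of [(T - z)^-1] over any small circle. *)
Definition is_riesz_projection {H : HilbertSpace} (T : op H H) (z0 : C) (P : Bop H H) : Prop :=
  exists r, 0 < r /\ forall eps, 0 < eps < r ->
    is_contour_integral (resolvent T) z0 eps
      (@scal C_Ring Bop_ModuleSpace (Copp two_pi_i) P).

(** The algebraic multiplicity of an isolated point is the dimension of the range
    of its Riesz projection. *)
Definition is_alg_mult {H : HilbertSpace} (T : op H H) (z0 : C) (n : nat) : Prop :=
  exists P, is_riesz_projection T z0 P /\ has_dim (ran P) n.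

Definition eigenvalue {H : HilbertSpace} (T : op H H) (z0 : C) : Prop :=
  exists f, f <> zero /\ eigenspace T z0 f.

Definition discrete_spectrum {H : HilbertSpace} (T : op H H) (z0 : C) : Prop :=
  eigenvalue T z0 /\ isolated_in_spectrum T z0 /\ exists n, is_alg_mult T z0 n.

Definition m_a {H : HilbertSpace} (z0 : C) (T : op H H) : nat :=
  if excluded_middle_informative (resolvent_set T z0) then 0%nat
  else epsilon (inhabits 0%nat) (is_alg_mult T z0).

Record boundary_triple {H G : HilbertSpace} (S : op H H) (Gamma0 Gamma1 : H -> G) : Prop := {
  bt_linear0 : linear_op (mkOp (dom (adjoint S)) Gamma0);
  bt_linear1 : linear_op (mkOp (dom (adjoint S)) Gamma1);
  bt_green : forall f g, dom (adjoint S) f -> dom (adjoint S) g ->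
    Cminus (inner (adjoint S f) g) (inner f (adjoint S g)) =
    Cminus (inner (Gamma1 f) (Gamma0 g)) (inner (Gamma0 f) (Gamma1 g));
  bt_onto : forall a b : G, exists f, dom (adjoint S) f /\ Gamma0 f = a /\ Gamma1 f = b }.

Definition boundary_restr {H G : HilbertSpace} (S : op H H) (Gamma0 Gamma1 : H -> G)
    (Theta : op G G) : op H H :=
  op_restr (adjoint S) (fun f => dom Theta (Gamma0 f) /\ Gamma1 f = Theta (Gamma0 f)).

(** [M(z) = Gamma1 (Gamma0 restricted to ker (S^* - z))^-1]; for [z] in the
    resolvent set of [A_0] the restriction of [Gamma0] is a bijection onto [G]. *)
Definition weyl {H G : HilbertSpace} (S : op H H) (Gamma0 Gamma1 : H -> G) (z : C) : op G G :=
  let preim phi f := eigenspace (adjoint S) z f /\ Gamma0 f = phi in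
  mkOp (fun phi => exists f, preim phi f)
       (fun phi => Gamma1 (epsilon (inhabits zero) (preim phi))).

(** For open [W]: analyticity is complex differentiability. *)
Definition analytic_on {V : NormedModule C_AbsRing} (F : C -> V) (W : C -> Prop) : Prop :=
  forall z : C, W z -> @ex_derive C_AbsRing V F z.

(** On a punctured disc around [z0], [F] is analytic and equal to the norm
    convergent sum of [(z - z0)^(k - N0) M_k] over [k >= 0]; thus [M k] is the
    Laurent coefficient with index [k - N0]. *)
Definition laurent {H : HilbertSpace} (F : C -> Bop H H) (z0 : C) (N0 : nat)
    (M : nat -> Bop H H) : Prop :=
  exists r, 0 < r /\ analytic_on F (punctured z0 r) /\
    forall z, punctured z0 r z ->
      @is_series C_AbsRing (Bop_NormedModule H H)
        (fun k => @scal C_Ring Bop_ModuleSpace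
                    (Cdiv (Cpow (Cminus z z0) k) (Cpow (Cminus z z0) N0)) (M k))
        (F z).

Definition meromorphic_at {H : HilbertSpace} (F : C -> Bop H H) (z0 : C) : Prop :=
  exists N0 M, laurent F z0 N0 M.

Definition pole {H : HilbertSpace} (F : C -> Bop H H) (z0 : C) : Prop :=
  meromorphic_at F z0 /\ ~ exists M, laurent F z0 0 M.

Definition finitely_meromorphic_at {H : HilbertSpace} (F : C -> Bop H H) (z0 : C) : Prop :=
  exists N0 M, laurent F z0 N0 M /\ forall k, (k < N0)%nat -> finite_rank (M k).

Definition finitely_meromorphic_on {H : HilbertSpace} (F : C -> Bop H H) (W : C -> Prop) : Prop :=
  (forall z, W z -> meromorphic_at F z) /\
  (forall z, W z -> pole F z -> finitely_meromorphic_at F z).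

Definition open_disc (z0 : C) (r : R) (z : C) : Prop := Cmod (Cminus z z0) < r.

(** [T] is a bounded everywhere defined extension of [N'(z)], the operator
    [phi |-> d/dz N(z) phi] on [dom (N z)]. Since that domain is dense, [T] is
    then the closure of [N'(z)] and is unique. *)
Definition is_deriv_closure {H : HilbertSpace} (N : C -> op H H) (z : C) (T : Bop H H) : Prop :=
  forall phi, dom (N z) phi ->
    @is_derive C_AbsRing H (fun zeta => N zeta phi) z (T phi).

Definition deriv_closure {H : HilbertSpace} (N : C -> op H H) (z : C) : Bop H H :=
  epsilon (inhabits zero) (is_deriv_closure N z).

(** [W] is meant to be open and connected, and [D0] to have no limit point in [W];
    the values of [N] on [D0] and outside [W] are irrelevant. *)
Record index_conditions {H : HilbertSpace} (N : C -> op H H) (W D0 : C -> Prop) : Prop := {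
  ic_closed : forall z, W z -> ~ D0 z -> dd_closed (N z);
  ic_a : exists N0 : H -> Prop, forall z, W z -> ~ D0 z -> forall f, dom (N z) f <-> N0 f;
  ic_b : forall z, W z -> ~ D0 z -> boundedly_invertible (N z);
  ic_c_analytic : analytic_on (fun z => op_inv (N z)) (fun z => W z /\ ~ D0 z);
  ic_c_meromorphic : finitely_meromorphic_on (fun z => op_inv (N z)) W;
  ic_d : forall phi, (forall z, W z -> ~ D0 z -> dom (N z) phi) ->
    analytic_on (fun z => N z phi) (fun z => W z /\ ~ D0 z);
  ic_e_extends : forall z, W z -> ~ D0 z -> exists T, is_deriv_closure N z T;
  ic_e_analytic : analytic_on (deriv_closure N) (fun z => W z /\ ~ D0 z);
  ic_e_meromorphic : finitely_meromorphic_on (deriv_closure N) W }.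

Definition is_residue_trace {H : HilbertSpace} (F : C -> Bop H H) (z0 : C) (eps : R) (t : C) : Prop :=
  exists T, is_contour_integral F z0 eps T /\
    is_trace (@scal C_Ring Bop_ModuleSpace (Cinv two_pi_i) T) t.

(** The index is the trace of the residue of [N' N^-1], and also of [N^-1 N']. *)
Definition is_index {H : HilbertSpace} (N : C -> op H H) (z0 : C) (eps : R) (t : C) : Prop :=
  is_residue_trace (fun z => bop_comp (deriv_closure N z) (op_inv (N z))) z0 eps t /\
  is_residue_trace (fun z => bop_comp (op_inv (N z)) (deriv_closure N z)) z0 eps t.

(* Main.v *)
Require Import Defs.
From Corelib Require Import ssreflect.
From Stdlib Require Import Reals Lra Lia List Classical.
From Stdlib Require Import ClassicalEpsilon FunctionalExtensionality.
From Coquelicot Require Import Coquelicot.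

(** Write gamma(z) for the inverse of Gamma0 on ker(S^* - z), X(z) = Gamma1 (A0 - z)^-1
    (which is the adjoint of gamma(conj z)) and L(z) = (Theta - M(z))^-1. Then M' = X gamma,
    and Krein's formula reads gamma L X = (B - z)^-1 - (A0 - z)^-1. By cyclicity of the
    trace, the residues of (Theta - M)' L = - X (gamma L) and L (Theta - M)' = - (L X) gamma
    have the trace of the residue of (A0 - z)^-1 - (B - z)^-1, so the index of Theta - M is
    m_a(z0; B) - m_a(z0; A0), and the last term cancels in the difference.

    For w fixed, X(z) = X(w) (1 + (z - w) (A0 - z)^-1), and gamma, gamma L, L X and L are
    likewise expressed by a resolvent between constant operators. The latter are bounded by
    the Hellinger-Toeplitz theorem, since each has an everywhere defined formal adjoint, and
    so everything is finitely meromorphic as soon as resolvents are.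

    Let P be the Riesz projection of T at z0. Cauchy's formula shows that (T - z)^-1 (1 - P)
    stays bounded near z0, hence is a Neumann series there. On the finite dimensional space
    ran P the operator T - z0 is nilpotent: on the stable range of its powers the resolvent
    is bounded, so that its residue vanishes, but this residue is - P. Hence (T - z)^-1 P is
    a Laurent polynomial with finite rank coefficients. *)

Set Bullet Behavior "Strict Subproofs".
Open Scope R_scope.

(** * Linear identities by reflection *)

(** Since [z0] may lie in the spectra of both [A0] and [B], nothing can be based at [z0]: gamma, X
    and L are built at an auxiliary regular point w of the punctured disc and carried to z. Nothing
    is assumed about boundedness of [Gamma0] and [Gamma1], hence the detour through formal adjoints;
    for L(w) the formal adjoint is the inverse of the adjoint of Theta minus M(conj w), which is
    where the description of the adjoint of [B] enters.

    Analysis is reduced to finite estimates: a germ is recorded by its Laurent coefficients and a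
    geometric bound on every truncation. Sums, products and uniqueness of coefficients then involve
    no rearrangement of series, and a contour integral is that of any long enough truncation.

    Finite rank is recorded by lists of rank one terms, whose trace is visibly cyclic even between
    two different spaces; orthonormal bases appear only when it is compared with the trace in the
    definition of the index. Indices adding up to -1 include a negative one, so each term of the
    residue of a product has a factor of finite rank. *)

Inductive vexp : Type :=
  | VZero | VVar (n : nat) | VPlus (a b : vexp) | VMinus (a b : vexp)
  | VOpp (a : vexp) | VScal (c : C) (a : vexp).

Section VectorExpressions.

Context {V : NormedModule C_AbsRing}.

Fixpoint vden (env : list V) (e : vexp) : V :=
  match e with
  | VZero => zero
  | VVar n => nth n env zero
  | VPlus a b => plus (vden env a) (vden env b)
  | VMinus a b => minus (vden env a) (vden env b)
  | VOpp a => opp (vden env a)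
  | VScal c a => @scal C_Ring V c (vden env a)
  end.

Fixpoint vcoef (e : vexp) (i : nat) : C :=
  match e with
  | VZero => RtoC 0
  | VVar n => if Nat.eqb n i then RtoC 1 else RtoC 0
  | VPlus a b => Cplus (vcoef a i) (vcoef b i)
  | VMinus a b => Cminus (vcoef a i) (vcoef b i)
  | VOpp a => Copp (vcoef a i)
  | VScal c a => Cmult c (vcoef a i)
  end.

Fixpoint vcomb (f : nat -> C) (k : nat) (env : list V) : V :=
  match env with
  | nil => zero
  | x :: env' => plus (@scal C_Ring V (f k) x) (vcomb f (S k) env')
  end.

Lemma scal_plus_l (a b : C) (x : V) :
  @scal C_Ring V (Cplus a b) x = plus (@scal C_Ring V a x) (@scal C_Ring V b x).
Proof. apply (scal_distr_r (V := NormedModule.ModuleSpace C_AbsRing V) (a : C_Ring)). Qed.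

Lemma scal_plus_r (a : C) (x y : V) :
  @scal C_Ring V a (plus x y) = plus (@scal C_Ring V a x) (@scal C_Ring V a y).
Proof. apply (scal_distr_l (V := NormedModule.ModuleSpace C_AbsRing V) (a : C_Ring)). Qed.

Lemma scal_scal (a b : C) (x : V) :
  @scal C_Ring V a (@scal C_Ring V b x) = @scal C_Ring V (Cmult a b) x.
Proof. apply (scal_assoc (V := NormedModule.ModuleSpace C_AbsRing V) (a : C_Ring)). Qed.

Lemma scal_C1 (x : V) : @scal C_Ring V (RtoC 1) x = x.
Proof. apply (scal_one (V := NormedModule.ModuleSpace C_AbsRing V)). Qed.

Lemma scal_C0 (x : V) : @scal C_Ring V (RtoC 0) x = zero.
Proof. apply (scal_zero_l (V := NormedModule.ModuleSpace C_AbsRing V)). Qed.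

Lemma scal_z (a : C) : @scal C_Ring V a zero = zero.
Proof. apply (scal_zero_r (V := NormedModule.ModuleSpace C_AbsRing V) (a : C_Ring)). Qed.

Lemma opp_scal_m1 (x : V) : opp x = @scal C_Ring V (RtoC (-1)) x.
Proof.
  etransitivity; [symmetry; apply (scal_opp_one (V := NormedModule.ModuleSpace C_AbsRing V) x)|].
  f_equal; unfold opp, one; simpl; unfold Copp, RtoC; simpl; f_equal; ring.
Qed.

Lemma vcomb_plus f g k env :
  vcomb (fun i => Cplus (f i) (g i)) k env = plus (vcomb f k env) (vcomb g k env).
Proof.
  revert k; induction env as [|x env IH]; intro k; simpl.
  - by rewrite plus_zero_l.
  - rewrite IH scal_plus_l -!plus_assoc; f_equal.
    rewrite !plus_assoc; f_equal; apply plus_comm.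
Qed.

Lemma vcomb_scal c f k env :
  vcomb (fun i => Cmult c (f i)) k env = @scal C_Ring V c (vcomb f k env).
Proof.
  revert k; induction env as [|x env IH]; intro k; simpl.
  - by rewrite scal_z.
  - by rewrite IH scal_plus_r scal_scal.
Qed.

Lemma vcomb_ext f g k env :
  (forall i, (k <= i < k + length env)%nat -> f i = g i) -> vcomb f k env = vcomb g k env.
Proof.
  revert k; induction env as [|x env IH]; intros k E; simpl; auto.
  rewrite E; [|simpl; lia].
  f_equal; apply IH; intros i hi; apply E; simpl; lia.
Qed.

Lemma vcomb_zero k env : vcomb (fun _ => RtoC 0) k env = zero.
Proof.
  revert k; induction env as [|x env IH]; intro k; simpl; auto.
  by rewrite IH scal_C0 plus_zero_l.
Qed.

Lemma vcomb_delta n k env :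
  vcomb (fun i => if Nat.eqb (k + n) i then RtoC 1 else RtoC 0) k env = nth n env zero.
Proof.
  revert n k; induction env as [|x env IH]; intros n k; simpl.
  - now destruct n.
  - destruct n as [|n].
    + replace (k + 0)%nat with k by lia; rewrite Nat.eqb_refl scal_C1.
      rewrite (vcomb_ext _ (fun _ => RtoC 0)); [by rewrite vcomb_zero plus_zero_r|].
      intros i hi; destruct (Nat.eqb_spec k i); auto; lia.
    + replace (k + S n)%nat with (S k + n)%nat by lia.
      rewrite IH; destruct (Nat.eqb_spec (S k + n) k); [lia|].
      by rewrite scal_C0 plus_zero_l.
Qed.

Lemma vden_vcomb env e : vden env e = vcomb (vcoef e) 0 env.
Proof.
  induction e as [|n|a IHa b IHb|a IHa b IHb|a IHa|c a IHa]; simpl.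
  - by rewrite vcomb_zero.
  - symmetry; apply (vcomb_delta n 0).
  - by rewrite IHa IHb -vcomb_plus.
  - unfold minus; rewrite IHa IHb opp_scal_m1 -vcomb_scal -vcomb_plus.
    apply vcomb_ext; intros; ring.
  - rewrite IHa opp_scal_m1 -vcomb_scal; apply vcomb_ext; intros; ring.
  - by rewrite IHa -vcomb_scal.
Qed.

Fixpoint vall (P : nat -> Prop) (k n : nat) : Prop :=
  match n with O => True | S n' => P k /\ vall P (S k) n' end.

(** Equal coefficients at each atom give equal normal forms. [vall] replaces a quantifier because it
    computes to a finite conjunction, one scalar identity per atom. *)
Lemma vden_eq env e1 e2 :
  vall (fun i => vcoef e1 i = vcoef e2 i) 0 (length env) -> vden env e1 = vden env e2.
Proof.
  intro h; rewrite !vden_vcomb; apply vcomb_ext.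
  assert (G : forall n k, vall (fun i => vcoef e1 i = vcoef e2 i) k n ->
    forall i, (k <= i < k + n)%nat -> vcoef e1 i = vcoef e2 i).
  { induction n as [|n IH]; simpl; intros k H i hi; [lia|].
    destruct H as [H1 H2]; destruct (Nat.eq_dec i k) as [->|N]; auto.
    apply (IH (S k)); auto; lia. }
  intros i hi; now apply (G _ _ h).
Qed.

End VectorExpressions.

Ltac vin x env :=
  lazymatch env with
  | nil => false
  | x :: _ => true
  | _ :: ?e => vin x e
  end.

Ltac vatoms V env t :=
  lazymatch t with
  | @plus _ ?a ?b => let e := vatoms V env a in vatoms V e b
  | @minus _ ?a ?b => let e := vatoms V env a in vatoms V e b
  | @opp _ ?a => vatoms V env a
  | @scal _ _ ?c ?a => vatoms V env a
  | @zero _ => env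
  | ?x => let b := vin x env in
          lazymatch b with true => env | false => constr:(@cons V x env) end
  end.

Ltac vindex x env :=
  lazymatch env with
  | x :: _ => constr:(O)
  | _ :: ?e => let n := vindex x e in constr:(S n)
  end.

Ltac vreify env t :=
  lazymatch t with
  | @plus _ ?a ?b => let a' := vreify env a in let b' := vreify env b in constr:(VPlus a' b')
  | @minus _ ?a ?b => let a' := vreify env a in let b' := vreify env b in constr:(VMinus a' b')
  | @opp _ ?a => let a' := vreify env a in constr:(VOpp a')
  | @scal _ _ ?c ?a => let a' := vreify env a in constr:(VScal c a')
  | @zero _ => constr:(VZero)
  | ?x => let n := vindex x env in constr:(VVar n)
  end.

(** Compares coefficients by [ring], leaving to the user those where it fails. *)
Ltac vec_in V :=
  lazymatch goal with
  | |- ?l = ?r =>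
    let e0 := vatoms V (@nil V) l in
    let env := vatoms V e0 r in
    let l' := vreify env l in
    let r' := vreify env r in
    refine (vden_eq (V := V) env l' r' _);
    cbn [vall length vcoef Nat.eqb]; repeat split; try ring
  end.

(** * Hilbert spaces *)

Section NormedModules.

Context {V : NormedModule C_AbsRing}.

Lemma norm_scal_le (c : C) (x : V) : norm (@scal C_Ring V c x) <= Cmod c * norm x.
Proof. exact (norm_scal (K := C_AbsRing) c x). Qed.

(** The structure provides one inequality; applying it to the scalar [Cinv c] gives the reverse
    one. *)
Lemma norm_scal_eq (c : C) (x : V) : norm (@scal C_Ring V c x) = Cmod c * norm x.
Proof.
  apply Rle_antisym; [apply norm_scal_le|].
  destruct (Req_dec (Cmod c) 0) as [E|N].
  - rewrite E Rmult_0_l; apply norm_ge_0.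
  - assert (c <> RtoC 0) by (intro E; apply N; rewrite E; apply Cmod_0).
    pose proof (Cmod_ge_0 c).
    apply Rmult_le_reg_l with (/ Cmod c); [apply Rinv_0_lt_compat; lra|].
    rewrite -Rmult_assoc Rinv_l // Rmult_1_l -Cmod_inv //.
    eapply Rle_trans; [|apply norm_scal_le].
    rewrite scal_scal Cinv_l // scal_C1; lra.
Qed.

Lemma norm_minus_sym (x y : V) : norm (minus x y) = norm (minus y x).
Proof.
  replace (minus x y) with (@scal C_Ring V (RtoC (-1)) (minus y x)) by vec_in V.
  rewrite norm_scal_eq Cmod_R Rabs_Ropp Rabs_R1; ring.
Qed.

Lemma norm_plus_le (x y : V) : norm (plus x y) <= norm x + norm y.
Proof. exact (norm_triangle (K := C_AbsRing) x y). Qed.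

Lemma norm_minus_le (x y : V) : norm (minus x y) <= norm x + norm y.
Proof.
  eapply Rle_trans; [apply (norm_plus_le x (opp y))|].
  rewrite opp_scal_m1 norm_scal_eq Cmod_R Rabs_Ropp Rabs_R1; lra.
Qed.

Lemma norm_minus_trans (x y z : V) :
  norm (minus x z) <= norm (minus x y) + norm (minus y z).
Proof.
  replace (minus x z) with (plus (minus x y) (minus y z)) by vec_in V.
  apply norm_plus_le.
Qed.

Lemma norm_z : norm (zero : V) = 0.
Proof. exact (norm_zero (K := C_AbsRing)). Qed.

Lemma norm0_eq (x : V) : norm x = 0 -> x = zero.
Proof. exact (norm_eq_zero (K := C_AbsRing) x). Qed.

Lemma norm_pos (x : V) : x <> zero -> 0 < norm x.
Proof.
  intro N; destruct (norm_ge_0 x) as [?|E]; auto; exfalso; now apply N, norm0_eq.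
Qed.

Lemma norm_small_eq (x y : V) :
  (forall eps, 0 < eps -> norm (minus x y) <= eps) -> x = y.
Proof.
  intro h.
  assert (E : minus x y = zero).
  { apply (norm_eq_zero (K := C_AbsRing)).
    apply Rle_antisym; [|apply norm_ge_0].
    apply Rnot_lt_le; intro L; specialize (h (norm (minus x y) / 2)); lra. }
  transitivity (plus (minus x y) y); [vec_in V|].
  rewrite E; vec_in V.
Qed.

Lemma minus_zero_eq (x y : V) : minus x y = zero -> x = y.
Proof.
  intro E; transitivity (plus (minus x y) y); [vec_in V|]; rewrite E; vec_in V.
Qed.

End NormedModules.

Section BoundedOperators.

Context {U V : NormedModule C_AbsRing} (T : Bop U V).

Lemma bopD x y : T (plus x y) = plus (T x) (T y).
Proof. apply (bop_lin T). Qed.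

Lemma bopZ (c : C) x : T (@scal C_Ring U c x) = @scal C_Ring V c (T x).
Proof. apply (linear_scal _ (bop_lin T) (c : C_Ring)). Qed.

Lemma bop0 : T zero = zero.
Proof. rewrite -{1}(scal_C0 (zero : U)) bopZ; apply scal_C0. Qed.

Lemma bopN x : T (opp x) = opp (T x).
Proof. rewrite !opp_scal_m1; apply bopZ. Qed.

Lemma bopB x y : T (minus x y) = minus (T x) (T y).
Proof. unfold minus; by rewrite bopD bopN. Qed.

Lemma bop_le x : norm (T x) <= op_norm T * norm x.
Proof. apply op_norm_bound. Qed.

End BoundedOperators.

Lemma mk_linear_bop (U V : NormedModule C_AbsRing) (f : U -> V) (c : R) :
  (forall x y, f (plus x y) = plus (f x) (f y)) ->
  (forall (k : C) x, f (@scal C_Ring U k x) = @scal C_Ring V k (f x)) ->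
  (forall x, norm (f x) <= c * norm x) -> exists T : Bop U V, forall x, T x = f x.
Proof.
  intros a s b.
  assert (L : is_linear f).
  { split; auto. exists (Rabs c + 1); split; [pose proof (Rabs_pos c); lra|].
    intro x; eapply Rle_trans; [apply b|]; pose proof (norm_ge_0 x).
    apply Rmult_le_compat_r; auto; pose proof (Rle_abs c); lra. }
  now exists (mkBop f L).
Qed.

Lemma op_norm_comp {U V W : NormedModule C_AbsRing} (S : Bop V W) (T : Bop U V) :
  op_norm (bop_comp S T) <= op_norm S * op_norm T.
Proof.
  apply op_norm_le; split.
  - apply Rmult_le_pos; apply op_norm_ge_0.
  - intro x; simpl; eapply Rle_trans; [apply bop_le|].
    rewrite Rmult_assoc; apply Rmult_le_compat_l; [apply op_norm_ge_0 | apply bop_le].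
Qed.

Lemma is_linear_id (V : NormedModule C_AbsRing) : is_linear (fun x : V => x).
Proof.
  split; auto; exists 1; split; [lra|]; intro x; rewrite Rmult_1_l; apply Rle_refl.
Qed.

Definition bop_id (V : NormedModule C_AbsRing) : Bop V V := mkBop _ (is_linear_id V).

Lemma cauchy_limit (V : CompleteNormedModule C_AbsRing) (u : nat -> V) :
  (forall eps, 0 < eps -> exists N, forall n m, (N <= n)%nat -> (N <= m)%nat ->
     norm (minus (u n) (u m)) < eps) ->
  exists l : V, forall eps, 0 < eps -> exists N, forall n, (N <= n)%nat ->
     norm (minus (u n) l) < eps.
Proof.
  intro h.
  destruct (proj1 (filterlim_locally_cauchy (U := V) (F := eventually) u)) as [l L].
  - intro eps; destruct (h eps (cond_pos eps)) as [N HN].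
    exists (fun n => (N <= n)%nat); split; [now exists N|].
    intros n m hn hm; apply (norm_compat1 (K := C_AbsRing) (V := V)); auto.
  - exists l; intros eps he.
    pose proof (norm_factor_gt_0 (K := C_AbsRing) (V := V)) as nf.
    (* A uniform ball of radius [e] lies in the norm ball of radius [norm_factor * e], hence the
       rescaling. *)
    assert (hd : 0 < eps / (@norm_factor C_AbsRing V)) by (apply Rdiv_lt_0_compat; auto).
    destruct (proj1 (filterlim_locally u l) L (mkposreal _ hd)) as [N HN].
    exists N; intros n hn; specialize (HN n hn).
    apply (norm_compat2 (K := C_AbsRing) (V := V)) in HN; simpl in HN.
    replace (norm_factor * (eps / norm_factor)) with eps in HN by (field; lra).
    exact HN.
Qed.

Lemma Cmod_conj (z : C) : Cmod (Cconj z) = Cmod z.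
Proof. unfold Cmod, Cconj; simpl; f_equal; ring. Qed.

Lemma Cmult_conj_r (z : C) : Cmult z (Cconj z) = RtoC (Cmod z ^ 2).
Proof.
  rewrite Cmod2_alt; unfold Cmult, Cconj, RtoC, Re, Im; simpl; f_equal; ring.
Qed.

Lemma Cconj_plus (a b : C) : Cconj (Cplus a b) = Cplus (Cconj a) (Cconj b).
Proof. unfold Cconj, Cplus; simpl; f_equal; ring. Qed.

Lemma Cconj_mult (a b : C) : Cconj (Cmult a b) = Cmult (Cconj a) (Cconj b).
Proof. unfold Cconj, Cmult; simpl; f_equal; ring. Qed.

Lemma Cconj_Cconj (a : C) : Cconj (Cconj a) = a.
Proof. unfold Cconj; destruct a; simpl; f_equal; ring. Qed.

Lemma Cconj_RtoC (a : R) : Cconj (RtoC a) = RtoC a.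
Proof. unfold Cconj, RtoC; simpl; f_equal; ring. Qed.

(** Lemmas on normed modules, used in a Hilbert space, leave terms that are only
    convertible to those produced by the canonical structures of the latter. *)
Ltac paths :=
  change (CompleteNormedModule.AbelianGroup C_AbsRing ?h) with
    (NormedModule.AbelianGroup C_AbsRing (CompleteNormedModule.NormedModule C_AbsRing h)) in *;
  change (CompleteNormedModule.AbelianMonoid C_AbsRing ?h) with
    (NormedModule.AbelianMonoid C_AbsRing (CompleteNormedModule.NormedModule C_AbsRing h)) in *;
  change (CompleteNormedModule.ModuleSpace C_AbsRing ?h) with
    (NormedModule.ModuleSpace C_AbsRing (CompleteNormedModule.NormedModule C_AbsRing h)) in *;
  change (CompleteNormedModule.sort C_AbsRing ?h) with
    (NormedModule.sort C_AbsRing (CompleteNormedModule.NormedModule C_AbsRing h)) in *;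
  change (AbsRing.Ring C_AbsRing) with C_Ring in *.
Ltac plra := paths; lra.

Section HilbertBasics.

Context {H : HilbertSpace}.
Implicit Types x y z : H.

Lemma inner_plus_r x y z : inner x (plus y z) = Cplus (inner x y) (inner x z).
Proof.
  by rewrite inner_conj inner_plus_l Cconj_plus -!(inner_conj _ _ x).
Qed.

Lemma inner_scal_r (k : C) x y :
  inner x (@scal C_Ring H k y) = Cmult (Cconj k) (inner x y).
Proof. by rewrite inner_conj inner_scal_l Cconj_mult -(inner_conj _ _ x). Qed.

Lemma inner_zero_l x : inner zero x = RtoC 0.
Proof.
  rewrite -(scal_C0 (V := H) zero) inner_scal_l; ring.
Qed.

Lemma inner_zero_r x : inner x zero = RtoC 0.
Proof. rewrite inner_conj inner_zero_l; apply Cconj_RtoC. Qed.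

Lemma inner_opp_l x y : inner (opp x) y = Copp (inner x y).
Proof. rewrite (opp_scal_m1 (V := H)) inner_scal_l; unfold Cmult, Copp, RtoC; simpl; f_equal; ring. Qed.

Lemma inner_opp_r x y : inner x (opp y) = Copp (inner x y).
Proof.
  rewrite (opp_scal_m1 (V := H)) inner_scal_r Cconj_RtoC;
    unfold Cmult, Copp, RtoC; simpl; f_equal; ring.
Qed.

Lemma inner_minus_l x y z : inner (minus x y) z = Cminus (inner x z) (inner y z).
Proof. unfold minus; by rewrite inner_plus_l inner_opp_l. Qed.

Lemma inner_minus_r x y z : inner x (minus y z) = Cminus (inner x y) (inner x z).
Proof. unfold minus; by rewrite inner_plus_r inner_opp_r. Qed.

Lemma norm_sq_minus_scal (c : C) x y :
  norm (minus x (@scal C_Ring H c y)) ^ 2 =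
  norm x ^ 2 - 2 * Re (Cmult (Cconj c) (inner x y)) + Cmod c ^ 2 * norm y ^ 2.
Proof.
  assert (E : RtoC (norm (minus x (@scal C_Ring H c y)) ^ 2) =
     Cplus (Cminus (RtoC (norm x ^ 2))
       (Cplus (Cmult (Cconj c) (inner x y)) (Cconj (Cmult (Cconj c) (inner x y)))))
       (RtoC (Cmod c ^ 2 * norm y ^ 2))).
  { rewrite -inner_norm inner_minus_l !inner_minus_r !inner_scal_l !inner_scal_r
      !inner_norm Cconj_mult Cconj_Cconj -(inner_conj _ x y) RtoC_mult -Cmult_conj_r.
    ring. }
  apply (f_equal fst) in E; unfold Re.
  destruct (Cmult (Cconj c) (inner x y)) as [p q]; simpl in *; lra.
Qed.

Lemma inner_self_eq_0 x : inner x x = RtoC 0 -> x = zero.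
Proof.
  rewrite inner_norm; intro E; apply (norm0_eq (V := H)).
  apply (f_equal fst) in E; simpl in E.
  destruct (Req_dec (norm x) 0); auto; exfalso; nra.
Qed.

(** The scalar is that of the orthogonal projection of [x] on the line through [y]. Positivity of
    the left side yields Cauchy-Schwarz; the decrease when [inner x y] is nonzero yields the
    orthogonality of a minimizer. *)
Lemma norm_sq_minus_proj x y : y <> zero ->
  norm (minus x (@scal C_Ring H (Cdiv (inner x y) (RtoC (norm y ^ 2))) y)) ^ 2 =
  norm x ^ 2 - Cmod (inner x y) ^ 2 / norm y ^ 2.
Proof.
  intro ny; rewrite norm_sq_minus_scal.
  assert (N : norm y <> 0) by (intro E; apply ny; now apply (norm0_eq (V := H))).
  assert (N2 : norm y ^ 2 <> 0) by (apply pow_nonzero; auto).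
  unfold Cdiv; rewrite Cmod_mult Cconj_mult -RtoC_inv // Cconj_RtoC Cmod_R Rabs_right;
    last by apply Rle_ge, Rlt_le, Rinv_0_lt_compat; nra.
  replace (Re _) with (Cmod (inner x y) ^ 2 * / norm y ^ 2).
  - field; auto.
  - rewrite Cmod2_alt; unfold Re, Im; destruct (inner x y); simpl; ring.
Qed.

Lemma cauchy_schwarz x y : Cmod (inner x y) <= norm x * norm y.
Proof.
  destruct (excluded_middle_informative (y = zero)) as [->|N].
  - rewrite inner_zero_r Cmod_0 norm_z; lra.
  - pose proof (norm_sq_minus_proj x y N) as E.
    assert (0 < norm y).
    { destruct (norm_ge_0 y) as [?|E']; auto; exfalso; apply N.
      now apply (norm0_eq (V := H)). }
    pose proof (pow2_ge_0 (norm (minus x (@scal C_Ring H (Cdiv (inner x y) (RtoC (norm y ^ 2))) y)))) as P.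
    rewrite E in P.
    assert (Cmod (inner x y) ^ 2 <= (norm x * norm y) ^ 2).
    { replace (Cmod (inner x y) ^ 2) with (Cmod (inner x y) ^ 2 / norm y ^ 2 * norm y ^ 2) by (field; lra).
      rewrite Rpow_mult_distr; apply Rmult_le_compat_r; [apply pow2_ge_0 | lra]. }
    apply Rsqr_incr_0; rewrite ?Rsqr_pow2 //; [apply Cmod_ge_0|].
    apply Rmult_le_pos; apply norm_ge_0.
Qed.

Lemma inner_ext_l x y : (forall z, inner x z = inner y z) -> x = y.
Proof.
  intro h; apply (minus_zero_eq (V := H)), inner_self_eq_0.
  rewrite inner_minus_l h; ring.
Qed.

Lemma inner_ext_r x y : (forall z, inner z x = inner z y) -> x = y.
Proof.
  intro h; apply inner_ext_l; intro z; by rewrite inner_conj h -inner_conj.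
Qed.

Lemma parallelogram x y :
  norm (plus x y) ^ 2 + norm (minus x y) ^ 2 = 2 * norm x ^ 2 + 2 * norm y ^ 2.
Proof.
  assert (E : Cplus (RtoC (norm (plus x y) ^ 2)) (RtoC (norm (minus x y) ^ 2)) =
     Cplus (Cmult (RtoC 2) (RtoC (norm x ^ 2))) (Cmult (RtoC 2) (RtoC (norm y ^ 2)))).
  { rewrite -!inner_norm inner_minus_l !inner_minus_r inner_plus_l !inner_plus_r; ring. }
  apply (f_equal fst) in E; simpl in E; simpl; lra.
Qed.

(** The Cauchy estimate for a minimizing sequence. [a] and [b] are two nearly minimal distances, [q]
    is the norm of the sum of the two differences, at least [2 * d] since the midpoint competes, and
    [n] is the distance of the two points: [n ^ 2] is below [4 * (d + t) ^ 2 - 4 * d ^ 2], of order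
    [t]. *)
Lemma minimizing_arith (d a b q n t eps : R) :
  0 <= d -> 0 <= a -> 0 <= b -> a < d + t -> b < d + t -> 0 < t -> t <= 1 ->
  2 * d <= q -> q ^ 2 + n ^ 2 = 2 * a ^ 2 + 2 * b ^ 2 ->
  t * (16 * d + 16) <= eps ^ 2 -> 0 < eps -> n < eps.
Proof.
  intros.
  assert (a ^ 2 <= (d + t) ^ 2) by (apply pow_incr; lra).
  assert (b ^ 2 <= (d + t) ^ 2) by (apply pow_incr; lra).
  assert ((2 * d) ^ 2 <= q ^ 2) by (apply pow_incr; lra).
  apply Rnot_le_lt; intro L.
  assert (eps ^ 2 <= n ^ 2) by (apply pow_incr; lra).
  assert (t * t <= t) by nra.
  nra.
Qed.

(** [W] need not be closed, so [p] is only approximated from [W]. In this form the lemma applies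
    both to the kernel of a functional and to the vectors fixed by a finite expansion. *)
Lemma ortho_projection (W : H -> Prop) :
  W zero -> (forall x y, W x -> W y -> W (plus x y)) ->
  (forall (c : C) x, W x -> W (@scal C_Ring H c x)) ->
  forall x, exists p,
    (forall eps, 0 < eps -> exists w, W w /\ norm (minus w p) < eps) /\
    (forall w, W w -> inner (minus x p) w = RtoC 0).
Proof.
  intros W0 Wp Ws x.
  set (E := fun r => exists w, W w /\ r = norm (minus x w)).
  (* The infimum of the distances is minus the supremum of their opposites. *)
  destruct (completeness (fun r => E (- r))) as [m [m1 m2]].
  { exists 0; intros r [w [_ hr]]; pose proof (norm_ge_0 (minus x w)); lra. }
  { exists (- norm (minus x zero)), zero; split; auto; apply Ropp_involutive. }
  set (d := - m).
  assert (lo : forall w, W w -> d <= norm (minus x w)).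
  { intros w hw; assert (- norm (minus x w) <= m); [|unfold d; lra].
    apply m1; exists w; split; auto; ring. }
  assert (hi : forall eps, 0 < eps -> exists w, W w /\ norm (minus x w) < d + eps).
  { intros eps he; apply NNPP; intro N.
    assert (m <= m - eps); [|lra].
    apply m2; intros r [w [hw hr]]; apply Rnot_lt_le; intro L.
    apply N; exists w; split; auto; unfold d; lra. }
  assert (d0 : 0 <= d).
  { apply Rnot_lt_le; intro L; destruct (hi (- d)) as [w [_ hw]]; [lra|].
    pose proof (norm_ge_0 (minus x w)); lra. }
  assert (hs : forall n : nat, exists w, W w /\ norm (minus x w) < d + / (INR n + 1)).
  { intro n; apply hi, Rinv_0_lt_compat; pose proof (pos_INR n); lra. }
  pose (u := fun n => proj1_sig (constructive_indefinite_description _ (hs n))).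
  assert (hu : forall n, W (u n) /\ norm (minus x (u n)) < d + / (INR n + 1)).
  { intro n; unfold u; exact (proj2_sig (constructive_indefinite_description _ (hs n))). }
  clearbody u.
  assert (hinv : forall N n : nat, (N <= n)%nat -> 0 < / (INR n + 1) <= / (INR N + 1)).
  { intros N n hn; apply le_INR in hn; pose proof (pos_INR N); split.
    - apply Rinv_0_lt_compat; lra.
    - apply Rinv_le_contravar; lra. }
  destruct (cauchy_limit H u) as [p hp].
  { intros eps he.
    set (t := Rmin 1 (eps ^ 2 / (16 * d + 16))).
    assert (ht : 0 < t) by (apply Rmin_pos; [lra | apply Rdiv_lt_0_compat; nra]).
    assert (ht2 : t * (16 * d + 16) <= eps ^ 2).
    { replace (eps ^ 2) with (eps ^ 2 / (16 * d + 16) * (16 * d + 16)) by (field; lra).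
      apply Rmult_le_compat_r; [lra | apply Rmin_r]. }
    destruct (INR_unbounded (/ t)) as [N hN].
    exists N; intros n k hn hk.
    pose proof (hinv N n hn) as [a1 a2]; pose proof (hinv N k hk) as [b1 b2].
    assert (hNt : / (INR N + 1) <= t).
    { rewrite -(Rinv_inv t); apply Rinv_le_contravar; [apply Rinv_0_lt_compat; auto | lra]. }
    destruct (hu n) as [wn nn], (hu k) as [wk nk].
    pose proof (parallelogram (minus x (u n)) (minus x (u k))) as P.
    replace (minus (minus x (u n)) (minus x (u k))) with (minus (u k) (u n)) in P by vec_in H.
    assert (Q : 2 * d <= norm (plus (minus x (u n)) (minus x (u k)))).
    { replace (plus (minus x (u n)) (minus x (u k))) with
       (@scal C_Ring H (RtoC 2) (minus x (@scal C_Ring H (RtoC (/2)) (plus (u n) (u k))))).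
      - rewrite norm_scal_eq Cmod_R Rabs_right; last lra.
        apply Rmult_le_compat_l; [lra|]; apply lo; auto.
      - assert (E2 : RtoC (/ 2) = Cinv (RtoC 2)) by (apply RtoC_inv; lra).
        rewrite E2; vec_in H; field; intro A; apply (f_equal fst) in A; simpl in A; lra. }
    rewrite (norm_minus_sym (V := H)).
    refine (minimizing_arith d _ _ _ _ t eps d0 (norm_ge_0 (minus x (u n)))
      (norm_ge_0 (minus x (u k))) _ _ ht (Rmin_l _ _) Q P ht2 he); lra. }
  exists p; split.
  { intros eps he; destruct (hp eps he) as [N hN]; exists (u N); split; [apply hu | apply hN; lia]. }
  assert (dp : norm (minus x p) <= d).
  { apply le_epsilon; intros eps he.
    destruct (hp (eps / 2)) as [N hN]; [lra|].
    destruct (INR_unbounded (/ (eps / 2))) as [N' hN'].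
    set (n := max N N').
    specialize (hN n ltac:(lia)); destruct (hu n) as [_ L].
    pose proof (norm_minus_trans (V := H) x (u n) p).
    assert (/ (INR n + 1) <= eps / 2); [|plra].
    assert (INR N' <= INR n) by (apply le_INR; lia).
    rewrite -(Rinv_inv (eps / 2)); apply Rinv_le_contravar; [apply Rinv_0_lt_compat; lra | lra]. }
  assert (low : forall w, W w -> d <= norm (minus (minus x p) w)).
  { intros w hw; apply le_epsilon; intros eps he.
    destruct (hp eps he) as [N hN]; specialize (hN N ltac:(lia)).
    pose proof (lo (plus (u N) w) (Wp _ _ (proj1 (hu N)) hw)) as L.
    assert (L2 : norm (minus x (plus (u N) w)) <= norm (minus (minus x p) w) + norm (minus (u N) p)).
    { replace (minus x (plus (u N) w)) with (minus (minus (minus x p) w) (minus (u N) p)) by vec_in H.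
      apply (norm_minus_le (V := H)). }
    lra. }
  intros w hw.
  destruct (excluded_middle_informative (w = zero)) as [->|nw]; [apply inner_zero_r|].
  pose proof (norm_sq_minus_proj (minus x p) w nw) as Q.
  (* Subtracting from [minus x p] its projection on [w] would bring the norm below [d] unless the
     inner product vanishes. *)
  pose proof (low _ (Ws (Cdiv (inner (minus x p) w) (RtoC (norm w ^ 2))) w hw)) as L.
  assert (nw0 : 0 < norm w).
  { destruct (norm_ge_0 w) as [?|E']; auto; exfalso; apply nw.
    now apply (norm0_eq (V := H)). }
  assert (nw2 : 0 < norm w ^ 2) by nra.
  assert (Z : Cmod (inner (minus x p) w) ^ 2 / norm w ^ 2 <= 0).
  { pose proof (pow_incr _ _ 2 (conj d0 L)) as L1; rewrite Q in L1.
    pose proof (pow_incr _ _ 2 (conj (norm_ge_0 (minus x p)) dp)) as L2.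
    plra. }
  assert (Z' : Cmod (inner (minus x p) w) ^ 2 <= 0).
  { replace (Cmod (inner (minus x p) w) ^ 2) with
      (Cmod (inner (minus x p) w) ^ 2 / norm w ^ 2 * norm w ^ 2) by (field; lra).
    nra. }
  apply Cmod_eq_0; pose proof (Cmod_ge_0 (inner (minus x p) w)); nra.
Qed.

End HilbertBasics.

(** * Geometric convergence, Neumann series, automatic boundedness *)

Lemma pow_small (q c eps : R) : 0 <= q < 1 -> 0 < eps ->
  exists N, forall n, (N <= n)%nat -> c * q ^ n < eps.
Proof.
  intros hq he.
  destruct (pow_lt_1_zero q ltac:(rewrite Rabs_right; lra) (eps / (Rabs c + 1))) as [N hN].
  { apply Rdiv_lt_0_compat; pose proof (Rabs_pos c); lra. }
  exists N; intros n hn; specialize (hN n ltac:(lia)).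
  pose proof (pow_le q n (proj1 hq)) as P; rewrite Rabs_right in hN; [|lra].
  pose proof (Rabs_pos c); pose proof (Rle_abs c).
  apply Rle_lt_trans with ((Rabs c + 1) * q ^ n); [nra|].
  apply Rmult_lt_reg_r with (/ (Rabs c + 1)); [apply Rinv_0_lt_compat; lra|].
  replace ((Rabs c + 1) * q ^ n * / (Rabs c + 1)) with (q ^ n) by (field; lra); exact hN.
Qed.

(** Summing the geometric tail gives the rate. The explicit distance to the limit matters later: it
    is what keeps a gliding hump from being undone by the subsequent moves. *)
Lemma geometric_limit (V : CompleteNormedModule C_AbsRing) (u : nat -> V) (c q : R) :
  0 <= q < 1 -> (forall n, norm (minus (u (S n)) (u n)) <= c * q ^ n) ->
  exists l : V, forall n, norm (minus (u n) l) <= c * q ^ n / (1 - q).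
Proof.
  intros hq hu.
  assert (c0 : 0 <= c).
  { specialize (hu 0%nat); simpl in hu; pose proof (norm_ge_0 (minus (u 1%nat) (u 0%nat))); lra. }
  assert (B : forall n k, norm (minus (u (n + k)%nat) (u n)) <= c * q ^ n / (1 - q)).
  { intros n k.
    assert (G : norm (minus (u (n + k)%nat) (u n)) <= c * q ^ n * ((1 - q ^ k) / (1 - q))).
    { induction k as [|k IH].
      - replace (n + 0)%nat with n by lia.
        replace (minus (u n) (u n)) with (zero : V) by vec_in V.
        rewrite (norm_z (V := V)); simpl; unfold Rdiv; rewrite Rminus_diag; lra.
      - replace (n + S k)%nat with (S (n + k)) by lia.
        pose proof (norm_minus_trans (V := V) (u (S (n + k))) (u (n + k)%nat) (u n)).
        specialize (hu (n + k)%nat); rewrite pow_add in hu.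
        replace (c * q ^ n * ((1 - q ^ S k) / (1 - q))) with
          (c * (q ^ n * q ^ k) + c * q ^ n * ((1 - q ^ k) / (1 - q))) by (simpl; field; lra).
        eapply Rle_trans; [eassumption|]; apply Rplus_le_compat; [exact hu | exact IH]. }
    eapply Rle_trans; [exact G|]; unfold Rdiv at 2; apply Rmult_le_compat_l.
    - apply Rmult_le_pos; auto; apply pow_le; lra.
    - pose proof (pow_le q k (proj1 hq)).
      assert (0 < / (1 - q)) by (apply Rinv_0_lt_compat; lra).
      unfold Rdiv; nra. }
  destruct (cauchy_limit V u) as [l hl].
  { intros eps he.
    destruct (pow_small q (c / (1 - q)) (eps / 2) hq ltac:(lra)) as [N hN].
    exists N; intros n m hn hm.
    specialize (hN N ltac:(lia)).
    assert (X : forall k, (N <= k)%nat -> norm (minus (u k) (u N)) <= c * q ^ N / (1 - q)).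
    { intros k hk; replace k with (N + (k - N))%nat by lia; apply B. }
    pose proof (X n hn) as X1; pose proof (X m hm) as X2.
    rewrite (norm_minus_sym (V := V)) in X2.
    pose proof (norm_minus_trans (V := V) (u n) (u N) (u m)) as X3.
    replace (c / (1 - q) * q ^ N) with (c * q ^ N / (1 - q)) in hN by (field; lra).
    eapply Rle_lt_trans; [exact X3|].
    apply Rlt_le_trans with (eps / 2 + eps / 2); [|lra].
    apply Rplus_lt_compat; (eapply Rle_lt_trans; [|exact hN]); assumption. }
  exists l; intro n; apply le_epsilon; intros eps he.
  destruct (hl eps he) as [N hN]; specialize (hN (n + N)%nat ltac:(lia)).
  pose proof (norm_minus_trans (V := V) (u n) (u (n + N)%nat) l) as X.
  pose proof (B n N) as Y; rewrite (norm_minus_sym (V := V)) in Y.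
  eapply Rle_trans; [exact X|]; apply Rplus_le_compat; [exact Y | apply Rlt_le; exact hN].
Qed.

(** The equation [x - S x = y] is solved by the iteration of [x |-> y + S x]. The lower bound [lo]
    gives at once injectivity, from which linearity of the inverse follows, and the bound [2] for
    its norm. *)
Lemma neumann_inverse (V : CompleteNormedModule C_AbsRing) (S : Bop V V) :
  op_norm S <= / 2 ->
  exists N : Bop V V, (forall x, N (minus x (S x)) = x) /\
    (forall x, minus (N x) (S (N x)) = x).
Proof.
  intro hS.
  assert (hSx : forall x, norm (S x) <= / 2 * norm x).
  { intro x; eapply Rle_trans; [apply bop_le|]; apply Rmult_le_compat_r; auto; apply norm_ge_0. }
  assert (lo : forall x : V, norm x <= 2 * norm (minus x (S x))).
  { intro x.
    assert (norm x <= norm (minus x (S x)) + norm (S x)).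
    { replace x with (plus (minus x (S x)) (S x)) at 1 by vec_in V; apply (norm_plus_le (V := V)). }
    specialize (hSx x); paths; lra. }
  assert (inj : forall x y : V, minus x (S x) = minus y (S y) -> x = y).
  { intros x y E; apply (minus_zero_eq (V := V)), (norm0_eq (V := V)).
    pose proof (lo (minus x y)) as L; rewrite bopB in L.
    replace (minus (minus x y) (minus (S x) (S y))) with
      (minus (minus x (S x)) (minus y (S y))) in L by vec_in V.
    rewrite E in L.
    replace (minus (minus y (S y)) (minus y (S y))) with (zero : V) in L by vec_in V.
    rewrite (norm_z (V := V)) in L; pose proof (norm_ge_0 (minus x y)); paths; lra. }
  assert (sur : forall y : V, exists x, minus x (S x) = y).
  { intro y.
    pose (u := fix u n := match n with O => (zero : V) | Datatypes.S m => plus y (S (u m)) end).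
    destruct (geometric_limit V u (norm y) (/ 2)) as [l hl]; [lra| |].
    { induction n as [|n IH].
      - simpl; rewrite bop0; apply Req_le; rewrite Rmult_1_r; f_equal; vec_in V.
      - change (u (Datatypes.S (Datatypes.S n))) with (plus y (S (u (Datatypes.S n)))).
        change (u (Datatypes.S n)) with (plus y (S (u n))) at 2.
        apply Rle_trans with (norm (S (minus (u (Datatypes.S n)) (u n)))).
        { apply Req_le; f_equal; rewrite bopB; vec_in V. }
        eapply Rle_trans; [apply hSx|]; simpl pow; paths; nra. }
    exists l; apply (norm_small_eq (V := V)); intros eps he.
    destruct (pow_small (/ 2) (norm y) (eps / 4) ltac:(lra) ltac:(lra)) as [N hN].
    pose proof (hl N) as l1; pose proof (hl (Datatypes.S N)) as l2.
    specialize (hN N ltac:(lia)).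
    assert (E : norm (minus (minus l (S l)) y) <=
       norm (minus (u (Datatypes.S N)) l) + norm (S (minus (u N) l))).
    { rewrite bopB; change (u (Datatypes.S N)) with (plus y (S (u N))).
      eapply Rle_trans; [|apply (norm_minus_le (V := V))].
      eapply Rle_trans; [apply Req_le, (norm_minus_sym (V := V))|].
      apply Req_le; f_equal; vec_in V. }
    specialize (hSx (minus (u N) l)); simpl pow in l2.
    pose proof (norm_ge_0 (minus (u N) l)).
    replace (norm y * (/ 2 * (/ 2) ^ N) / (1 - / 2)) with (norm y * (/2) ^ N) in l2 by field.
    replace (norm y * (/ 2) ^ N / (1 - / 2)) with (2 * (norm y * (/2) ^ N)) in l1 by field.
    paths; lra. }
  pose (f := fun y => proj1_sig (constructive_indefinite_description _ (sur y))).
  assert (hf : forall y : V, minus (f y) (S (f y)) = y).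
  { intro y; exact (proj2_sig (constructive_indefinite_description _ (sur y))). }
  clearbody f.
  destruct (mk_linear_bop V V f 2) as [N hN].
  - intros x y; apply inj; rewrite hf bopD -{1}(hf x) -{1}(hf y); vec_in V.
  - intros k x; apply inj; rewrite hf bopZ -{1}(hf x); vec_in V.
  - intro x; rewrite -{2}(hf x); apply lo.
  - exists N; split; intro x; rewrite !hN; [apply inj, hf | apply hf].
Qed.

(** Take a vector outside the kernel and remove its projection [p], which stays in the kernel
    because [f] is bounded. The remainder [u] is orthogonal to the kernel, in particular to
    [x - (f x / f u) u], and this orthogonality is the representation up to a scalar. *)
Lemma riesz_representation (H : HilbertSpace) (f : H -> C) (c : R) :
  (forall x y, f (plus x y) = Cplus (f x) (f y)) ->
  (forall (k : C) x, f (@scal C_Ring H k x) = Cmult k (f x)) ->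
  (forall x, Cmod (f x) <= c * norm x) -> exists a, forall x, f x = inner x a.
Proof.
  intros fp fs fb.
  destruct (classic (forall x, f x = RtoC 0)) as [Z|NZ].
  { exists zero; intro x; by rewrite Z inner_zero_r. }
  apply not_all_ex_not in NZ as [x0 hx0].
  assert (f0 : f zero = RtoC 0).
  { rewrite -(scal_C0 (V := H) zero) fs; ring. }
  assert (fm : forall x y, f (minus x y) = Cminus (f x) (f y)).
  { intros x y; unfold minus; rewrite fp (opp_scal_m1 (V := H)) fs.
    unfold Cminus, Cplus, Cmult, Copp, RtoC; simpl; f_equal; ring. }
  destruct (ortho_projection (fun x => f x = RtoC 0)) with (x := x0) as [p [hp ho]]; auto.
  { intros x y hx hy; rewrite fp hx hy; ring. }
  { intros k x hx; rewrite fs hx; ring. }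
  assert (fp0 : f p = RtoC 0).
  { apply Cmod_eq_0, Rle_antisym; [|apply Cmod_ge_0].
    apply le_epsilon; intros eps he.
    destruct (hp (eps / (Rabs c + 1))) as [w [hw hn]].
    { apply Rdiv_lt_0_compat; pose proof (Rabs_pos c); lra. }
    pose proof (fb (minus w p)) as B; rewrite fm hw in B.
    replace (Cmod (Cminus (RtoC 0) (f p))) with (Cmod (f p)) in B.
    - pose proof (norm_ge_0 (minus w p)); pose proof (Rle_abs c); pose proof (Rabs_pos c).
      apply Rmult_lt_compat_r with (r := Rabs c + 1) in hn; [|lra].
      replace (eps / (Rabs c + 1) * (Rabs c + 1)) with eps in hn by (field; lra).
      paths; nra.
    - rewrite -(Cmod_opp (f p)); f_equal; ring. }
  set (u := minus x0 p) in *.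
  assert (fu : f u <> RtoC 0).
  { unfold u; rewrite fm fp0; intro E; apply hx0; rewrite -E; ring. }
  assert (nu : u <> zero) by (intro E; apply fu; by rewrite E).
  assert (nn : norm u ^ 2 <> 0) by (apply pow_nonzero; pose proof (norm_pos (V := H) u nu); paths; lra).
  assert (nn' : RtoC (norm u ^ 2) <> RtoC 0) by (intro E; apply (f_equal fst) in E; apply nn; exact E).
  exists (@scal C_Ring H (Cdiv (Cconj (f u)) (RtoC (norm u ^ 2))) u); intro x.
  assert (E : inner u (minus x (@scal C_Ring H (Cdiv (f x) (f u)) u)) = RtoC 0).
  { apply ho; rewrite fm fs; field; auto. }
  rewrite inner_conj in E; apply (f_equal Cconj) in E; rewrite Cconj_Cconj Cconj_RtoC in E.
  rewrite inner_minus_l inner_scal_l inner_norm in E.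
  rewrite inner_scal_r; unfold Cdiv.
  rewrite Cconj_mult Cconj_Cconj -RtoC_inv // Cconj_RtoC RtoC_inv //.
  replace (inner x u) with (Cmult (Cdiv (f x) (f u)) (RtoC (norm u ^ 2))).
  - field; auto.
  - transitivity (Cminus (inner x u) (RtoC 0)); [rewrite -E|]; ring.
Qed.

Lemma adjoint_exists (U V : HilbertSpace) (T : Bop U V) :
  exists S : Bop V U, forall x y, inner (T x) y = inner x (S y).
Proof.
  assert (ex : forall y, exists a, forall x, inner (T x) y = inner x a).
  { intro y; apply (riesz_representation U (fun x => inner (T x) y) (op_norm T * norm y)).
    - intros; by rewrite bopD inner_plus_l.
    - intros; by rewrite bopZ inner_scal_l.
    - intro x; eapply Rle_trans; [apply cauchy_schwarz|].
      apply Rle_trans with (op_norm T * norm x * norm y); [|apply Req_le; ring].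
      apply Rmult_le_compat_r; [apply norm_ge_0 | apply bop_le]. }
  pose (f := fun y => proj1_sig (constructive_indefinite_description _ (ex y))).
  assert (hf : forall x y, inner (T x) y = inner x (f y)).
  { intros x y; exact (proj2_sig (constructive_indefinite_description _ (ex y)) x). }
  clearbody f.
  destruct (mk_linear_bop V U f (op_norm T)) as [S hS].
  - intros x y; apply inner_ext_r; intro z; by rewrite -hf !inner_plus_r !hf.
  - intros k x; apply inner_ext_r; intro z; by rewrite -hf !inner_scal_r !hf.
  (* The square of [norm (f y)] is [inner (T (f y)) y], at most [op_norm T * norm (f y) * norm y];
     the common factor is cancelled by contradiction. *)
  - intro y; apply Rnot_lt_le; intro L.
    assert (P : norm (f y) ^ 2 <= op_norm T * norm (f y) * norm y).
    { assert (E : Cmod (inner (f y) (f y)) = norm (f y) ^ 2).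
      { rewrite inner_norm Cmod_R Rabs_right //; apply Rle_ge, pow2_ge_0. }
      rewrite -E -hf; eapply Rle_trans; [apply cauchy_schwarz|].
      apply Rmult_le_compat_r; [apply norm_ge_0 | apply bop_le]. }
    pose proof (Rmult_le_pos _ _ (op_norm_ge_0 T) (norm_ge_0 y)) as Q; paths.
    pose proof (Rmult_lt_0_compat (norm (f y)) (norm (f y) - op_norm T * norm y)
      ltac:(lra) ltac:(lra)).
    lra.
  - exists S; intros; by rewrite hS.
Qed.

Definition bop_adj {U V : HilbertSpace} (T : Bop U V) : Bop V U :=
  proj1_sig (constructive_indefinite_description _ (adjoint_exists U V T)).

Lemma bop_adjP {U V : HilbertSpace} (T : Bop U V) x y : inner (T x) y = inner x (bop_adj T y).
Proof. exact (proj2_sig (constructive_indefinite_description _ (adjoint_exists U V T)) x y). Qed.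

(** Moving away from [x] by [r] in the direction [v] or in the opposite one. *)
Lemma inner_large_nearby (H : HilbertSpace) (x v : H) (r : R) : 0 <= r ->
  exists x', norm (minus x' x) <= r /\ r * norm v <= Cmod (inner x' v).
Proof.
  intro hr.
  destruct (excluded_middle_informative (v = zero)) as [->|nv].
  { exists x; split.
    - replace (minus x x) with (zero : H) by vec_in H; rewrite (norm_z (V := H)); lra.
    - rewrite (norm_z (V := H)) inner_zero_r Cmod_0; lra. }
  pose proof (norm_pos (V := H) v nv) as pv.
  set (e := @scal C_Ring H (RtoC (r / norm v)) v).
  assert (he : norm e = r).
  { unfold e; rewrite (norm_scal_eq (V := H)) Cmod_R Rabs_right; [field; lra|].
    apply Rle_ge, Rmult_le_pos; auto; apply Rlt_le, Rinv_0_lt_compat; auto. }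
  assert (iev : inner e v = RtoC (r * norm v)).
  { unfold e; rewrite inner_scal_l inner_norm -RtoC_mult; f_equal; field; lra. }
  destruct (Rle_dec (r * norm v) (Cmod (inner (plus x e) v))) as [L|L].
  - exists (plus x e); split; auto.
    replace (minus (plus x e) x) with e by vec_in H; lra.
  - exists (minus x e); split.
    + replace (minus (minus x e) x) with (@scal C_Ring H (RtoC (-1)) e) by vec_in H.
      rewrite (norm_scal_eq (V := H)) Cmod_R Rabs_Ropp Rabs_R1 he; lra.
    + rewrite inner_plus_l iev in L; rewrite inner_minus_l iev.
      pose proof (Cmod_triangle (Cplus (inner x v) (RtoC (r * norm v)))
        (Copp (Cminus (inner x v) (RtoC (r * norm v))))) as T.
      rewrite Cmod_opp in T.
      replace (Cplus (Cplus (inner x v) (RtoC (r * norm v)))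
         (Copp (Cminus (inner x v) (RtoC (r * norm v))))) with (RtoC (2 * (r * norm v))) in T.
      * rewrite Cmod_R Rabs_right in T; [lra | apply Rle_ge; nra].
      * rewrite RtoC_mult; ring.
Qed.

(** If [g] were unbounded, a point [x] built by a gliding hump would have
    [inner x (g y) = inner (f x) y] unbounded over unit vectors [y]. *)
Lemma hellinger_toeplitz_aux (U V : HilbertSpace) (f : U -> V) (g : V -> U) :
  (forall x y, inner (f x) y = inner x (g y)) ->
  exists c, forall y, norm y <= 1 -> norm (g y) <= c.
Proof.
  intro fg; apply NNPP; intro N.
  (* Growth [4 ^ n] against moves of size [3 ^ -n]: all moves after the n-th add up to at most half
     of it, so that [inner x (g (y n))] keeps a size of at least [(4 / 3) ^ n / 2]. *)
  assert (hy : forall n : nat, exists y, norm y <= 1 /\ 4 ^ n < norm (g y)).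
  { intro n; apply NNPP; intro N'; apply N; exists (4 ^ n); intros y hy.
    apply Rnot_lt_le; intro L; apply N'; now exists y. }
  pose (y := fun n => proj1_sig (constructive_indefinite_description _ (hy n))).
  assert (yP : forall n, norm (y n) <= 1 /\ 4 ^ n < norm (g (y n))).
  { intro n; exact (proj2_sig (constructive_indefinite_description _ (hy n))). }
  clearbody y.
  assert (r3 : forall n : nat, 0 <= (/ 3) ^ n) by (intro n; apply pow_le; lra).
  pose (st := fun n x => proj1_sig (constructive_indefinite_description _
      (inner_large_nearby U x (g (y n)) ((/ 3) ^ n) (r3 n)))).
  assert (stP : forall n x, norm (minus (st n x) x) <= (/ 3) ^ n /\
      (/ 3) ^ n * norm (g (y n)) <= Cmod (inner (st n x) (g (y n)))).
  { intros n x; exact (proj2_sig (constructive_indefinite_description _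
      (inner_large_nearby U x (g (y n)) ((/ 3) ^ n) (r3 n)))). }
  clearbody st.
  pose (u := fix u n := match n with O => (zero : U) | S m => st m (u m) end).
  destruct (geometric_limit U u 1 (/ 3)) as [x hx]; [lra| |].
  { intro n; rewrite Rmult_1_l; apply stP. }
  destruct (Pow_x_infinity (4 / 3) ltac:(rewrite Rabs_right; lra) (2 * norm (f x) + 1)) as [n hn].
  specialize (hn n (le_n n)); rewrite Rabs_right in hn; [|apply Rle_ge, pow_le; lra].
  destruct (yP n) as [y1 y2]; specialize (hx (S n)).
  destruct (stP n (u n)) as [_ lo]; change (st n (u n)) with (u (S n)) in lo.
  assert (A : Cmod (inner x (g (y n))) <= norm (f x)).
  { rewrite -fg; eapply Rle_trans; [apply cauchy_schwarz|].
    pose proof (norm_ge_0 (f x)); paths; nra. }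
  assert (B : Cmod (inner (minus (u (S n)) x) (g (y n))) <= (/ 3) ^ n / 2 * norm (g (y n))).
  { eapply Rle_trans; [apply cauchy_schwarz|]; apply Rmult_le_compat_r; [apply norm_ge_0|].
    eapply Rle_trans; [exact hx|]; simpl; apply Req_le; field. }
  assert (D : Cmod (inner (u (S n)) (g (y n))) <=
     Cmod (inner x (g (y n))) + Cmod (inner (minus (u (S n)) x) (g (y n)))).
  { eapply Rle_trans; [|apply Cmod_triangle]; apply Req_le; f_equal.
    rewrite inner_minus_l; ring. }
  assert (E : (4 / 3) ^ n <= (/ 3) ^ n * norm (g (y n))).
  { replace ((4 / 3) ^ n) with ((/ 3) ^ n * 4 ^ n) by (rewrite -Rpow_mult_distr; f_equal; lra).
    apply Rmult_le_compat_l; auto; lra. }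
  paths; lra.
Qed.

(** The pairing also forces linearity, so [f] and [g] may be obtained by choosing solutions
    pointwise. The auxiliary lemma is used with the roles exchanged, and its bound on the unit ball
    is rescaled. *)
Lemma hellinger_toeplitz (U V : HilbertSpace) (f : U -> V) (g : V -> U) :
  (forall x y, inner (f x) y = inner x (g y)) -> exists T : Bop U V, forall x, T x = f x.
Proof.
  intro fg.
  assert (fp : forall x y, f (plus x y) = plus (f x) (f y)).
  { intros x y; apply inner_ext_l; intro z; by rewrite fg !inner_plus_l !fg. }
  assert (fs : forall (k : C) x, f (@scal C_Ring U k x) = @scal C_Ring V k (f x)).
  { intros k x; apply inner_ext_l; intro z; by rewrite fg !inner_scal_l !fg. }
  destruct (hellinger_toeplitz_aux V U g f) as [c hc].
  { intros y x; rewrite inner_conj -fg -inner_conj //. }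
  apply (mk_linear_bop U V f c); auto.
  intro x; destruct (excluded_middle_informative (x = zero)) as [->|nx].
  - rewrite (_ : f zero = (zero : V)).
    + rewrite (norm_z (V := V)) (norm_z (V := U)); lra.
    + rewrite -{1}(scal_C0 (V := U) zero) fs; apply (scal_C0 (V := V)).
  - pose proof (norm_pos (V := U) x nx) as px.
    specialize (hc (@scal C_Ring U (RtoC (/ norm x)) x)).
    assert (p' : 0 < / norm x) by now apply Rinv_0_lt_compat.
    rewrite fs (norm_scal_eq (V := U)) (norm_scal_eq (V := V)) Cmod_R Rabs_right in hc; [|lra].
    assert (L : / norm x * norm (f x) <= c) by (apply hc; apply Req_le; field; lra).
    apply Rmult_le_compat_r with (r := norm x) in L; [|lra].
    replace (/ norm x * norm (f x) * norm x) with (norm (f x)) in L by (field; lra).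
    exact L.
Qed.

(** * Finite rank operators and their traces *)

(** [rank_sum [(a_1, b_1); ...]] is the operator [sum_i (., a_i) b_i], and
    [trace_sum] the candidate [sum_i (b_i, a_i)] for its trace. *)
Fixpoint rank_sum {U V : HilbertSpace} (l : list (U * V)) (x : U) : V :=
  match l with
  | nil => zero
  | p :: l' => plus (@scal C_Ring V (inner x (fst p)) (snd p)) (rank_sum l' x)
  end.

Definition csum {X : Type} (f : X -> C) (l : list X) : C :=
  fold_right (fun p s => Cplus (f p) s) (RtoC 0) l.

Definition trace_sum {H : HilbertSpace} (l : list (H * H)) : C :=
  csum (fun p => inner (snd p) (fst p)) l.

Definition has_rank_sum {U V : HilbertSpace} (T : Bop U V) : Prop :=
  exists l, forall x, T x = rank_sum l x.

(** A relation, since the value is read off a representation; [ftrace_unique] shows that it depends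
    on the operator alone. *)
Definition ftrace {H : HilbertSpace} (T : Bop H H) (t : C) : Prop :=
  exists l, (forall x, T x = rank_sum l x) /\ trace_sum l = t.

Lemma csum_ext {X : Type} (f g : X -> C) (l : list X) :
  (forall x, In x l -> f x = g x) -> csum f l = csum g l.
Proof.
  induction l as [|p l IH]; simpl; intro h; auto.
  rewrite h; [f_equal; apply IH; auto | auto].
Qed.

Lemma csum_plus {X : Type} (f g : X -> C) (l : list X) :
  csum (fun x => Cplus (f x) (g x)) l = Cplus (csum f l) (csum g l).
Proof. induction l as [|p l IH]; simpl; [ring | rewrite IH; ring]. Qed.

Lemma csum_mult {X : Type} (k : C) (f : X -> C) (l : list X) :
  csum (fun x => Cmult k (f x)) l = Cmult k (csum f l).
Proof. induction l as [|p l IH]; simpl; [ring | rewrite IH; ring]. Qed.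

Lemma csum_app {X : Type} (f : X -> C) (l l' : list X) :
  csum f (l ++ l') = Cplus (csum f l) (csum f l').
Proof. induction l as [|p l IH]; simpl; [ring | rewrite IH; ring]. Qed.

Lemma csum_map {X Y : Type} (f : Y -> C) (g : X -> Y) (l : list X) :
  csum f (map g l) = csum (fun x => f (g x)) l.
Proof. induction l as [|p l IH]; simpl; [auto | by rewrite IH]. Qed.

Section RankSums.

Context {U V : HilbertSpace}.
Implicit Types l : list (U * V).

Lemma rank_sum_app l l' x : rank_sum (l ++ l') x = plus (rank_sum l x) (rank_sum l' x).
Proof.
  induction l as [|p l IH]; simpl; [vec_in V|]; rewrite IH; vec_in V.
Qed.

Lemma inner_rank_sum l x y :
  inner (rank_sum l x) y = csum (fun p => Cmult (inner x (fst p)) (inner (snd p) y)) l.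
Proof.
  induction l as [|p l IH]; simpl; [apply inner_zero_l|].
  by rewrite inner_plus_l inner_scal_l IH.
Qed.

Lemma rank_sum_map_right {W : HilbertSpace} (S : Bop V W) l x :
  rank_sum (map (fun p => (fst p, S (snd p))) l) x = S (rank_sum l x).
Proof.
  induction l as [|p l IH]; simpl; [by rewrite bop0|].
  by rewrite bopD bopZ IH.
Qed.

Lemma rank_sum_map_left {W : HilbertSpace} (S : Bop W U) l x :
  rank_sum (map (fun p => (bop_adj S (fst p), snd p)) l) x = rank_sum l (S x).
Proof.
  induction l as [|p l IH]; simpl; [reflexivity|].
  by rewrite IH bop_adjP.
Qed.

Lemma rank_sum_swap l x y :
  inner (rank_sum l x) y = inner x (rank_sum (map (fun p => (snd p, fst p)) l) y).
Proof.
  induction l as [|p l IH]; simpl; [by rewrite inner_zero_l inner_zero_r|].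
  rewrite inner_plus_l inner_scal_l inner_plus_r inner_scal_r IH -(inner_conj _ y).
  ring.
Qed.

End RankSums.

Lemma rank_sum_scal {U V : HilbertSpace} (k : C) (l : list (U * V)) x :
  rank_sum (map (fun p => (fst p, @scal C_Ring V k (snd p))) l) x = @scal C_Ring V k (rank_sum l x).
Proof.
  apply (rank_sum_map_right (bop_scal k (bop_id V))).
Qed.

(** Projecting the [b_i] on the orthogonal complement of the first of them
    shortens a representation of [0] without changing its trace. *)
Lemma trace_sum_zero {H : HilbertSpace} (l : list (H * H)) :
  (forall x, rank_sum l x = zero) -> trace_sum l = RtoC 0.
Proof.
  remember (length l) as n eqn:hn; revert l hn.
  induction n as [|n IH]; intros l hn hl.
  - destruct l; [reflexivity | discriminate].
  - destruct l as [|[a b] l]; [discriminate|]; simpl in hn; injection hn as hn.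
    unfold trace_sum in *; simpl in *.
    destruct (excluded_middle_informative (b = zero)) as [->|nb].
    + rewrite inner_zero_l IH //; [ring|].
      intro x; rewrite -(hl x) (scal_z (V := H)); vec_in H.
    + assert (nn : RtoC (norm b ^ 2) <> RtoC 0).
      { intro E; apply (f_equal fst) in E; pose proof (norm_pos (V := H) b nb).
        simpl in E; paths; nra. }
      pose (q := (fun y => minus y (@scal C_Ring H (Cdiv (inner y b) (RtoC (norm b ^ 2))) b)) : H -> H).
      assert (qs : forall (l' : list (H * H)) x, rank_sum (map (fun p => (fst p, q (snd p))) l') x = q (rank_sum l' x)).
      { induction l' as [|p l' IH']; intro x; simpl; unfold q in *.
        - rewrite inner_zero_l; vec_in H; field; auto.
        - rewrite IH' inner_plus_l inner_scal_l; vec_in H; field; auto. }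
      assert (qb : q b = zero).
      { unfold q; rewrite inner_norm; vec_in H; field; auto. }
      specialize (IH (map (fun p => (fst p, q (snd p))) l)).
      rewrite length_map csum_map in IH; simpl in IH.
      (* The representation of [0] evaluated at [b] and paired with [b]: up to the factor
         [norm b ^ 2], this says that the trace [inner b a] of the deleted term is what the
         projection [q] subtracts from the other terms, with opposite sign. *)
      pose proof (hl b) as hb; apply (f_equal (fun y => inner y b)) in hb.
      rewrite inner_plus_l inner_scal_l inner_rank_sum inner_zero_l inner_norm in hb.
      transitivity (csum (fun p => inner (q (snd p)) (fst p)) l).
      * unfold q.
        rewrite [RHS](csum_ext _ (fun p => Cplus (inner (snd p) (fst p))
           (Cmult (Copp (Cinv (RtoC (norm b ^ 2)))) (Cmult (inner b (fst p)) (inner (snd p) b))))).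
        -- rewrite csum_plus csum_mult.
           set (s := csum (fun p => Cmult _ _) l) in *.
           replace s with (Copp (Cmult (inner b a) (RtoC (norm b ^ 2)))).
           ++ field; auto.
           ++ transitivity (Cminus (RtoC 0) (Cmult (inner b a) (RtoC (norm b ^ 2)))); [ring|].
              rewrite -hb; ring.
        -- intros p _; rewrite inner_minus_l inner_scal_l; field; auto.
      * apply IH; auto; intro x; rewrite qs.
        assert (E : q (plus (@scal C_Ring H (inner x a) b) (rank_sum l x)) = zero).
        { rewrite hl; unfold q; rewrite inner_zero_l; vec_in H; field; auto. }
        rewrite -E; unfold q; rewrite inner_plus_l inner_scal_l inner_norm; vec_in H; field; auto.
Qed.

Section FiniteTraces.

Context {H : HilbertSpace}.
Implicit Types S T : Bop H H.

Lemma ftrace_plus S T s t : ftrace S s -> ftrace T t -> ftrace (bop_plus S T) (Cplus s t).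
Proof.
  intros [l [hl <-]] [l' [hl' <-]]; exists (l ++ l'); split.
  - intro x; rewrite rank_sum_app -hl -hl' //.
  - apply csum_app.
Qed.

Lemma ftrace_scal k T t : ftrace T t -> ftrace (bop_scal k T) (Cmult k t).
Proof.
  intros [l [hl <-]]; exists (map (fun p => (fst p, @scal C_Ring H k (snd p))) l); split.
  - intro x; rewrite rank_sum_scal -hl //.
  - unfold trace_sum; rewrite csum_map -csum_mult; apply csum_ext; intros p _; apply inner_scal_l.
Qed.

Lemma ftrace_zero : ftrace (bop_zero : Bop H H) (RtoC 0).
Proof. now exists nil. Qed.

(** One list followed by the negative of the other represents [0], whose trace is [0]. *)
Lemma ftrace_unique T s t : ftrace T s -> ftrace T t -> s = t.
Proof.
  intros hs ht.
  destruct (ftrace_plus _ _ _ _ hs (ftrace_scal (RtoC (-1)) _ _ ht)) as [l [hl E]].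
  assert (Z : trace_sum l = RtoC 0).
  { apply trace_sum_zero; intro x; rewrite -hl; simpl; vec_in H. }
  rewrite Z in E.
  transitivity (Cplus (Cplus s (Cmult (RtoC (-1)) t)) t); [ring | rewrite -E; ring].
Qed.

End FiniteTraces.

Section FiniteRank.

Context {U V W : HilbertSpace}.

Lemma has_rank_sum_plus (S T : Bop U V) :
  has_rank_sum S -> has_rank_sum T -> has_rank_sum (bop_plus S T).
Proof.
  intros [l hl] [l' hl']; exists (l ++ l'); intro x; rewrite rank_sum_app -hl -hl' //.
Qed.

Lemma has_rank_sum_zero : has_rank_sum (bop_zero : Bop U V).
Proof. now exists nil. Qed.

Lemma has_rank_sum_comp_l (S : Bop V W) (T : Bop U V) :
  has_rank_sum S -> has_rank_sum (bop_comp S T).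
Proof.
  intros [l hl]; exists (map (fun p => (bop_adj T (fst p), snd p)) l).
  intro x; rewrite rank_sum_map_left -hl //.
Qed.

Lemma has_rank_sum_comp_r (S : Bop V W) (T : Bop U V) :
  has_rank_sum T -> has_rank_sum (bop_comp S T).
Proof.
  intros [l hl]; exists (map (fun p => (fst p, S (snd p))) l).
  intro x; rewrite rank_sum_map_right -hl //.
Qed.

End FiniteRank.

Lemma has_rank_sum_scal {U V : HilbertSpace} (k : C) (T : Bop U V) :
  has_rank_sum T -> has_rank_sum (bop_scal k T).
Proof.
  intros [l hl]; exists (map (fun p => (fst p, @scal C_Ring V k (snd p))) l).
  intro x; rewrite rank_sum_scal -hl //.
Qed.

(** If [X] is the sum of the [(., a_i) b_i], replacing [a_i] by its image under the adjoint of [Y]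
    represents [X Y], replacing [b_i] by [Y b_i] represents [Y X], and both traces are the sum of
    the [(Y b_i, a_i)]. *)
Lemma ftrace_cyclic {U V : HilbertSpace} (X : Bop U V) (Y : Bop V U) :
  has_rank_sum X \/ has_rank_sum Y ->
  exists t, ftrace (bop_comp X Y) t /\ ftrace (bop_comp Y X) t.
Proof.
  assert (G : forall (U V : HilbertSpace) (X : Bop U V) (Y : Bop V U), has_rank_sum X ->
     exists t, ftrace (bop_comp X Y) t /\ ftrace (bop_comp Y X) t).
  { clear; intros U V X Y [l hl].
    exists (trace_sum (map (fun p => (fst p, Y (snd p))) l)); split.
    - exists (map (fun p => (bop_adj Y (fst p), snd p)) l); split.
      + intro x; rewrite rank_sum_map_left -hl //.
      + unfold trace_sum; rewrite !csum_map; apply csum_ext; intros p _; simpl.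
        symmetry; apply bop_adjP.
    - exists (map (fun p => (fst p, Y (snd p))) l); split; auto.
      intro x; rewrite rank_sum_map_right -hl //. }
  intros [h|h]; [now apply G|].
  destruct (G V U Y X h) as [t [h1 h2]]; now exists t.
Qed.

(** * Shortest rank one representations and the dimension of the range *)

Fixpoint span {H : HilbertSpace} (l : list H) (x : H) : Prop :=
  match l with
  | nil => x = zero
  | e :: l' => exists k : C, span l' (minus x (@scal C_Ring H k e))
  end.

Lemma span_ortho {H : HilbertSpace} (l : list H) (x d : H) :
  span l x -> (forall e, In e l -> inner d e = RtoC 0) -> inner d x = RtoC 0.
Proof.
  revert x; induction l as [|e l IH]; simpl; intros x hx hd.
  - rewrite hx; apply inner_zero_r.
  - destruct hx as [k hk]; apply IH in hk; auto.
    rewrite inner_minus_r inner_scal_r (hd e) in hk; auto.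
    rewrite -hk; ring.
Qed.

(** Induction on the list. If [c] has a dual vector [e] with respect to [l], subtract from [a] the
    multiple of [c] that makes it orthogonal to [e]; a dual vector [d] of the result, corrected by a
    multiple of [e] so as to annihilate [c], is dual to [a]. *)
Lemma span_or_dual {H : HilbertSpace} (l : list H) (a : H) :
  span l a \/ exists d, (forall e, In e l -> inner d e = RtoC 0) /\ inner d a = RtoC 1.
Proof.
  revert a; induction l as [|c l IH]; intro a; simpl.
  - destruct (excluded_middle_informative (a = zero)) as [->|na]; [now left | right].
    assert (nn : RtoC (norm a ^ 2) <> RtoC 0).
    { intro E; apply (f_equal fst) in E; pose proof (norm_pos (V := H) a na).
      simpl in E; paths; nra. }
    exists (@scal C_Ring H (Cinv (RtoC (norm a ^ 2))) a); split; [tauto|].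
    rewrite inner_scal_l inner_norm; field; auto.
  - destruct (IH c) as [sc|[e [e1 e2]]].
    + destruct (IH a) as [sa|[d [d1 d2]]].
      * left; exists (RtoC 0); rewrite (scal_C0 (V := H)).
        rewrite (_ : minus a zero = a); [auto | vec_in H].
      * right; exists d; split; auto; intros e [<-|he]; auto.
        now apply span_ortho with l.
    + set (k := Cconj (inner e a)).
      destruct (IH (minus a (@scal C_Ring H k c))) as [sa|[d [d1 d2]]]; [left; now exists k | right].
      exists (minus d (@scal C_Ring H (inner d c) e)); split.
      * intros x [<-|hx]; rewrite inner_minus_l inner_scal_l ?e2 ?(d1 x hx) ?(e1 x hx); ring.
      * rewrite inner_minus_r inner_scal_r in d2.
        unfold k in d2; rewrite Cconj_Cconj in d2.
        rewrite inner_minus_l inner_scal_l -d2; ring.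
Qed.

(** A term whose [a] depends on the other ones can be distributed over them without lengthening the
    list; a shortest list therefore has independent first components. *)
Lemma span_absorb {U V : HilbertSpace} (l : list (U * V)) (a : U) (b : V) :
  span (map fst l) a ->
  exists l', length l' = length l /\
    forall x, rank_sum l' x = plus (@scal C_Ring V (inner x a) b) (rank_sum l x).
Proof.
  revert a; induction l as [|[a1 b1] l IH]; simpl; intros a ha.
  - exists nil; split; auto; intro x; rewrite ha inner_zero_r (scal_C0 (V := V)); simpl; vec_in V.
  - destruct ha as [k hk]; destruct (IH _ hk) as [l' [e1 e2]].
    exists ((a1, plus b1 (@scal C_Ring V (Cconj k) b)) :: l'); split; [simpl; auto|].
    intro x; simpl; rewrite e2 inner_minus_r inner_scal_r; vec_in V.
Qed.

(** Minimal length stands for the independence of the [a_i] and of the [b_i], and it passes to the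
    adjoint by a mere exchange of components. The length is the rank. *)
Definition minimal_rank_sum {U V : HilbertSpace} (T : Bop U V) (l : list (U * V)) : Prop :=
  (forall x, T x = rank_sum l x) /\
  (forall l', (forall x, T x = rank_sum l' x) -> (length l <= length l')%nat).

Lemma nat_minimum (P : nat -> Prop) : (exists n, P n) ->
  exists n, P n /\ forall m, P m -> (n <= m)%nat.
Proof.
  intros [n hn]; revert hn; induction n as [n IH] using (well_founded_induction Wf_nat.lt_wf).
  intro hn; destruct (classic (exists m, P m /\ (m < n)%nat)) as [[m [hm lm]]|N].
  - now apply (IH m).
  - exists n; split; auto; intros m hm; destruct (Nat.le_gt_cases n m); auto.
    exfalso; apply N; now exists m.
Qed.

Lemma minimal_rank_sum_exists {U V : HilbertSpace} (T : Bop U V) :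
  has_rank_sum T -> exists l, minimal_rank_sum T l.
Proof.
  intros [l0 h0].
  destruct (nat_minimum (fun n => exists l, length l = n /\ forall x, T x = rank_sum l x))
    as [n [[l [<- hl]] hm]]; [now exists (length l0), l0|].
  exists l; split; auto; intros l' hl'; apply hm; now exists l'.
Qed.

(** Were [a] in the span of the other first components, its term could be absorbed and the list
    shortened. The dual vector isolates the term of [b], so each second component is a value of
    [T]. *)
Lemma minimal_rank_sum_dual {U V : HilbertSpace} (T : Bop U V) l1 a b l2 :
  minimal_rank_sum T (l1 ++ (a, b) :: l2) ->
  exists d, (forall p, In p (l1 ++ l2) -> inner d (fst p) = RtoC 0) /\
    inner d a = RtoC 1 /\ T d = b.
Proof.
  intros [hT hm].
  destruct (span_or_dual (map fst (l1 ++ l2)) a) as [hs|[d [d1 d2]]].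
  - destruct (span_absorb (l1 ++ l2) a b hs) as [l' [e1 e2]].
    exfalso; assert (L : (length (l1 ++ (a, b) :: l2) <= length l')%nat).
    { apply hm; intro x; rewrite e2 hT !rank_sum_app; simpl; vec_in V. }
    rewrite e1 !length_app in L; simpl in L; lia.
  - assert (d1' : forall p, In p (l1 ++ l2) -> inner d (fst p) = RtoC 0).
    { intros p hp; apply d1; now apply in_map. }
    exists d; repeat split; auto.
    assert (Z : forall l : list (U * V), (forall p, In p l -> inner d (fst p) = RtoC 0) -> rank_sum l d = zero).
    { induction l as [|p l IH]; simpl; intro h; auto.
      rewrite IH; auto. rewrite (h p); auto. rewrite (scal_C0 (V := V)); vec_in V. }
    rewrite hT rank_sum_app; simpl; rewrite d2 !Z; [vec_in V| |];
      intros p hp; apply d1', in_or_app; auto.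
Qed.

(** Exchanging components is an involution that preserves length, so a shorter list for the adjoint
    would give one for [T]. Dual vectors of the second components are obtained in this way. *)
Lemma minimal_rank_sum_adj {U V : HilbertSpace} (T : Bop U V) l :
  minimal_rank_sum T l -> minimal_rank_sum (bop_adj T) (map (fun p => (snd p, fst p)) l).
Proof.
  intros [h1 h2]; split.
  - intro y; apply inner_ext_r; intro x; by rewrite -bop_adjP h1 rank_sum_swap.
  - intros l' hl'; rewrite length_map -(length_map (fun p : V * U => (snd p, fst p)) l').
    apply h2; intro x; apply inner_ext_l; intro y.
    rewrite bop_adjP hl' rank_sum_swap map_map; f_equal; f_equal.
    rewrite -{1}(map_id l'); apply map_ext; now intros [].
Qed.

Section LinearCombinations.

Context {V : HilbertSpace}.
Implicit Types (e : nat -> V) (c : nat -> C).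

Definition lincomb c e (n : nat) : V := sum_n_m (fun k => @scal C_Ring V (c k) (e k)) 1 n.

Lemma lincomb_0 c e : lincomb c e 0 = zero.
Proof. unfold lincomb; apply (sum_n_m_zero (G := NormedModule.AbelianMonoid C_AbsRing V)); lia. Qed.

Lemma lincomb_S c e n :
  lincomb c e (S n) = plus (lincomb c e n) (@scal C_Ring V (c (S n)) (e (S n))).
Proof. apply (sum_n_Sm (G := NormedModule.AbelianMonoid C_AbsRing V)); lia. Qed.

Lemma inner_lincomb c e n d (j : nat) :
  (forall k, (1 <= k <= n)%nat -> inner (e k) d = if Nat.eqb k j then RtoC 1 else RtoC 0) ->
  inner (lincomb c e n) d = if andb (Nat.leb 1 j) (Nat.leb j n) then c j else RtoC 0.
Proof.
  induction n as [|n IH]; intro h.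
  - rewrite lincomb_0 inner_zero_l; destruct j; reflexivity.
  - rewrite lincomb_S inner_plus_l inner_scal_l h; [|lia]; rewrite IH; [|intros; apply h; lia].
    destruct (Nat.eqb_spec (S n) j) as [<-|N].
    + replace (Nat.leb (S n) n) with false by (symmetry; apply Nat.leb_gt; lia).
      rewrite Nat.leb_refl; simpl; ring.
    + destruct (Nat.leb_spec 1 j), (Nat.leb_spec j n), (Nat.leb_spec j (S n)); simpl; try lia; ring.
Qed.

Lemma lincomb_plus c c' e n :
  lincomb (fun k => Cplus (c k) (c' k)) e n = plus (lincomb c e n) (lincomb c' e n).
Proof.
  induction n as [|n IH]; [rewrite !lincomb_0; vec_in V|].
  rewrite !lincomb_S IH; vec_in V.
Qed.

Lemma lincomb_delta a e n (j : nat) : (1 <= j <= n)%nat ->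
  lincomb (fun k => if Nat.eqb k j then a else RtoC 0) e n = @scal C_Ring V a (e j).
Proof.
  assert (Z : forall m, (m < j)%nat ->
    lincomb (fun k => if Nat.eqb k j then a else RtoC 0) e m = zero).
  { induction m as [|m IH]; intro h; [apply lincomb_0|].
    rewrite lincomb_S IH; [|lia]; destruct (Nat.eqb_spec (S m) j); [lia|]; vec_in V. }
  induction n as [|n IH]; intro h; [lia|].
  rewrite lincomb_S; destruct (Nat.eqb_spec (S n) j) as [<-|N].
  - rewrite Z; [vec_in V | lia].
  - rewrite IH; [vec_in V | lia].
Qed.

Lemma lincomb_zero e n : lincomb (fun _ => RtoC 0) e n = zero.
Proof.
  induction n as [|n IH]; [apply lincomb_0|]; rewrite lincomb_S IH; vec_in V.
Qed.

Lemma span_lincomb e n L x : span (map e L) x ->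
  (forall k, In k L -> (1 <= k <= n)%nat) ->
  exists c, x = lincomb c e n /\ forall k, ~ In k L -> c k = RtoC 0.
Proof.
  revert x; induction L as [|j L IH]; simpl; intros x hx hL.
  - exists (fun _ => RtoC 0); split; auto; by rewrite lincomb_zero.
  - destruct hx as [a ha]; destruct (IH _ ha) as [c [h1 h2]]; [intros; apply hL; auto|].
    exists (fun k => Cplus (c k) (if Nat.eqb k j then a else RtoC 0)); split.
    + rewrite lincomb_plus -h1 lincomb_delta; [vec_in V | apply hL; auto].
    + intros k hk; destruct (Nat.eqb_spec k j) as [->|N]; [exfalso; apply hk; auto|].
      rewrite h2; [ring | intro; apply hk; auto].
Qed.

(** If [e j] had no vector dual to it and orthogonal to the others, it would be a combination of
    these, and moving it to the other side, with coefficient -1, would contradict independence. *)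
Lemma independent_dual e n :
  (forall c, lincomb c e n = zero -> forall k, (1 <= k <= n)%nat -> c k = RtoC 0) ->
  exists d : nat -> V, forall j k, (1 <= j <= n)%nat -> (1 <= k <= n)%nat ->
    inner (e k) (d j) = if Nat.eqb k j then RtoC 1 else RtoC 0.
Proof.
  intro h.
  assert (ex : forall j, exists d, (1 <= j <= n)%nat -> forall k, (1 <= k <= n)%nat ->
    inner (e k) d = if Nat.eqb k j then RtoC 1 else RtoC 0).
  { intro j; destruct (classic (1 <= j <= n)%nat) as [hj|]; [|exists zero; tauto].
    set (L := filter (fun k => negb (Nat.eqb k j)) (seq 1 n)).
    assert (hL : forall k, In k L <-> (1 <= k <= n)%nat /\ k <> j).
    { intro k; unfold L; rewrite filter_In in_seq; destruct (Nat.eqb_spec k j); simpl;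
        intuition (lia || discriminate). }
    destruct (span_or_dual (map e L) (e j)) as [hs|[d [d1 d2]]].
    - exfalso; destruct (span_lincomb e n L (e j) hs) as [c [h1 h2]]; [intros k hk; now apply hL|].
      assert (E : Cplus (c j) (RtoC (-1)) = RtoC 0).
      { pose proof (h (fun k => Cplus (c k) (if Nat.eqb k j then RtoC (-1) else RtoC 0))) as hc.
        specialize (fun E => hc E j hj); simpl in hc; rewrite Nat.eqb_refl in hc; apply hc.
        rewrite lincomb_plus -h1 lincomb_delta //; vec_in V. }
      rewrite h2 in E; [|rewrite hL; tauto].
      apply (f_equal fst) in E; simpl in E; lra.
    - exists d; intros _ k hk; destruct (Nat.eqb_spec k j) as [->|N].
      + by rewrite inner_conj d2 Cconj_RtoC.
      + rewrite inner_conj d1; [apply Cconj_RtoC|]; apply in_map, hL; auto. }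
  exists (fun j => proj1_sig (constructive_indefinite_description _ (ex j))).
  intros j k hj hk.
  exact (proj2_sig (constructive_indefinite_description _ (ex j)) hj k hk).
Qed.

End LinearCombinations.

Lemma ran_lincomb {U V : HilbertSpace} (T : Bop U V) (c : nat -> C) (e : nat -> V) n :
  (forall k, (1 <= k <= n)%nat -> ran T (e k)) -> ran T (lincomb c e n).
Proof.
  induction n as [|n IH]; intro h.
  - exists zero; rewrite lincomb_0; apply (bop0 T).
  - destruct IH as [x hx]; [intros; apply h; lia|]; destruct (h (S n)) as [y hy]; [lia|].
    exists (plus x (@scal C_Ring U (c (S n)) y)).
    rewrite bopD bopZ hx hy lincomb_S //.
Qed.

(** The second components of a shortest list are a basis of the range: they belong to it by the dual
    vectors of [T], and they are independent by those of its adjoint. *)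
Lemma has_rank_sum_finite_rank {U V : HilbertSpace} (T : Bop U V) :
  has_rank_sum T -> finite_rank T.
Proof.
  intro hT; destruct (minimal_rank_sum_exists T hT) as [l hl].
  pose proof (minimal_rank_sum_adj T l hl) as hl'.
  (* [has_dim] numbers a basis from 1 and [nth] counts from 0. *)
  exists (length l), (fun k => snd (nth (k - 1) l (zero, zero))).
  assert (R : forall k, (1 <= k <= length l)%nat -> ran T (snd (nth (k - 1) l (zero, zero)))).
  { intros k hk; destruct (nth_split l (zero, zero) (n := (k - 1)%nat)) as [l1 [l2 [E _]]]; [lia|].
    destruct (nth (k - 1) l (zero, zero)) as [a b].
    destruct (minimal_rank_sum_dual T l1 a b l2) as [d [_ [_ hd]]]; [by rewrite -E|].
    now exists d. }
  split.
  - intro y; split.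
    + intros [x <-]; rewrite (proj1 hl).
      exists (fun k => inner x (fst (nth (k - 1) l (zero, zero)))).
      clear; induction l as [|p l IH].
      { symmetry; apply (sum_n_m_zero (G := NormedModule.AbelianMonoid C_AbsRing V)); simpl; lia. }
      simpl length; simpl rank_sum.
      etransitivity; [|symmetry; apply (sum_Sn_m (G := NormedModule.AbelianMonoid C_AbsRing V)); lia].
      f_equal; etransitivity; [exact IH|].
      etransitivity; [|apply (sum_n_m_S (G := NormedModule.AbelianMonoid C_AbsRing V))].
      apply (sum_n_m_ext_loc (G := NormedModule.AbelianMonoid C_AbsRing V)).
      intros k hk; replace (S k - 1)%nat with (S (k - 1)) by lia; reflexivity.
    + intros [c ->]; apply (ran_lincomb T c); auto.
  - intros c hc k hk.
    destruct (nth_split l (zero, zero) (n := (k - 1)%nat)) as [l1 [l2 [E El]]]; [lia|].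
    assert (E' := E); destruct (nth (k - 1) l (zero, zero)) as [a b].
    apply (f_equal (map (fun p => (snd p, fst p)))) in E'; rewrite map_app in E'; simpl in E'.
    rewrite E' in hl'.
    destruct (minimal_rank_sum_dual (bop_adj T) _ _ _ _ hl') as [d [d1 [d2 _]]].
    pose proof (inner_lincomb c (fun k => snd (nth (k - 1) l (zero, zero))) (length l) d k) as I.
    replace (andb (Nat.leb 1 k) (Nat.leb k (length l))) with true in I.
    2: { symmetry; apply andb_true_intro; split; apply Nat.leb_le; lia. }
    change (c k = RtoC 0); rewrite -I; clear I.
    + transitivity (inner (zero : V) d); [f_equal; exact hc | apply inner_zero_l].
    + intros j hj; rewrite inner_conj.
      destruct (Nat.eqb_spec j k) as [->|N].
      * rewrite E -El app_nth2 // Nat.sub_diag; simpl; rewrite d2; apply Cconj_RtoC.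
      * assert (I : In (nth (j - 1) l (zero, zero)) (l1 ++ l2)).
        { assert (hj' : (j - 1 < length l)%nat) by lia; revert hj'; rewrite E; intro hj'.
          rewrite length_app in hj'; simpl in hj'.
          apply in_or_app; destruct (Nat.lt_ge_cases (j - 1) (length l1)).
          - left; rewrite app_nth1 //; apply nth_In; auto.
          - right; rewrite app_nth2 //.
            replace (j - 1 - length l1)%nat with (S (j - 1 - length l1 - 1)) by lia.
            simpl; apply nth_In; lia. }
        rewrite (d1 (snd (nth (j - 1) l (zero, zero)), fst (nth (j - 1) l (zero, zero)))).
        { apply Cconj_RtoC. }
        rewrite -map_app; now apply (in_map (fun p : U * V => (snd p, fst p))) in I.
Qed.

(** With vectors [d k] dual to the basis, the k-th coordinate of [T x] is [inner (T x) (d k)], a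
    functional of [x] represented through the adjoint. An idempotent fixes the vectors of its range,
    so each of the n terms contributes 1 to the trace. *)
Lemma has_dim_rank_sum {V : HilbertSpace} (T : Bop V V) n :
  has_dim (ran T) n -> has_rank_sum T /\
  ((forall x, T (T x) = T x) -> ftrace T (RtoC (INR n))).
Proof.
  intros [e [h1 h2]].
  destruct (independent_dual e n h2) as [d hd].
  set (l := map (fun k => (bop_adj T (d k), e k)) (seq 1 n)).
  assert (hl : forall x, T x = rank_sum l x).
  { intro x.
    destruct (proj1 (h1 (T x)) (ex_intro _ x eq_refl)) as [c hc].
    assert (hc' : T x = lincomb c e n) by exact hc.
    assert (Q : forall m, (m <= n)%nat -> lincomb c e m =
       rank_sum (map (fun k => (bop_adj T (d k), e k)) (seq 1 m)) x).
    { induction m as [|m IH]; intro hm; [apply lincomb_0|].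
      rewrite lincomb_S seq_S map_app rank_sum_app IH; [|lia]; simpl.
      rewrite -bop_adjP hc' (inner_lincomb c e n (d (S m)) (S m)).
      2: { intros k hk; apply hd; lia. }
      - replace (Nat.leb (S m) n) with true by (symmetry; apply Nat.leb_le; lia).
        simpl; vec_in V. }
    rewrite hc'; apply Q; auto. }
  split; [now exists l|]; intro hT; exists l; split; auto.
  unfold trace_sum, l; rewrite csum_map; simpl.
  rewrite (csum_ext _ (fun _ => RtoC 1)).
  - assert (Q : forall L : list nat, csum (fun _ => RtoC 1) L = RtoC (INR (length L))).
    { induction L as [|k L IH]; [reflexivity|].
      simpl length; rewrite S_INR RtoC_plus; simpl; rewrite IH; ring. }
    by rewrite Q length_seq.
  - intros k hk; apply in_seq in hk.
    assert (E : T (e k) = e k).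
    { destruct (proj2 (h1 (e k))) as [y hy]; [|by rewrite -hy hT].
      exists (fun i => if Nat.eqb i k then RtoC 1 else RtoC 0).
      symmetry; etransitivity; [apply (lincomb_delta (RtoC 1) e n k); lia|].
      apply (scal_C1 (V := V)). }
    rewrite -bop_adjP E hd; [|lia|lia]; by rewrite Nat.eqb_refl.
Qed.

(** * Orthonormal systems and the trace over a basis *)

Fixpoint orthonormal_list {H : HilbertSpace} (l : list H) : Prop :=
  match l with
  | nil => True
  | e :: l' => inner e e = RtoC 1 /\ (forall f, In f l' -> inner e f = RtoC 0) /\
               orthonormal_list l'
  end.

Definition expansion {H : HilbertSpace} (l : list H) (x : H) : H :=
  rank_sum (map (fun e => (e, e)) l) x.

Lemma expansion_ortho {H : HilbertSpace} (l : list H) (x e : H) :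
  (forall f, In f l -> inner e f = RtoC 0) -> inner (expansion l x) e = RtoC 0.
Proof.
  intro h; unfold expansion; rewrite inner_rank_sum csum_map; simpl.
  rewrite (csum_ext _ (fun _ => Cmult (RtoC 0) (RtoC 0))).
  - rewrite csum_mult; ring.
  - intros f hf; rewrite (inner_conj _ e f) (h f hf) Cconj_RtoC; ring.
Qed.

Lemma bessel_step {H : HilbertSpace} (y e : H) (c : C) :
  inner e e = RtoC 1 -> inner y e = c ->
  norm (minus y (@scal C_Ring H c e)) ^ 2 = norm y ^ 2 - Cmod c ^ 2.
Proof.
  intros he hy; rewrite norm_sq_minus_scal hy.
  assert (N : norm e ^ 2 = 1).
  { rewrite inner_norm in he; apply (f_equal fst) in he; exact he. }
  rewrite N Cmult_comm Cmult_conj_r; simpl; ring.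
Qed.

Lemma bessel {H : HilbertSpace} (l : list H) (x : H) : orthonormal_list l ->
  norm (minus x (expansion l x)) ^ 2 +
  fold_right (fun e s => Cmod (inner x e) ^ 2 + s) 0 l = norm x ^ 2.
Proof.
  induction l as [|e l IH]; simpl; intro h.
  - unfold expansion; simpl; rewrite (_ : minus x zero = x); [ring | vec_in H].
  - destruct h as [h1 [h2 h3]]; specialize (IH h3).
    assert (E : inner (minus x (expansion l x)) e = inner x e).
    { rewrite inner_minus_l expansion_ortho //; ring. }
    pose proof (bessel_step _ e _ h1 E) as B.
    unfold expansion in *; simpl.
    rewrite (_ : minus x (plus (@scal C_Ring H (inner x e) e) (rank_sum (map (fun e => (e, e)) l) x)) =
      minus (minus x (rank_sum (map (fun e => (e, e)) l) x)) (@scal C_Ring H (inner x e) e));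
      [|vec_in H].
    simpl in B, IH |- *; plra.
Qed.

Lemma bessel_sum {H : HilbertSpace} (l : list H) (x : H) : orthonormal_list l ->
  fold_right (fun e s => Cmod (inner x e) ^ 2 + s) 0 l <= norm x ^ 2.
Proof.
  intro h; pose proof (bessel l x h); pose proof (pow2_ge_0 (norm (minus x (expansion l x)))); lra.
Qed.

Lemma norm_expansion_rest {H : HilbertSpace} (l : list H) (x : H) : orthonormal_list l ->
  norm (minus x (expansion l x)) <= norm x.
Proof.
  intro h; pose proof (bessel l x h) as B.
  assert (P : 0 <= fold_right (fun e s => Cmod (inner x e) ^ 2 + s) 0 l).
  { clear; induction l as [|e l IH]; cbn [fold_right]; [lra|].
    pose proof (pow2_ge_0 (Cmod (inner x e))); lra. }
  apply Rsqr_incr_0; [rewrite !Rsqr_pow2; plra | apply norm_ge_0 | apply norm_ge_0].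
Qed.

Lemma orthonormal_list_nth {H : HilbertSpace} (l : list (H * H)) (g : H * H -> H) d :
  (forall i j, (i < length l)%nat -> (j < length l)%nat ->
     inner (g (nth i l d)) (g (nth j l d)) = RtoC (if Nat.eqb i j then 1 else 0)) ->
  orthonormal_list (map g l).
Proof.
  induction l as [|p l IH]; simpl; intro h; auto; repeat split.
  - apply (h 0%nat 0%nat); lia.
  - intros f hf; apply in_map_iff in hf as [q [<- hq]].
    destruct (In_nth l q d hq) as [j [hj <-]]; apply (h 0%nat (S j)); lia.
  - apply IH; intros i j hi hj; apply (h (S i) (S j)); lia.
Qed.

(** For one term, [|(x, a) (b, y)|] is at most half the sum of the two squares, and Bessel's
    inequality bounds the sum of these squares over each of the two orthonormal systems. *)
Lemma rank_sum_trace_class {H : HilbertSpace} (T : Bop H H) : has_rank_sum T -> trace_class T.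
Proof.
  intros [r hr].
  exists (fold_right (fun p s => (norm (fst p) ^ 2 + norm (snd p) ^ 2) / 2 + s) 0 r).
  intros l hl.
  assert (o1 : orthonormal_list (map fst l)).
  { apply orthonormal_list_nth with (zero, zero); intros i j hi hj; apply hl; auto. }
  assert (o2 : orthonormal_list (map snd l)).
  { apply orthonormal_list_nth with (zero, zero); intros i j hi hj; apply hl; auto. }
  clear hl.
  assert (B : forall (g : H * H -> H) a, orthonormal_list (map g l) ->
     fold_right (fun p s => Cmod (inner a (g p)) ^ 2 + s) 0 l <= norm a ^ 2).
  { intros g a ho; eapply Rle_trans; [|apply (bessel_sum _ a ho)]; apply Req_le.
    clear; induction l as [|p l IH]; simpl; auto; by rewrite IH. }
  assert (G : forall r : list (H * H),
     fold_right (fun p s => Cmod (inner (rank_sum r (fst p)) (snd p)) + s) 0 l <=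
     fold_right (fun p s => (norm (fst p) ^ 2 + norm (snd p) ^ 2) / 2 + s) 0 r).
  { clear r hr; induction r as [|[a b] r IH]; cbn [rank_sum]; cbn [fold_right].
    - apply Req_le; clear; induction l as [|p l IH]; simpl; auto.
      rewrite inner_zero_l Cmod_0 IH; ring.
    - pose proof (B fst a o1) as Ba; pose proof (B snd b o2) as Bb.
      eapply Rle_trans; [|apply Rplus_le_compat; [|exact IH]].
      2: { apply Rmult_le_compat_r; [lra|]; apply Rplus_le_compat; [exact Ba | exact Bb]. }
      clear; induction l as [|[x y] l IH]; cbn [fold_right]; [lra|]; simpl fst; simpl snd.
      assert (E : Cmod (inner (plus (@scal C_Ring H (inner x a) b) (rank_sum r x)) y) <=
         (Cmod (inner a x) ^ 2 + Cmod (inner b y) ^ 2) / 2 + Cmod (inner (rank_sum r x) y)).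
      { rewrite inner_plus_l inner_scal_l; eapply Rle_trans; [apply Cmod_triangle|].
        apply Rplus_le_compat_r; rewrite Cmod_mult (inner_conj _ a x) Cmod_conj.
        pose proof (pow2_ge_0 (Cmod (inner a x) - Cmod (inner b y))); nra. }
      simpl fst in *; simpl snd in *; lra. }
  eapply Rle_trans; [|apply G]; apply Req_le; clear - hr.
  induction l as [|p l IH]; simpl; auto; by rewrite IH hr.
Qed.

Lemma orthonormal_basis_list {H : HilbertSpace} (E : H -> Prop) (l : list H) :
  orthonormal_basis (fun _ => True) E -> NoDup l -> (forall x, In x l -> E x) ->
  orthonormal_list l.
Proof.
  intros [_ [h1 [h2 _]]]; induction 1 as [|e l he hl IH]; intro hE; simpl; auto; repeat split.
  - apply h1, hE; now left.
  - intros f hf; apply h2; try (apply hE; simpl; auto); intros ->; auto.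
  - apply IH; intros; apply hE; now right.
Qed.

Lemma expansion_plus {H : HilbertSpace} (l : list H) x y :
  expansion l (plus x y) = plus (expansion l x) (expansion l y).
Proof.
  unfold expansion; induction l as [|e l IH]; simpl; [vec_in H|].
  rewrite IH inner_plus_l; vec_in H.
Qed.

Lemma expansion_scal {H : HilbertSpace} (l : list H) (k : C) x :
  expansion l (@scal C_Ring H k x) = @scal C_Ring H k (expansion l x).
Proof.
  unfold expansion; induction l as [|e l IH]; simpl; [vec_in H|].
  rewrite IH inner_scal_l; vec_in H.
Qed.

Lemma expansion_self {H : HilbertSpace} (l : list H) e :
  orthonormal_list l -> In e l -> expansion l e = e.
Proof.
  unfold expansion; induction l as [|f l IH]; simpl; [tauto|].
  intros [h1 [h2 h3]] [<-|he].
  - rewrite h1; assert (Z : rank_sum (map (fun e => (e, e)) l) f = zero); [|rewrite Z; vec_in H].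
    clear IH h3; induction l as [|g l IH]; simpl; auto.
    rewrite (h2 g); [|now left]; rewrite IH; [vec_in H|]; intros; apply h2; now right.
  - rewrite IH // inner_conj h2 // Cconj_RtoC; vec_in H.
Qed.

(** The vectors reproduced by all large enough finite expansions form a subspace that contains the
    basis; by maximality of the basis nothing nonzero is orthogonal to it, so it approximates [x].
    Taking the remainder of an expansion is a contraction and kills the approximant, hence the
    remainder of [x] is as small as the error. *)
Lemma parseval {H : HilbertSpace} (E : H -> Prop) (x : H) :
  orthonormal_basis (fun _ => True) E ->
  forall eps, 0 < eps -> exists l0, (forall e, In e l0 -> E e) /\
    forall l, NoDup l -> (forall e, In e l -> E e) -> incl l0 l ->
      norm (minus x (expansion l x)) < eps.
Proof.
  intros hE eps he.
  set (W := fun w => exists l0, (forall e, In e l0 -> E e) /\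
    forall l, NoDup l -> (forall e, In e l -> E e) -> incl l0 l -> expansion l w = w).
  destruct (ortho_projection W) with (x := x) as [p [h1 h2]].
  - exists nil; split; [simpl; tauto|]; intros l _ _ _.
    rewrite -{1}(scal_C0 (V := H) zero) expansion_scal; apply (scal_C0 (V := H)).
  - intros a b [la [a1 a2]] [lb [b1 b2]]; exists (la ++ lb); split.
    + intros e h; apply in_app_or in h as [h|h]; auto.
    + intros l d hl hi; rewrite expansion_plus a2 // ?b2 //;
        intros e h; apply hi, in_or_app; auto.
  - intros c a [la [a1 a2]]; exists la; split; auto.
    intros l d hl hi; rewrite expansion_scal a2 //.
  - assert (px : minus x p = zero).
    { apply (proj2 (proj2 (proj2 hE))); auto; intros e h; apply h2.
      exists (e :: nil); split; [intros f [<-|[]]; auto|].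
      intros l d hl hi; apply expansion_self.
      - now apply (orthonormal_basis_list E).
      - apply hi; now left. }
    apply (minus_zero_eq (V := H)) in px; subst p.
    destruct (h1 eps he) as [w [[l0 [w1 w2]] hw]].
    exists l0; split; auto; intros l d hl hi.
    pose proof (norm_expansion_rest l (minus w x) (orthonormal_basis_list E l hE d hl)) as B.
    eapply Rle_lt_trans; [|exact hw]; eapply Rle_trans; [|exact B]; apply Req_le.
    rewrite (norm_minus_sym (V := H)); f_equal.
    rewrite (_ : minus w x = plus w (@scal C_Ring H (RtoC (-1)) x)); [|vec_in H].
    rewrite expansion_plus expansion_scal w2 //; vec_in H.
Qed.

Lemma is_unordered_sum_plus {X : Type} (E : X -> Prop) (a b : X -> C) s t :
  is_unordered_sum E a s -> is_unordered_sum E b t ->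
  is_unordered_sum E (fun x => Cplus (a x) (b x)) (Cplus s t).
Proof.
  intros ha hb eps.
  assert (he : 0 < eps / 2) by (pose proof (cond_pos eps); lra).
  destruct (ha (mkposreal _ he)) as [la [a1 a2]], (hb (mkposreal _ he)) as [lb [b1 b2]].
  exists (la ++ lb); split; [intros x h; apply in_app_or in h as [h|h]; auto|].
  intros l d hl hi.
  specialize (a2 l d hl ltac:(intros x h; apply hi, in_or_app; auto)).
  specialize (b2 l d hl ltac:(intros x h; apply hi, in_or_app; auto)); simpl in a2, b2.
  fold (csum a l) in a2; fold (csum b l) in b2.
  fold (csum (fun x => Cplus (a x) (b x)) l); rewrite csum_plus.
  replace (Cminus (Cplus (csum a l) (csum b l)) (Cplus s t)) with
    (Cplus (Cminus (csum a l) s) (Cminus (csum b l) t)) by ring.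
  eapply Rle_lt_trans; [apply Cmod_triangle|]; lra.
Qed.

Lemma is_unordered_sum_ext {X : Type} (E : X -> Prop) (a b : X -> C) s :
  (forall x, a x = b x) -> is_unordered_sum E a s -> is_unordered_sum E b s.
Proof. intros h hs; replace b with a; auto; apply functional_extensionality; auto. Qed.

(** By additivity one term suffices, and there the diagonal sum of the [(e, a) (b, e)] over a finite
    set is the expansion of [b] paired with [a], which tends to [(b, a)]. *)
Lemma ftrace_is_trace {H : HilbertSpace} (T : Bop H H) t : ftrace T t -> is_trace T t.
Proof.
  intros [r [hr <-]]; split; [apply rank_sum_trace_class; now exists r|].
  intros E hE; apply (is_unordered_sum_ext E (fun e => inner (rank_sum r e) e)).
  { intro x; by rewrite hr. }
  clear T hr; unfold trace_sum; induction r as [|[a b] r IH]; simpl.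
  - intro eps; exists nil; split; [simpl; tauto|]; intros l _ _ _.
    fold (csum (fun e : H => inner zero e) l).
    rewrite (csum_ext _ (fun _ => Cmult (RtoC 0) (RtoC 0))); [|intros; rewrite inner_zero_l; ring].
    rewrite csum_mult; replace (Cminus _ _) with (RtoC 0) by ring.
    rewrite Cmod_0; apply cond_pos.
  - apply (is_unordered_sum_ext E (fun e => Cplus (Cmult (inner e a) (inner b e)) (inner (rank_sum r e) e))).
    { intro x; by rewrite inner_plus_l inner_scal_l. }
    apply is_unordered_sum_plus; auto; clear IH.
    intro eps; pose proof (norm_ge_0 a) as na.
    destruct (parseval E b hE (eps / (norm a + 1))) as [l0 [h1 h2]].
    { apply Rdiv_lt_0_compat; [apply cond_pos | paths; lra]. }
    exists l0; split; auto; intros l d hl hi; specialize (h2 l d hl hi).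
    fold (csum (fun e => Cmult (inner e a) (inner b e)) l).
    assert (Q : csum (fun e => Cmult (inner e a) (inner b e)) l = inner (expansion l b) a).
    { unfold expansion; rewrite inner_rank_sum csum_map; apply csum_ext; intros; simpl; ring. }
    rewrite Q -(Cmod_opp (Cminus _ _)).
    replace (Copp (Cminus (inner (expansion l b) a) (inner b a))) with
      (inner (minus b (expansion l b)) a) by (rewrite inner_minus_l; ring).
    eapply Rle_lt_trans; [apply cauchy_schwarz|].
    apply Rmult_lt_compat_r with (r := norm a + 1) in h2; [|paths; lra].
    replace (eps / (norm a + 1) * (norm a + 1)) with (pos eps) in h2 by (field; paths; lra).
    pose proof (norm_ge_0 (minus b (expansion l b))); paths; nra.
Qed.

(** * Laurent expansions with geometric remainder *)

Section FiniteSums.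

Context {V : NormedModule C_AbsRing}.
Implicit Types f g : nat -> V.

Fixpoint bsum f (n : nat) : V :=
  match n with O => zero | S m => plus (bsum f m) (f m) end.

Lemma bsum_ext f g n : (forall i, (i < n)%nat -> f i = g i) -> bsum f n = bsum g n.
Proof. induction n as [|n IH]; simpl; intro h; auto; rewrite IH ?h; auto. Qed.

Lemma bsum_plus f g n : bsum (fun i => plus (f i) (g i)) n = plus (bsum f n) (bsum g n).
Proof. induction n as [|n IH]; simpl; [vec_in V | rewrite IH; vec_in V]. Qed.

Lemma bsum_minus f g n : bsum (fun i => minus (f i) (g i)) n = minus (bsum f n) (bsum g n).
Proof. induction n as [|n IH]; simpl; [vec_in V | rewrite IH; vec_in V]. Qed.

Lemma bsum_scal (k : C) f n :
  bsum (fun i => @scal C_Ring V k (f i)) n = @scal C_Ring V k (bsum f n).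
Proof. induction n as [|n IH]; simpl; [vec_in V | rewrite IH; vec_in V]. Qed.

Lemma bsum_S_l f n : bsum f (S n) = plus (f 0%nat) (bsum (fun i => f (S i)) n).
Proof.
  induction n as [|n IH]; [simpl; vec_in V|].
  change (bsum f (S (S n))) with (plus (bsum f (S n)) (f (S n))).
  rewrite IH; simpl; vec_in V.
Qed.

Lemma norm_bsum_le f n B : (forall i, (i < n)%nat -> norm (f i) <= B) ->
  norm (bsum f n) <= INR n * B.
Proof.
  induction n as [|n IH]; intro h.
  - simpl; rewrite norm_z; lra.
  - rewrite S_INR; simpl bsum; eapply Rle_trans; [apply norm_plus_le|].
    specialize (IH ltac:(intros; apply h; lia)); specialize (h n ltac:(lia)); lra.
Qed.

Lemma bsum_zero f n : (forall i, (i < n)%nat -> f i = zero) -> bsum f n = zero.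
Proof.
  intro h; induction n as [|n IH]; simpl; auto; rewrite IH; [|intros; apply h; lia].
  rewrite h; [vec_in V | lia].
Qed.

Definition psum (a : nat -> V) (t : C) (n : nat) : V :=
  bsum (fun k => @scal C_Ring V (Cpow t k) (a k)) n.

Lemma psum_plus (a b : nat -> V) t n :
  psum (fun k => plus (a k) (b k)) t n = plus (psum a t n) (psum b t n).
Proof.
  unfold psum; rewrite -bsum_plus; apply bsum_ext; intros; vec_in V.
Qed.

(** [a k] is the Laurent coefficient of index [k - N] at [z0], with the rate of
    convergence of the expansion made explicit. *)
Definition expands (F : C -> V) (z0 : C) (N : nat) (a : nat -> V) : Prop :=
  exists K q, 0 <= K /\ 1 <= q /\ forall t, t <> RtoC 0 -> q * Cmod t < 1 -> forall n,
    norm (minus (@scal C_Ring V (Cpow t N) (F (Cplus z0 t))) (psum a t n)) <= K * (q * Cmod t) ^ n.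

Lemma expands_ext F G z0 N a r : 0 < r ->
  (forall z, punctured z0 r z -> F z = G z) -> expands F z0 N a -> expands G z0 N a.
Proof.
  (* The rate [q] also encodes the radius of validity [/ q]; raising it to at least [/ r] confines
     [t] to the disc where [F] and [G] agree. *)
  intros hr E [K [q [hK [hq h]]]]; exists K, (Rmax q (/ r)).
  assert (hr' : 0 < / r) by now apply Rinv_0_lt_compat.
  split; auto; split; [eapply Rle_trans; [exact hq | apply Rmax_l]|].
  intros t ht hm n; pose proof (Cmod_gt_0 t) as [pt _]; specialize (pt ht).
  assert (q * Cmod t <= Rmax q (/ r) * Cmod t) by (apply Rmult_le_compat_r; [lra | apply Rmax_l]).
  assert (/ r * Cmod t <= Rmax q (/ r) * Cmod t) by (apply Rmult_le_compat_r; [lra | apply Rmax_r]).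
  rewrite -E.
  - eapply Rle_trans; [apply h; auto; lra|]; apply Rmult_le_compat_l; auto.
    apply pow_incr; split; auto; apply Rmult_le_pos; lra.
  - unfold punctured; replace (Cminus (Cplus z0 t) z0) with t by ring; split; auto.
    apply Rmult_lt_reg_l with (/ r); auto; rewrite Rinv_l; lra.
Qed.

Lemma expands_mono F z0 N a : expands F z0 N a -> forall q0,
  exists K, 0 <= K /\ exists q, q0 <= q /\ 1 <= q /\ forall q', q <= q' ->
  forall t, t <> RtoC 0 -> q' * Cmod t < 1 -> forall n,
    norm (minus (@scal C_Ring V (Cpow t N) (F (Cplus z0 t))) (psum a t n)) <= K * (q' * Cmod t) ^ n.
Proof.
  intros [K [q [hK [hq h]]]] q0; exists K; split; auto; exists (Rmax q q0).
  split; [apply Rmax_r|]; split; [eapply Rle_trans; [exact hq | apply Rmax_l]|].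
  intros q' hq' t ht hm n; pose proof (Cmod_gt_0 t) as [pt _]; specialize (pt ht).
  assert (q * Cmod t <= q' * Cmod t).
  { apply Rmult_le_compat_r; [lra|]; pose proof (Rmax_l q q0); lra. }
  eapply Rle_trans; [apply h; auto; lra|]; apply Rmult_le_compat_l; auto.
  apply pow_incr; split; auto; apply Rmult_le_pos; lra.
Qed.

Lemma expands_plus F G z0 N a b : expands F z0 N a -> expands G z0 N b ->
  expands (fun z => plus (F z) (G z)) z0 N (fun k => plus (a k) (b k)).
Proof.
  intros hF hG.
  destruct (expands_mono _ _ _ _ hF 1) as [K [hK [q [_ [hq1 hq]]]]].
  destruct (expands_mono _ _ _ _ hG q) as [K' [hK' [q' [hqq [_ hq']]]]].
  exists (K + K'), q'; split; [lra|]; split; [lra|]; intros t ht hm n.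
  specialize (hq q' hqq t ht hm n); specialize (hq' q' (Rle_refl _) t ht hm n).
  rewrite psum_plus.
  rewrite (_ : minus _ _ = plus (minus (@scal C_Ring V (Cpow t N) (F (Cplus z0 t))) (psum a t n))
     (minus (@scal C_Ring V (Cpow t N) (G (Cplus z0 t))) (psum b t n))); [|vec_in V].
  eapply Rle_trans; [apply norm_plus_le|].
  rewrite Rmult_plus_distr_r; now apply Rplus_le_compat.
Qed.

Lemma expands_shift m F z0 N a : expands F z0 N a ->
  expands F z0 (m + N) (fun k => if Nat.ltb k m then zero else a (k - m)%nat).
Proof.
  induction m as [|m IH]; intro h.
  - destruct h as [K [q h]]; exists K, q; destruct h as [h1 [h2 h]]; repeat split; auto.
    intros t ht hm n; eapply Rle_trans; [|apply (h t ht hm n)]; apply Req_le; f_equal; f_equal.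
    apply bsum_ext; intros i _; f_equal; simpl; f_equal; lia.
  - destruct (IH h) as [K [q [h1 [h2 h3]]]].
    exists (K * 2), q; split; [lra|]; split; auto; intros t ht hm n.
    pose proof (Cmod_gt_0 t) as [pt _]; specialize (pt ht).
    destruct n as [|n].
    + specialize (h3 t ht hm 0%nat); simpl psum in *; unfold psum in *; simpl bsum in *.
      rewrite (_ : minus _ zero = @scal C_Ring V t (minus
        (@scal C_Ring V (Cpow t (m + N)) (F (Cplus z0 t))) zero)); [|simpl; vec_in V].
      rewrite norm_scal_eq.
      apply Rle_trans with (Cmod t * (K * (q * Cmod t) ^ 0)).
      { apply Rmult_le_compat_l; [lra | exact h3]. }
      rewrite !pow_O; assert (Cmod t <= 1) by nra; nra.
    + specialize (h3 t ht hm n); unfold psum in *; rewrite bsum_S_l.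
      simpl Nat.ltb; cbv beta iota.
      set (B := bsum _ n) in h3.
      rewrite (_ : minus _ _ = @scal C_Ring V t (minus
        (@scal C_Ring V (Cpow t (m + N)) (F (Cplus z0 t))) B)).
      * rewrite norm_scal_eq.
        apply Rle_trans with (Cmod t * (K * (q * Cmod t) ^ n)).
        { apply Rmult_le_compat_l; [lra | exact h3]. }
        rewrite -tech_pow_Rmult.
        pose proof (pow_le (q * Cmod t) n ltac:(nra)).
        assert (0 <= K * (q * Cmod t) ^ n) by (apply Rmult_le_pos; auto).
        replace (K * 2 * (q * Cmod t * (q * Cmod t) ^ n)) with
          ((2 * q) * Cmod t * (K * (q * Cmod t) ^ n)) by ring.
        apply Rmult_le_compat_r; nra.
      * assert (E : bsum (fun i => @scal C_Ring V (Cpow t (S i))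
            (if Nat.ltb (S i) (S m) then zero else a (S i - S m)%nat)) n = @scal C_Ring V t B).
        { unfold B; rewrite -bsum_scal; apply bsum_ext; intros i _.
          change (Nat.ltb (S i) (S m)) with (Nat.ltb i m).
          change (S i - S m)%nat with (i - m)%nat; simpl Cpow; vec_in V. }
        rewrite E; simpl; vec_in V.
Qed.

(** A single term of the expansion is the difference of two consecutive remainders. *)
Lemma expands_coef F z0 N a : expands F z0 N a ->
  exists K q, 0 <= K /\ 1 <= q /\ forall q', q <= q' -> forall t, t <> RtoC 0 -> q' * Cmod t < 1 ->
    (forall n, norm (minus (@scal C_Ring V (Cpow t N) (F (Cplus z0 t))) (psum a t n)) <= K * (q' * Cmod t) ^ n) /\
    (forall n, norm (@scal C_Ring V (Cpow t n) (a n)) <= 2 * K * (q' * Cmod t) ^ n).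
Proof.
  intro h; destruct (expands_mono _ _ _ _ h 1) as [K [hK [q [_ [hq1 hq]]]]].
  exists K, q; repeat split; auto; intro n.
  pose proof (hq q' H t H0 H1 n) as A; pose proof (hq q' H t H0 H1 (S n)) as B.
  unfold psum in *; simpl bsum in B; set (P := bsum _ _) in *.
  rewrite (_ : @scal C_Ring V (Cpow t n) (a n) =
     minus (minus (@scal C_Ring V (Cpow t N) (F (Cplus z0 t))) P)
       (minus (@scal C_Ring V (Cpow t N) (F (Cplus z0 t))) (plus P (@scal C_Ring V (Cpow t n) (a n)))));
    [|vec_in V].
  eapply Rle_trans; [apply norm_minus_le|].
  rewrite -tech_pow_Rmult in B.
  pose proof (Cmod_gt_0 t) as [pt _]; specialize (pt H0).
  pose proof (pow_le (q' * Cmod t) n ltac:(nra)).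
  assert (q' * Cmod t * (q' * Cmod t) ^ n <= (q' * Cmod t) ^ n) by nra.
  nra.
Qed.

(** Strong induction: once the earlier coefficients agree, the remainders of order [S n] bound
    [Cmod t ^ n * norm (a n - b n)] by a multiple of [Cmod t ^ S n]; divide and let [t] tend to
    0. *)
Lemma expands_unique F z0 N a b : expands F z0 N a -> expands F z0 N b -> forall n, a n = b n.
Proof.
  intros ha hb.
  destruct (expands_mono _ _ _ _ ha 1) as [K [hK [q [_ [hq1 hq]]]]].
  destruct (expands_mono _ _ _ _ hb q) as [K' [hK' [q' [hqq [_ hq']]]]].
  intro n; induction n as [n IH] using (well_founded_induction Wf_nat.lt_wf).
  assert (E : forall t, t <> RtoC 0 -> q' * Cmod t < 1 ->
     norm (minus (a n) (b n)) <= (K + K') * q' ^ S n * Cmod t).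
  { intros t ht hm.
    pose proof (hq q' hqq t ht hm (S n)) as A; pose proof (hq' q' (Rle_refl _) t ht hm (S n)) as B.
    pose proof (Cmod_gt_0 t) as [pt _]; specialize (pt ht).
    unfold psum in *; simpl bsum in A, B.
    rewrite (bsum_ext (fun k => @scal C_Ring V (Cpow t k) (a k)) (fun k => @scal C_Ring V (Cpow t k) (b k))) in A.
    2: { intros i hi; rewrite IH //. }
    set (P := bsum _ _) in *; set (G := @scal C_Ring V (Cpow t N) (F (Cplus z0 t))) in *.
    assert (L : norm (@scal C_Ring V (Cpow t n) (minus (a n) (b n))) <= (K + K') * (q' * Cmod t) ^ S n).
    { rewrite (_ : @scal C_Ring V _ _ = minus (minus G (plus P (@scal C_Ring V (Cpow t n) (b n))))
        (minus G (plus P (@scal C_Ring V (Cpow t n) (a n))))); [|vec_in V].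
      eapply Rle_trans; [apply norm_minus_le|]; lra. }
    rewrite norm_scal_eq Cmod_pow Rpow_mult_distr in L.
    pose proof (pow_lt (Cmod t) n pt).
    apply Rmult_le_reg_l with (Cmod t ^ n); auto.
    eapply Rle_trans; [exact L|]; apply Req_le; simpl; ring. }
  apply norm_small_eq; intros eps he.
  set (M := (K + K') * q' ^ S n) in *.
  assert (hM : 0 <= M) by (apply Rmult_le_pos; [lra | apply pow_le; lra]).
  set (s := Rmin (/ (2 * q')) (eps / (M + 1))).
  assert (hs : 0 < s).
  { apply Rmin_pos; [apply Rinv_0_lt_compat; lra | apply Rdiv_lt_0_compat; lra]. }
  assert (cs : Cmod (RtoC s) = s) by (rewrite Cmod_R Rabs_right; lra).
  eapply Rle_trans; [apply (E (RtoC s))|]; rewrite ?cs.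
  - intro A; apply (f_equal fst) in A; simpl in A; lra.
  - pose proof (Rmin_l (/ (2 * q')) (eps / (M + 1))) as L; fold s in L.
    apply Rmult_le_compat_l with (r := q') in L; [|lra].
    replace (q' * / (2 * q')) with (/ 2) in L by (field; lra); lra.
  - pose proof (Rmin_r (/ (2 * q')) (eps / (M + 1))) as L; fold s in L.
    apply Rmult_le_compat_l with (r := M + 1) in L; [|lra].
    replace ((M + 1) * (eps / (M + 1))) with eps in L by (field; lra); nra.
Qed.

Lemma expands_const (x : V) z0 :
  expands (fun _ => x) z0 0 (fun k => if Nat.eqb k 0 then x else zero).
Proof.
  exists (norm x), 1; split; [apply norm_ge_0|]; split; [lra|]; intros t ht hm n.
  pose proof (Cmod_ge_0 t); pose proof (pow_le (1 * Cmod t) n ltac:(lra)).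
  pose proof (norm_ge_0 x).
  destruct n as [|n]; unfold psum.
  - simpl; rewrite (_ : minus _ zero = x); [lra | vec_in V].
  - rewrite bsum_S_l bsum_zero; [|intros; simpl; vec_in V].
    rewrite (_ : minus _ _ = zero); [|simpl; vec_in V].
    rewrite norm_z; apply Rmult_le_pos; auto.
Qed.

Lemma expands_affine (w : C) (x : V) z0 :
  expands (fun z => @scal C_Ring V (Cminus z w) x) z0 0
    (fun k => match k with O => @scal C_Ring V (Cminus z0 w) x | S O => x | _ => zero end).
Proof.
  exists ((Cmod (Cminus z0 w) + 1) * norm x), 1.
  pose proof (norm_ge_0 x); pose proof (Cmod_ge_0 (Cminus z0 w)).
  split; [apply Rmult_le_pos; lra|]; split; [lra|]; intros t ht hm n.
  pose proof (Cmod_ge_0 t); pose proof (pow_le (1 * Cmod t) n ltac:(lra)).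
  destruct n as [|[|n]]; unfold psum.
  - simpl; rewrite (_ : minus _ zero = @scal C_Ring V (Cplus (Cminus z0 w) t) x); [|vec_in V].
    rewrite norm_scal_eq Rmult_1_r; apply Rmult_le_compat_r; auto.
    eapply Rle_trans; [apply Cmod_triangle|]; lra.
  - simpl; rewrite (_ : minus _ _ = @scal C_Ring V t x); [|vec_in V].
    rewrite norm_scal_eq.
    pose proof (Rmult_le_pos _ _ (Cmod_ge_0 (Cminus z0 w)) (Rmult_le_pos _ _ (norm_ge_0 x) (Cmod_ge_0 t))).
    lra.
  - rewrite !bsum_S_l bsum_zero; [|intros; simpl; vec_in V].
    rewrite (_ : minus _ _ = zero); [|simpl; vec_in V].
    rewrite norm_z; apply Rmult_le_pos; auto; apply Rmult_le_pos; lra.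
Qed.

End FiniteSums.

Section OperatorProducts.

Context {U V W : NormedModule C_AbsRing}.

Definition conv (a : nat -> Bop V W) (b : nat -> Bop U V) (k : nat) : Bop U W :=
  bsum (V := Bop_NormedModule U W) (fun i => bop_comp (a i) (b (k - i)%nat)) (S k).

Lemma bop_comp_scal (s t : C) (S : Bop V W) (T : Bop U V) :
  bop_comp (bop_scal s S) (bop_scal t T) = bop_scal (Cmult s t) (bop_comp S T).
Proof. apply bop_ext; intro x; simpl; rewrite bopZ; vec_in W. Qed.

Lemma bop_comp_minus_l (S S' : Bop V W) (T : Bop U V) :
  bop_comp (minus S S') T = minus (bop_comp S T) (bop_comp S' T).
Proof. apply bop_ext; intro x; simpl; vec_in W. Qed.

Lemma bop_comp_minus_r (S : Bop V W) (T T' : Bop U V) :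
  bop_comp S (minus T T') = minus (bop_comp S T) (bop_comp S T').
Proof. apply bop_ext; intro x; simpl; rewrite bopD bopN; vec_in W. Qed.

Lemma bop_comp_bsum_l (f : nat -> Bop V W) (T : Bop U V) n :
  bop_comp (bsum (V := Bop_NormedModule V W) f n) T =
  bsum (V := Bop_NormedModule U W) (fun i => bop_comp (f i) T) n.
Proof.
  induction n as [|n IH]; simpl; [now apply bop_ext|].
  by rewrite -IH; apply bop_ext.
Qed.

(** The truncated Cauchy product covers the triangle of index sum below [n]; it is summed here by
    rows, each row being a truncation of the second factor. *)
Lemma psum_conv (a : nat -> Bop V W) (b : nat -> Bop U V) t n :
  psum (V := Bop_NormedModule U W) (conv a b) t n =
  bsum (V := Bop_NormedModule U W)
    (fun i => bop_comp (bop_scal (Cpow t i) (a i)) (psum (V := Bop_NormedModule U V) b t (n - i))) n.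
Proof.
  induction n as [|n IH]; [reflexivity|].
  unfold psum at 1; simpl bsum at 1; fold (psum (V := Bop_NormedModule U W) (conv a b) t n).
  rewrite IH; clear IH.
  transitivity (bsum (V := Bop_NormedModule U W) (fun i => plus
     (bop_comp (bop_scal (Cpow t i) (a i)) (psum (V := Bop_NormedModule U V) b t (n - i)))
     (bop_scal (Cpow t n) (bop_comp (a i) (b (n - i)%nat)))) (S n)).
  - rewrite bsum_plus; unfold conv.
    rewrite -(bsum_scal (V := Bop_NormedModule U W)).
    simpl bsum at 3; rewrite Nat.sub_diag.
    rewrite (_ : bop_comp _ (psum (V := Bop_NormedModule U V) b t 0) = zero).
    + rewrite plus_zero_r; reflexivity.
    + apply bop_ext; intro x; simpl; rewrite bop0; apply (scal_z (V := W)).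
  - apply bsum_ext; intros i hi.
    replace (S n - i)%nat with (S (n - i)) by lia.
    unfold psum at 2; simpl bsum; fold (psum (V := Bop_NormedModule U V) b t (n - i)).
    apply bop_ext; intro x; simpl; rewrite bopD bopZ.
    replace (Cpow t n) with (Cmult (Cpow t i) (Cpow t (n - i))).
    + vec_in W.
    + rewrite -Cpow_add_r; f_equal; lia.
Qed.

(** In a product of expansions, n cross terms of weight 2 and one further term appear; this
    inequality absorbs them by tripling the rate. *)
Lemma pow3_ge (n : nat) : 2 * INR n + 1 <= 3 ^ n.
Proof.
  induction n as [|n IH]; [simpl; lra|].
  rewrite S_INR -tech_pow_Rmult; pose proof (pos_INR n); lra.
Qed.

(** With [X_n], [Y_n] the truncations, the remainder of [X Y] is [(X - X_n) Y] plus the sum of the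
    [t^i a_i (Y - Y_(n-i))], where every term has size [s ^ n]. *)
Lemma expands_comp (F : C -> Bop V W) (G : C -> Bop U V) z0 N M a b :
  expands (V := Bop_NormedModule V W) F z0 N a -> expands (V := Bop_NormedModule U V) G z0 M b ->
  expands (V := Bop_NormedModule U W) (fun z => bop_comp (F z) (G z)) z0 (N + M) (conv a b).
Proof.
  intros hF hG.
  destruct (expands_coef _ _ _ _ hF) as [K [q [hK [hq1 hq]]]].
  destruct (expands_mono _ _ _ _ hG q) as [K' [hK' [q' [hqq [hq'1 hq']]]]].
  exists (K * K'), (3 * q'); split; [now apply Rmult_le_pos|]; split; [lra|]; intros t ht hm n.
  pose proof (Cmod_gt_0 t) as [pt _]; specialize (pt ht).
  assert (hm' : q' * Cmod t < 1) by nra.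
  destruct (hq q' hqq t ht hm') as [A1 A2]; specialize (hq' q' (Rle_refl _) t ht hm').
  set (s := q' * Cmod t) in *.
  assert (hs : 0 <= s) by (unfold s; nra).
  set (X := bop_scal (Cpow t N) (F (Cplus z0 t))).
  set (Y := bop_scal (Cpow t M) (G (Cplus z0 t))).
  assert (A1' : forall n, op_norm (minus X (psum (V := Bop_NormedModule V W) a t n)) <= K * s ^ n) by exact A1.
  assert (B' : forall n, op_norm (minus Y (psum (V := Bop_NormedModule U V) b t n)) <= K' * s ^ n) by exact hq'.
  assert (A2' : forall n, op_norm (bop_scal (Cpow t n) (a n)) <= 2 * K * s ^ n) by exact A2.
  clear A1 A2 hq hq'.
  assert (E : minus (bop_comp X Y) (psum (V := Bop_NormedModule U W) (conv a b) t n) =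
     plus (bop_comp (minus X (psum (V := Bop_NormedModule V W) a t n)) Y)
       (bsum (V := Bop_NormedModule U W) (fun i => bop_comp (bop_scal (Cpow t i) (a i))
          (minus Y (psum (V := Bop_NormedModule U V) b t (n - i)))) n)).
  { rewrite psum_conv.
    rewrite (bsum_ext (V := Bop_NormedModule U W) (fun i => bop_comp (bop_scal (Cpow t i) (a i))
          (minus Y (psum (V := Bop_NormedModule U V) b t (n - i))))
        (fun i => minus (bop_comp (bop_scal (Cpow t i) (a i)) Y)
            (bop_comp (bop_scal (Cpow t i) (a i)) (psum (V := Bop_NormedModule U V) b t (n - i))))).
    - rewrite (bsum_minus (V := Bop_NormedModule U W)) -bop_comp_bsum_l bop_comp_minus_l.
      change (psum (V := Bop_NormedModule V W) a t n) with
        (bsum (V := Bop_NormedModule V W) (fun i => bop_scal (Cpow t i) (a i)) n).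
      vec_in (Bop_NormedModule U W).
    - intros; apply bop_comp_minus_r. }
  assert (EX : @scal C_Ring (Bop_NormedModule U W) (Cpow t (N + M)) (bop_comp (F (Cplus z0 t)) (G (Cplus z0 t)))
     = bop_comp X Y).
  { unfold X, Y; rewrite bop_comp_scal -Cpow_add_r //. }
  change (op_norm (minus (@scal C_Ring (Bop_NormedModule U W) (Cpow t (N + M)) (bop_comp (F (Cplus z0 t)) (G (Cplus z0 t))))
    (psum (V := Bop_NormedModule U W) (conv a b) t n)) <= K * K' * (3 * q' * Cmod t) ^ n).
  rewrite EX E.
  eapply Rle_trans; [apply op_norm_triangle|].
  apply Rle_trans with (K * K' * s ^ n + INR n * (2 * K * K' * s ^ n)).
  - apply Rplus_le_compat.
    + eapply Rle_trans; [apply op_norm_comp|].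
      specialize (A1' n); specialize (B' 0%nat).
      change (psum (V := Bop_NormedModule U V) b t 0) with (zero : Bop_NormedModule U V) in B'.
      rewrite (_ : minus Y zero = Y) in B'; [|vec_in (Bop_NormedModule U V)].
      simpl pow in B'; rewrite Rmult_1_r in B'.
      replace (K * K' * s ^ n) with (K * s ^ n * K') by ring.
      apply Rmult_le_compat; auto; apply op_norm_ge_0.
    + apply (norm_bsum_le (V := Bop_NormedModule U W)); intros i hi.
      eapply Rle_trans; [apply op_norm_comp|].
      replace (2 * K * K' * s ^ n) with ((2 * K * s ^ i) * (K' * s ^ (n - i))).
      * apply Rmult_le_compat; auto; apply op_norm_ge_0.
      * replace (s ^ n) with (s ^ i * s ^ (n - i)) by (rewrite -pow_add; f_equal; lia); ring.
  - replace (3 * q' * Cmod t) with (3 * s) by (unfold s; ring).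
    rewrite Rpow_mult_distr.
    pose proof (pow3_ge n); pose proof (pow_le s n hs).
    assert (0 <= K * K' * s ^ n) by (apply Rmult_le_pos; auto; now apply Rmult_le_pos).
    replace (K * K' * s ^ n + INR n * (2 * K * K' * s ^ n)) with ((2 * INR n + 1) * (K * K' * s ^ n)) by ring.
    replace (K * K' * (3 ^ n * s ^ n)) with (3 ^ n * (K * K' * s ^ n)) by ring.
    apply Rmult_le_compat_r; auto.
Qed.

End OperatorProducts.

(** * Finitely meromorphic germs, traces of residues, local analyticity *)

Definition fmero {U V : HilbertSpace} (F : C -> Bop U V) (z0 : C) : Prop :=
  exists N a, expands (V := Bop_NormedModule U V) F z0 N a /\
    forall k, (k < N)%nat -> has_rank_sum (a k).

(** With the pole order bounded by [S N], the coefficient [a N] has index -1: it is the residue. *)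
Definition rtrace {H : HilbertSpace} (F : C -> Bop H H) (z0 t : C) : Prop :=
  exists N a, expands (V := Bop_NormedModule H H) F z0 (S N) a /\ ftrace (a N) t.

(** Analyticity as an expansion without negative powers whose constant term is the actual value. It
    inherits sums and products from [expands] and implies complex differentiability. *)
Definition holo {V : NormedModule C_AbsRing} (F : C -> V) (z : C) : Prop :=
  exists a, expands F z 0 a /\ a 0%nat = F z.

Lemma has_rank_sum_bsum {U V : HilbertSpace} (f : nat -> Bop U V) n :
  (forall i, (i < n)%nat -> has_rank_sum (f i)) ->
  has_rank_sum (bsum (V := Bop_NormedModule U V) f n).
Proof.
  induction n as [|n IH]; intro h; simpl; [apply has_rank_sum_zero|].
  apply has_rank_sum_plus; auto.
Qed.

Section FinitelyMeromorphic.

Context {U V W : HilbertSpace}.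

Lemma fmero_shift (F : C -> Bop U V) z0 N a m :
  expands (V := Bop_NormedModule U V) F z0 N a -> (forall k, (k < N)%nat -> has_rank_sum (a k)) ->
  exists b, expands (V := Bop_NormedModule U V) F z0 (m + N) b /\
    forall k, (k < m + N)%nat -> has_rank_sum (b k).
Proof.
  intros h ha; eexists; split; [apply (expands_shift m); exact h|].
  intros k hk; simpl; destruct (Nat.ltb_spec k m); [apply has_rank_sum_zero | apply ha; lia].
Qed.

Lemma fmero_plus (F G : C -> Bop U V) z0 :
  fmero F z0 -> fmero G z0 -> fmero (fun z => bop_plus (F z) (G z)) z0.
Proof.
  intros [N [a [h1 h2]]] [M [b [g1 g2]]].
  destruct (fmero_shift F z0 N a M h1 h2) as [a' [h1' h2']].
  destruct (fmero_shift G z0 M b N g1 g2) as [b' [g1' g2']].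
  replace (N + M)%nat with (M + N)%nat in * by lia.
  exists (M + N)%nat; eexists; split; [apply (expands_plus _ _ _ _ _ _ h1' g1')|].
  intros k hk; apply has_rank_sum_plus; auto.
Qed.

Lemma fmero_const (T : Bop U V) z0 : fmero (fun _ => T) z0.
Proof.
  exists 0%nat; eexists; split; [apply (expands_const (V := Bop_NormedModule U V))|]; lia.
Qed.

Lemma fmero_affine (w : C) (T : Bop U V) z0 : fmero (fun z => bop_scal (Cminus z w) T) z0.
Proof.
  exists 0%nat; eexists; split; [apply (expands_affine (V := Bop_NormedModule U V))|]; lia.
Qed.

Lemma fmero_ext (F G : C -> Bop U V) z0 r : 0 < r ->
  (forall z, punctured z0 r z -> F z = G z) -> fmero F z0 -> fmero G z0.
Proof.
  intros hr E [N [a [h1 h2]]]; exists N, a; split; auto.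
  now apply (expands_ext (V := Bop_NormedModule U V) F G z0 N a r).
Qed.

(** If [i + j < N + M], then [i < N] or [j < M]: each term of a coefficient of negative index has a
    factor of finite rank. *)
Lemma fmero_comp (F : C -> Bop V W) (G : C -> Bop U V) z0 :
  fmero F z0 -> fmero G z0 -> fmero (fun z => bop_comp (F z) (G z)) z0.
Proof.
  intros [N [a [h1 h2]]] [M [b [g1 g2]]].
  exists (N + M)%nat, (conv a b); split; [now apply expands_comp|].
  intros k hk; apply has_rank_sum_bsum; intros i hi.
  destruct (Nat.lt_ge_cases i N).
  - apply has_rank_sum_comp_l; auto.
  - apply has_rank_sum_comp_r; apply g2; lia.
Qed.

End FinitelyMeromorphic.

Lemma fmero_scal {U V : HilbertSpace} (k : C) (F : C -> Bop U V) z0 :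
  fmero F z0 -> fmero (fun z => bop_scal k (F z)) z0.
Proof.
  intro h; apply (fmero_ext (fun z => bop_comp (bop_scal k (bop_id V)) (F z)) _ z0 1); [lra| |].
  - intros; now apply bop_ext.
  - apply fmero_comp; auto; apply fmero_const.
Qed.

Lemma bsum_rev {V : NormedModule C_AbsRing} (f : nat -> V) n :
  bsum f (S n) = bsum (fun i => f (n - i)%nat) (S n).
Proof.
  induction n as [|n IH]; [reflexivity|].
  rewrite (bsum_S_l (fun i => f (S n - i)%nat)).
  change (bsum f (S (S n))) with (plus (bsum f (S n)) (f (S n))).
  rewrite IH Nat.sub_0_r plus_comm; reflexivity.
Qed.

Section ResidueTraces.

Context {H : HilbertSpace}.
Implicit Types F G : C -> Bop H H.

Lemma rtrace_ext F G z0 r t : 0 < r ->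
  (forall z, punctured z0 r z -> F z = G z) -> rtrace F z0 t -> rtrace G z0 t.
Proof.
  intros hr E [N [a [h1 h2]]]; exists N, a; split; auto.
  now apply (expands_ext (V := Bop_NormedModule H H) F G z0 (S N) a r).
Qed.

Lemma rtrace_shift F z0 N a t m :
  expands (V := Bop_NormedModule H H) F z0 (S N) a -> ftrace (a N) t ->
  exists b, expands (V := Bop_NormedModule H H) F z0 (S (m + N)) b /\ ftrace (b (m + N)%nat) t.
Proof.
  intros h ha; eexists; split.
  - replace (S (m + N)) with (m + S N)%nat by lia; apply (expands_shift m); exact h.
  - simpl; destruct (Nat.ltb_spec (m + N) m); [lia|].
    by replace (m + N - m)%nat with N by lia.
Qed.

Lemma rtrace_plus F G z0 s t :
  rtrace F z0 s -> rtrace G z0 t -> rtrace (fun z => bop_plus (F z) (G z)) z0 (Cplus s t).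
Proof.
  intros [N [a [h1 h2]]] [M [b [g1 g2]]].
  destruct (rtrace_shift F z0 N a s M h1 h2) as [a' [h1' h2']].
  destruct (rtrace_shift G z0 M b t N g1 g2) as [b' [g1' g2']].
  replace (N + M)%nat with (M + N)%nat in * by lia.
  exists (M + N)%nat; eexists; split; [apply (expands_plus _ _ _ _ _ _ h1' g1')|].
  now apply ftrace_plus.
Qed.

Lemma rtrace_scal k F z0 t : rtrace F z0 t -> rtrace (fun z => bop_scal k (F z)) z0 (Cmult k t).
Proof.
  intros [N [a [[K [q [hK [hq h]]]] h2]]].
  exists N, (fun i => bop_scal k (a i)); split; [|now apply ftrace_scal].
  exists (Cmod k * K), q; split; [apply Rmult_le_pos; auto; apply Cmod_ge_0|]; split; auto.
  intros t' ht hm n; rewrite Rmult_assoc; specialize (h t' ht hm n).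
  apply Rmult_le_compat_l with (r := Cmod k) in h; [|apply Cmod_ge_0].
  rewrite -(norm_scal_eq (V := Bop_NormedModule H H)) in h.
  eapply Rle_trans; [apply Req_le | exact h].
  assert (E : psum (V := Bop_NormedModule H H) (fun i => bop_scal k (a i)) t' n =
    @scal C_Ring (Bop_NormedModule H H) k (psum (V := Bop_NormedModule H H) a t' n)).
  { unfold psum; rewrite -(bsum_scal (V := Bop_NormedModule H H)); apply bsum_ext; intros i _.
    change (bop_scal k (a i)) with (@scal C_Ring (Bop_NormedModule H H) k (a i)).
    vec_in (Bop_NormedModule H H). }
  rewrite E; change (bop_scal k (F (Cplus z0 t'))) with
    (@scal C_Ring (Bop_NormedModule H H) k (F (Cplus z0 t'))).
  f_equal; vec_in (Bop_NormedModule H H).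
Qed.

Lemma rtrace_unique F z0 s t : rtrace F z0 s -> rtrace F z0 t -> s = t.
Proof.
  intros [N [a [h1 h2]]] [M [b [g1 g2]]].
  destruct (rtrace_shift F z0 N a s M h1 h2) as [a' [h1' h2']].
  destruct (rtrace_shift F z0 M b t N g1 g2) as [b' [g1' g2']].
  replace (N + M)%nat with (M + N)%nat in * by lia.
  rewrite (expands_unique _ _ _ _ _ h1' g1') in h2'.
  exact (ftrace_unique _ _ _ h2' g2').
Qed.

Lemma ftrace_bsum_pair {U V : HilbertSpace} (f : nat -> Bop U U) (g : nat -> Bop V V) n :
  (forall i, (i < n)%nat -> exists t, ftrace (f i) t /\ ftrace (g i) t) ->
  exists t, ftrace (bsum (V := Bop_NormedModule U U) f n) t /\
            ftrace (bsum (V := Bop_NormedModule V V) g n) t.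
Proof.
  induction n as [|n IH]; intro h; simpl.
  - exists (RtoC 0); split; apply ftrace_zero.
  - destruct IH as [s [s1 s2]]; [auto|]; destruct (h n) as [t [t1 t2]]; [lia|].
    exists (Cplus s t); split; now apply ftrace_plus.
Qed.

End ResidueTraces.

(** Both residues are sums of products of the same pairs of coefficients, in opposite orders. Their
    indices add up to -1, so one member of each pair has finite rank and the trace is exchanged term
    by term. *)
Lemma rtrace_cyclic {U V : HilbertSpace} (F : C -> Bop V U) (G : C -> Bop U V) z0 :
  fmero F z0 -> fmero G z0 ->
  exists t, rtrace (fun z => bop_comp (F z) (G z)) z0 t /\
            rtrace (fun z => bop_comp (G z) (F z)) z0 t.
Proof.
  intros [N [a0 [h1 h2]]] [M [b [g1 g2]]].
  (* A vanishing leading coefficient is added so that the product has a coefficient of index -1 even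
     if neither factor has a pole. *)
  destruct (fmero_shift F z0 N a0 1 h1 h2) as [a [a1 a2]]; clear h1 h2; simpl in a1, a2.
  destruct (ftrace_bsum_pair (fun i => bop_comp (a i) (b (N + M - i)%nat))
    (fun i => bop_comp (b (N + M - i)%nat) (a i)) (S (N + M))) as [t [t1 t2]].
  { intros i hi; apply ftrace_cyclic.
    destruct (Nat.lt_ge_cases i (S N)); [left; auto | right; apply g2; lia]. }
  exists t; split.
  - exists (N + M)%nat, (conv a b); split; auto.
    apply (expands_comp F G z0 (S N) M); auto.
  - exists (N + M)%nat, (conv b a); split.
    + replace (S (N + M)) with (M + S N)%nat by lia.
      apply (expands_comp G F z0 M (S N)); auto.
    + unfold conv; rewrite (bsum_rev (V := Bop_NormedModule V V)).
      rewrite (bsum_ext (V := Bop_NormedModule V V) _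
         (fun i => bop_comp (b (N + M - i)%nat) (a i))); auto.
      intros i hi; f_equal; f_equal; lia.
Qed.

Lemma is_derive_quadratic (V : NormedModule C_AbsRing) (f : C -> V) (z : C) (l : V) K d :
  0 < d -> (forall y, Cmod (Cminus y z) < d ->
    norm (minus (minus (f y) (f z)) (@scal C_Ring V (Cminus y z) l)) <= K * Cmod (Cminus y z) ^ 2) ->
  @is_derive C_AbsRing V f z l.
Proof.
  intros hd h; split; [apply (is_linear_scal_l (K := C_AbsRing))|].
  intros x hx; apply (is_filter_lim_locally_unique (V := AbsRing_NormedModule C_AbsRing)) in hx.
  subst x; intro eps.
  set (K' := Rabs K + 1).
  assert (hK : 0 < K') by (unfold K'; pose proof (Rabs_pos K); lra).
  assert (hm : 0 < Rmin d (eps / K')).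
  { apply Rmin_pos; auto; apply Rdiv_lt_0_compat; auto; apply cond_pos. }
  exists (mkposreal _ hm); intros y hy; simpl in hy.
  change (Cmod (Cminus y z) < Rmin d (eps / K')) in hy.
  eapply Rle_trans; [apply h; eapply Rlt_le_trans; [exact hy | apply Rmin_l]|].
  change (K * Cmod (Cminus y z) ^ 2 <= eps * Cmod (Cminus y z)).
  pose proof (Rmin_r d (eps / K')) as L; pose proof (Cmod_ge_0 (Cminus y z)).
  assert (E : K' * (eps / K') = eps) by (field; lra).
  assert (K' * Cmod (Cminus y z) <= eps) by nra.
  assert (K <= K') by (unfold K'; pose proof (Rle_abs K); lra).
  simpl; nra.
Qed.

Section Holomorphic.

Context {V : NormedModule C_AbsRing}.
Implicit Types F G : C -> V.

(** The truncations of length 1 and 2: a Lipschitz estimate, used for continuity, and a quadratic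
    one, used for the derivative [a 1]. *)
Lemma holo_bound F z : holo F z -> exists l K d, 0 < d /\ 0 <= K /\
  forall y, Cmod (Cminus y z) < d ->
    norm (minus (F y) (F z)) <= K * Cmod (Cminus y z) /\
    norm (minus (minus (F y) (F z)) (@scal C_Ring V (Cminus y z) l)) <= K * Cmod (Cminus y z) ^ 2.
Proof.
  intros [a [[K [q [hK [hq h]]]] h0]]; exists (a 1%nat), (K * q ^ 2), (/ q).
  assert (0 < / q) by (apply Rinv_0_lt_compat; lra).
  split; auto; split; [apply Rmult_le_pos; auto; apply pow2_ge_0|]; intros y hy.
  destruct (classic (y = z)) as [->|N].
  - replace (Cminus z z) with (RtoC 0) by ring; rewrite Cmod_0.
    rewrite (_ : minus (F z) (F z) = zero); [|vec_in V].
    rewrite (_ : minus _ _ = zero); [|vec_in V]; rewrite norm_z; lra.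
  - assert (ht : Cminus y z <> RtoC 0).
    { intro E; apply N; transitivity (Cplus (Cminus y z) z); [ring | rewrite E; ring]. }
    assert (hm : q * Cmod (Cminus y z) < 1).
    { apply Rmult_lt_compat_l with (r := q) in hy; [|lra].
      replace (q * / q) with 1 in hy by (field; lra); lra. }
    specialize (h _ ht hm); replace (Cplus z (Cminus y z)) with y in h by ring.
    pose proof (h 1%nat) as B1; pose proof (h 2%nat) as B2; unfold psum in B1, B2; simpl bsum in B1, B2.
    pose proof (Cmod_ge_0 (Cminus y z)).
    split.
    + eapply Rle_trans; [eapply Rle_trans; [|exact B1]|].
      * apply Req_le; f_equal; rewrite -h0; simpl; vec_in V.
      * replace (K * (q * Cmod (Cminus y z)) ^ 1) with ((K * Cmod (Cminus y z)) * q) by ring.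
        replace (K * q ^ 2 * Cmod (Cminus y z)) with ((K * Cmod (Cminus y z)) * q ^ 2) by ring.
        apply Rmult_le_compat_l; [now apply Rmult_le_pos | nra].
    + eapply Rle_trans; [eapply Rle_trans; [|exact B2]|].
      * apply Req_le; f_equal; rewrite -h0; simpl; vec_in V.
      * apply Req_le; ring.
Qed.

Lemma holo_ex_derive F z : holo F z -> @ex_derive C_AbsRing V F z.
Proof.
  intro h; destruct (holo_bound F z h) as [l [K [d [hd [_ hK]]]]].
  exists l; apply is_derive_quadratic with K d; auto; intros y hy; now apply hK.
Qed.

Lemma holo_plus F G z : holo F z -> holo G z -> holo (fun z => plus (F z) (G z)) z.
Proof.
  intros [a [h1 h2]] [b [g1 g2]]; eexists; split; [apply (expands_plus _ _ _ _ _ _ h1 g1)|].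
  simpl; by rewrite h2 g2.
Qed.

Lemma holo_const (x : V) z : holo (fun _ => x) z.
Proof. eexists; split; [apply expands_const | reflexivity]. Qed.

Lemma holo_affine w (x : V) z : holo (fun z => @scal C_Ring V (Cminus z w) x) z.
Proof. eexists; split; [apply expands_affine | reflexivity]. Qed.

Lemma holo_ext F G z r : 0 < r -> (forall y, Cmod (Cminus y z) < r -> F y = G y) ->
  holo F z -> holo G z.
Proof.
  intros hr E [a [h1 h2]]; exists a; split.
  - apply (expands_ext F G z 0 a r); auto; intros y [_ hy]; auto.
  - rewrite h2; apply E; replace (Cminus z z) with (RtoC 0) by ring; by rewrite Cmod_0.
Qed.

End Holomorphic.

Lemma holo_comp {U V W : NormedModule C_AbsRing} (F : C -> Bop V W) (G : C -> Bop U V) z :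
  holo (V := Bop_NormedModule V W) F z -> holo (V := Bop_NormedModule U V) G z ->
  holo (V := Bop_NormedModule U W) (fun z => bop_comp (F z) (G z)) z.
Proof.
  intros [a [h1 h2]] [b [g1 g2]]; exists (conv a b); split; [apply (expands_comp _ _ _ 0 0); auto|].
  unfold conv; simpl; rewrite h2 g2; apply plus_zero_l.
Qed.

(** Dividing the remainder estimate by [Cmod t ^ N] gives the convergence of the Laurent series;
    [sum_n] includes its upper index, hence the truncations of length [S n]. *)
Lemma laurent_expands {H : HilbertSpace} (F : C -> Bop H H) z0 r N a : 0 < r ->
  analytic_on F (punctured z0 r) -> expands (V := Bop_NormedModule H H) F z0 N a ->
  laurent F z0 N a.
Proof.
  intros hr han [K [q [hK [hq h]]]].
  assert (hq' : 0 < / q) by (apply Rinv_0_lt_compat; lra).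
  exists (Rmin r (/ q)); split; [now apply Rmin_pos|]; split.
  { intros z [z1 z2]; apply han; split; auto; eapply Rlt_le_trans; [exact z2 | apply Rmin_l]. }
  intros z [z1 z2]; set (t := Cminus z z0) in *.
  assert (ht : t <> RtoC 0) by (intro E; rewrite E Cmod_0 in z1; lra).
  assert (hm : q * Cmod t < 1).
  { apply Rlt_le_trans with (q * / q); [|apply Req_le; field; lra].
    apply Rmult_lt_compat_l; [lra|]; eapply Rlt_le_trans; [exact z2 | apply Rmin_r]. }
  specialize (h t ht hm); replace (Cplus z0 t) with z in h by (unfold t; ring).
  unfold is_series; apply (filterlim_locally_ball_norm (U := Bop_NormedModule H H)); intro eps.
  assert (pN : 0 < Cmod t ^ N) by now apply pow_lt.
  destruct (pow_small (q * Cmod t) K (eps * Cmod t ^ N)) as [n0 hn0].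
  { split; [apply Rmult_le_pos; lra | auto]. }
  { apply Rmult_lt_0_compat; auto; apply cond_pos. }
  exists n0; intros n hn; unfold ball_norm.
  specialize (h (S n)); specialize (hn0 (S n) ltac:(lia)).
  assert (tN : Cpow t N <> RtoC 0) by now apply Cpow_nz.
  assert (E : forall n, sum_n (fun k => @scal C_Ring (Bop_ModuleSpace (U := H) (V := H)) (Cdiv (Cpow t k) (Cpow t N)) (a k)) n =
     @scal C_Ring (Bop_NormedModule H H) (Cinv (Cpow t N)) (psum (V := Bop_NormedModule H H) a t (S n))).
  { clear; induction n as [|n IH].
    - rewrite sum_O; unfold psum, Cdiv; simpl bsum; vec_in (Bop_NormedModule H H).
    - rewrite sum_Sn IH; unfold psum, Cdiv; simpl bsum; vec_in (Bop_NormedModule H H); simpl; ring. }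
  change (op_norm (minus (sum_n (fun k => @scal C_Ring (Bop_ModuleSpace (U := H) (V := H)) (Cdiv (Cpow t k) (Cpow t N)) (a k)) n) (F z)) < eps).
  rewrite E.
  rewrite (_ : minus _ _ = @scal C_Ring (Bop_NormedModule H H) (Copp (Cinv (Cpow t N)))
    (minus (@scal C_Ring (Bop_NormedModule H H) (Cpow t N) (F z)) (psum (V := Bop_NormedModule H H) a t (S n)))).
  2: { vec_in (Bop_NormedModule H H); field; auto. }
  eapply Rle_lt_trans; [apply (norm_scal_le (V := Bop_NormedModule H H))|].
  rewrite Cmod_opp Cmod_inv // Cmod_pow.
  apply Rmult_lt_reg_l with (Cmod t ^ N); auto.
  rewrite -Rmult_assoc Rinv_r; [|lra]; rewrite Rmult_1_l.
  eapply Rle_lt_trans; [exact h|]; lra.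
Qed.

Lemma fmero_finitely_meromorphic {H : HilbertSpace} (F : C -> Bop H H) z0 r : 0 < r ->
  analytic_on F (punctured z0 r) -> fmero F z0 -> finitely_meromorphic_at F z0.
Proof.
  intros hr han [N [a [h1 h2]]]; exists N, a; split.
  - now apply laurent_expands with r.
  - intros k hk; now apply has_rank_sum_finite_rank, h2.
Qed.

(** * Contour integrals *)

(** All approximants are required to have the same integral [I], so no limit of integrals has to be
    formed. Truncated Laurent series meet this requirement: only the power -1 contributes. *)
Lemma is_RInt_approx (V : NormedModule R_AbsRing) (f : R -> V) (a b : R) (I : V) : a <= b ->
  (forall d, 0 < d -> exists g, is_RInt g a b I /\
     forall t, a <= t <= b -> norm (minus (f t) (g t)) <= d) ->
  is_RInt f a b I.
Proof.
  intros hab h; apply filterlim_locally_ball_norm; intro eps.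
  set (d := eps / (2 * (b - a + 1))).
  assert (hd : 0 < d) by (apply Rdiv_lt_0_compat; [apply cond_pos | lra]).
  destruct (h d hd) as [g [hg hfg]].
  apply (filterlim_locally_ball_norm (F := Riemann_fine a b)) with (eps := pos_div_2 eps) in hg.
  assert (A : Riemann_fine a b (fun ptd => pointed_subdiv ptd /\
     SF_h ptd = Rmin a b /\ seq.last (SF_h ptd) (SF_lx ptd) = Rmax a b)).
  { exists (mkposreal 1 Rlt_0_1); auto. }
  pose proof (filter_and _ _ A hg) as B; revert B; apply filter_imp; clear A hg.
  intros ptd [[p1 [p2 p3]] hb]; unfold ball_norm in *.
  rewrite Rmin_left in p2; [|lra]; rewrite Rmax_right in p3; [|lra].
  (* Riemann sums carry the factor [sign (b - a)], which is 0 for a degenerate interval. *)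
  assert (s1 : Rabs (sign (b - a)) <= 1).
  { destruct (Rle_lt_or_eq_dec a b hab) as [L|E].
    - rewrite sign_eq_1; [rewrite Rabs_R1; lra | lra].
    - rewrite E Rminus_diag sign_0 Rabs_R0; lra. }
  set (s := sign (b - a)) in *.
  assert (N : norm (Riemann_sum (fun t => minus (f t) (g t)) ptd) <= d * (b - a)).
  { eapply Rle_trans; [apply (Riemann_sum_norm _ (fun _ => d)); auto|].
    - intros t ht; apply hfg; rewrite p3 p2 in ht; exact ht.
    - rewrite Riemann_sum_const p3 p2; apply Req_le; apply Rmult_comm. }
  rewrite Riemann_sum_minus in N.
  apply Rle_lt_trans with (norm (minus (scal s (Riemann_sum g ptd)) I) +
     norm (scal s (minus (Riemann_sum f ptd) (Riemann_sum g ptd)))).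
  - eapply Rle_trans; [|apply norm_triangle]; apply Req_le; f_equal.
    rewrite scal_minus_distr_l; unfold minus.
    rewrite (plus_comm (plus (scal s (Riemann_sum g ptd)) (opp I))) -!plus_assoc; f_equal.
    rewrite plus_assoc plus_opp_l plus_zero_l; reflexivity.
  - assert (Q : norm (scal s (minus (Riemann_sum f ptd) (Riemann_sum g ptd))) <= d * (b - a)).
    { eapply Rle_trans; [exact (norm_scal (K := R_AbsRing) (V := V) s _)|].
      change (abs s) with (Rabs s).
      eapply Rle_trans; [apply Rmult_le_compat_r; [apply norm_ge_0 | exact s1]|].
      rewrite Rmult_1_l; exact N. }
    assert (d * (b - a) < eps / 2).
    { replace (eps / 2) with (d * (b - a + 1)) by (unfold d; field; lra); nra. }
    eapply Rlt_le_trans; [apply Rplus_lt_le_compat; [exact hb | exact Q]|]; simpl; lra.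
Qed.

Lemma is_RInt_linear (U V : NormedModule R_AbsRing) (L : U -> V) (f : R -> U) (a b : R) (I : U) :
  is_linear L -> is_RInt f a b I -> is_RInt (fun t => L (f t)) a b (L I).
Proof.
  intros hL h; unfold is_RInt in *.
  apply (filterlim_ext (fun ptd => L (scal (sign (b - a)) (Riemann_sum f ptd)))).
  - intro ptd; rewrite (linear_scal _ hL); f_equal.
    induction ptd as [x|p s IH] using SF_cons_ind.
    + unfold Riemann_sum; simpl; apply (linear_zero L hL).
    + rewrite !Riemann_sum_cons (linear_plus _ hL) (linear_scal _ hL) IH //.
  - eapply filterlim_comp; [exact h | apply (linear_cont L I hL)].
Qed.

Lemma is_linear_real (U V : NormedModule C_AbsRing) (L : U -> V) :
  @is_linear C_AbsRing U V L -> @is_linear R_AbsRing (real_NormedModule U) (real_NormedModule V) L.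
Proof.
  intros [a s b]; split; [exact a | | exact b].
  intros k x; exact (s (RtoC k) x).
Qed.

Definition cis (t : R) : C := (cos t, sin t).

Lemma cis_plus s t : cis (s + t) = Cmult (cis s) (cis t).
Proof. unfold cis, Cmult; simpl; rewrite cos_plus sin_plus; f_equal; ring. Qed.

Lemma cis_0 : cis 0 = RtoC 1.
Proof. unfold cis; by rewrite cos_0 sin_0. Qed.

Lemma Cmod_cis t : Cmod (cis t) = 1.
Proof.
  unfold cis, Cmod; transitivity (sqrt 1); [simpl; f_equal | apply sqrt_1].
  pose proof (sin2_cos2 t); unfold Rsqr in *; lra.
Qed.

Lemma cis_nz t : cis t <> RtoC 0.
Proof. intro E; pose proof (Cmod_cis t) as A; rewrite E Cmod_0 in A; lra. Qed.

Lemma cis_pow t n : Cpow (cis t) n = cis (INR n * t).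
Proof.
  induction n as [|n IH]; [simpl; by rewrite Rmult_0_l cis_0|].
  rewrite Cpow_S IH -cis_plus S_INR; f_equal; ring.
Qed.

Lemma cis_div s t : Cdiv (cis s) (cis t) = cis (s - t).
Proof.
  replace s with (s - t + t) at 1 by ring; rewrite cis_plus; field; apply cis_nz.
Qed.

(** Integer exponents are written as differences of two naturals, as in the quotients of powers of a
    Laurent series. *)
Lemma cis_2PI n m : cis ((INR n - INR m) * (2 * PI)) = RtoC 1.
Proof.
  replace ((INR n - INR m) * (2 * PI)) with (INR n * (2 * PI) - INR m * (2 * PI)) by ring.
  rewrite -cis_div -!cis_pow.
  assert (E : cis (2 * PI) = RtoC 1) by (unfold cis; by rewrite cos_2PI sin_2PI).
  rewrite E !Cpow_1_l; field; intro A; apply (f_equal fst) in A; simpl in A; lra.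
Qed.

Lemma Cmod_circle z0 eps t : 0 < eps -> Cmod (Cminus (circle z0 eps t) z0) = eps.
Proof.
  intro he; unfold circle; fold (cis t).
  replace (Cminus _ z0) with (Cmult (RtoC eps) (cis t)) by ring.
  rewrite Cmod_mult Cmod_cis Cmod_R Rabs_right; lra.
Qed.

Section ContourIntegrals.

Context {V : NormedModule C_AbsRing}.
Implicit Types F G : C -> V.

(** The vector integral splits into the real integrals of the cosine and the sine, carried to [V] by
    the linear maps that multiply [x] and [Ci x] by a real number. *)
Lemma is_RInt_cis (j : R) (x : V) : j <> 0 -> cis (j * (2 * PI)) = RtoC 1 ->
  @is_RInt (real_NormedModule V) (fun t => @scal C_Ring V (cis (j * t)) x) 0 (2 * PI) zero.
Proof.
  intros hj E.
  assert (c : is_RInt (V := R_NormedModule) (fun t => cos (j * t)) 0 (2 * PI) 0).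
  { replace 0 with (@minus R_AbelianGroup (sin (j * (2 * PI)) / j) (sin (j * 0) / j)) at 2.
    - apply (is_RInt_derive (V := R_CompleteNormedModule) (fun t => sin (j * t) / j)).
      + intros t _; auto_derive; auto; field; auto.
      + intros t _; apply (ex_derive_continuous (fun t => cos (j * t))); auto_derive; auto.
    - apply (f_equal snd) in E; simpl in E; rewrite E Rmult_0_r sin_0.
      unfold minus, plus, opp; simpl; field; auto. }
  assert (s : is_RInt (V := R_NormedModule) (fun t => sin (j * t)) 0 (2 * PI) 0).
  { replace 0 with (@minus R_AbelianGroup (- cos (j * (2 * PI)) / j) (- cos (j * 0) / j)) at 2.
    - apply (is_RInt_derive (V := R_CompleteNormedModule) (fun t => - cos (j * t) / j)).
      + intros t _; auto_derive; auto; field; auto.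
      + intros t _; apply (ex_derive_continuous (fun t => sin (j * t))); auto_derive; auto.
    - apply (f_equal fst) in E; simpl in E; rewrite E Rmult_0_r cos_0.
      unfold minus, plus, opp; simpl; field; auto. }
  assert (L : forall y : V, @is_linear R_AbsRing R_NormedModule (real_NormedModule V) (fun r => rscal V r y)).
  { intro y; exact (is_linear_scal_l (K := R_AbsRing) (V := real_NormedModule V) y). }
  apply (is_RInt_linear _ (real_NormedModule V) _ _ _ _ _ (L x)) in c.
  apply (is_RInt_linear _ (real_NormedModule V) _ _ _ _ _ (L (@scal C_Ring V Ci x))) in s.
  pose proof (is_RInt_plus _ _ _ _ _ _ c s) as P.
  rewrite (_ : plus _ _ = zero) in P; [|unfold rscal; vec_in V].
  revert P; apply is_RInt_ext; intros t _.
  change (plus (@scal C_Ring V (RtoC (cos (j * t))) x)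
    (@scal C_Ring V (RtoC (sin (j * t))) (@scal C_Ring V Ci x)) = @scal C_Ring V (cis (j * t)) x).
  vec_in V; unfold cis, RtoC, Ci, Cmult, Cplus; simpl; f_equal; ring.
Qed.

Lemma contour_ext F G z0 eps I : 0 < eps ->
  (forall z, Cmod (Cminus z z0) = eps -> F z = G z) ->
  is_contour_integral F z0 eps I -> is_contour_integral G z0 eps I.
Proof.
  intros he E; apply is_RInt_ext; intros t _; rewrite E //; now apply Cmod_circle.
Qed.

Lemma contour_plus F G z0 eps I J :
  is_contour_integral F z0 eps I -> is_contour_integral G z0 eps J ->
  is_contour_integral (fun z => plus (F z) (G z)) z0 eps (plus I J).
Proof.
  intros hF hG; pose proof (is_RInt_plus _ _ _ _ _ _ hF hG) as P.
  revert P; apply is_RInt_ext; intros t _; symmetry; apply (scal_plus_r (V := V)).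
Qed.

Lemma contour_linear {W : NormedModule C_AbsRing} (L : V -> W) F z0 eps I :
  is_linear L -> is_contour_integral F z0 eps I ->
  is_contour_integral (fun z => L (F z)) z0 eps (L I).
Proof.
  intros hL h; pose proof (is_RInt_linear (real_NormedModule V) (real_NormedModule W) L _ _ _ _
    (is_linear_real _ _ L hL) h) as P.
  revert P; apply is_RInt_ext; intros t _; apply (linear_scal _ hL).
Qed.

Lemma contour_bound F z0 eps I M : 0 < eps ->
  (forall t, 0 <= t <= 2 * PI -> norm (F (circle z0 eps t)) <= M) ->
  is_contour_integral F z0 eps I -> norm I <= 2 * PI * (eps * M).
Proof.
  intros he hM hI; pose proof PI_RGT_0.
  rewrite -(Rminus_0_r (2 * PI)).
  refine (norm_RInt_le_const (V := real_NormedModule V) _ 0 (2 * PI) I (eps * M) _ _ hI); [lra|].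
  intros t ht.
  change (norm (@scal C_Ring V (Cmult Ci (Cmult (RtoC eps) (cis t))) (F (circle z0 eps t))) <= eps * M).
  rewrite norm_scal_eq !Cmod_mult Cmod_cis Cmod_R Rabs_right; [|lra].
  replace (Cmod Ci) with 1.
  - rewrite Rmult_1_l Rmult_1_r; apply Rmult_le_compat_l; [lra|]; auto.
  - unfold Cmod, Ci; transitivity (sqrt 1); [symmetry; apply sqrt_1 | simpl; f_equal; ring].
Qed.

Lemma is_linear_scal_C (c : C) : is_linear (fun x : V => @scal C_Ring V c x).
Proof. exact (is_linear_bop_scal c (bop_id V)). Qed.

Lemma contour_scal (c : C) F z0 eps I :
  is_contour_integral F z0 eps I ->
  is_contour_integral (fun z => @scal C_Ring V c (F z)) z0 eps (@scal C_Ring V c I).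
Proof. intro h; apply (contour_linear (fun x => @scal C_Ring V c x)); auto; apply is_linear_scal_C. Qed.

Lemma contour_minus F G z0 eps I J :
  is_contour_integral F z0 eps I -> is_contour_integral G z0 eps J ->
  is_contour_integral (fun z => minus (F z) (G z)) z0 eps (minus I J).
Proof.
  intros hF hG.
  rewrite (_ : minus I J = plus I (@scal C_Ring V (RtoC (-1)) J)); [|vec_in V].
  pose proof (contour_plus _ _ _ _ _ _ hF (contour_scal (RtoC (-1)) _ _ _ _ hG)) as P.
  revert P; apply is_RInt_ext; intros t _; f_equal; vec_in V.
Qed.

(** The difference of the two values is an integral of the zero function, which the length estimate
    with bound 0 forces to vanish. *)
Lemma contour_unique F z0 eps I J : 0 < eps ->
  is_contour_integral F z0 eps I -> is_contour_integral F z0 eps J -> I = J.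
Proof.
  intros he hI hJ; pose proof (contour_minus _ _ _ _ _ _ hI hJ) as P.
  apply (contour_bound _ _ _ _ 0 he) in P.
  - apply (minus_zero_eq (V := V)), norm0_eq; pose proof (norm_ge_0 (minus I J)); lra.
  - intros z _; rewrite (_ : minus _ _ = zero); [rewrite norm_z; lra | vec_in V].
Qed.

Lemma contour_approx F z0 eps I : 0 < eps ->
  (forall d, 0 < d -> exists G, is_contour_integral G z0 eps I /\
     forall z, Cmod (Cminus z z0) = eps -> norm (minus (F z) (G z)) <= d) ->
  is_contour_integral F z0 eps I.
Proof.
  intros he h; pose proof PI_RGT_0; apply is_RInt_approx; [lra|]; intros d hd.
  destruct (h (d / eps)) as [G [hG hFG]]; [apply Rdiv_lt_0_compat; auto|].
  eexists; split; [exact hG|]; intros t _.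
  set (c := Cmult Ci (Cmult (RtoC eps) (cis t))).
  change (norm (@minus (NormedModule.AbelianGroup C_AbsRing V)
    (@scal C_Ring V c (F (circle z0 eps t))) (@scal C_Ring V c (G (circle z0 eps t)))) <= d).
  rewrite (_ : minus _ _ = @scal C_Ring V c (minus (F (circle z0 eps t)) (G (circle z0 eps t)))); [|vec_in V].
  assert (hc : Cmod c = eps).
  { unfold c; rewrite !Cmod_mult Cmod_cis Cmod_R Rabs_right; [|lra].
    replace (Cmod Ci) with 1; [ring|].
    unfold Cmod, Ci; transitivity (sqrt 1); [symmetry; apply sqrt_1 | simpl; f_equal; ring]. }
  rewrite norm_scal_eq hc.
  replace d with (eps * (d / eps)) by (field; lra).
  apply Rmult_le_compat_l; [lra|]; apply hFG.
  now apply Cmod_circle.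
Qed.

Lemma contour_zero z0 eps : is_contour_integral (fun _ => zero : V) z0 eps zero.
Proof.
  pose proof (is_RInt_const (V := real_NormedModule V) 0 (2 * PI) zero) as P.
  rewrite (scal_zero_r (V := real_NormedModule V)) in P.
  revert P; apply is_RInt_ext; intros t _; symmetry; apply (scal_z (V := V)).
Qed.

(** [S k = M] is the exponent -1: the velocity of the circle contributes one more power, and the
    integrand is constant. Otherwise it is an exponential of nonzero integer frequency. *)
Lemma contour_monomial (x : V) z0 eps k M : 0 < eps ->
  is_contour_integral
    (fun z => @scal C_Ring V (Cdiv (Cpow (Cminus z z0) k) (Cpow (Cminus z z0) M)) x) z0 eps
    (if Nat.eqb (S k) M then @scal C_Ring V two_pi_i x else zero).
Proof.
  intro he.
  assert (re : RtoC eps <> RtoC 0) by (intro E; apply (f_equal fst) in E; simpl in E; lra).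
  set (c := Cmult Ci (Cdiv (Cpow (RtoC eps) (S k)) (Cpow (RtoC eps) M))).
  assert (E : forall t, Cmult (Cmult Ci (Cmult (RtoC eps) (cis t)))
     (Cdiv (Cpow (Cminus (circle z0 eps t) z0) k) (Cpow (Cminus (circle z0 eps t) z0) M)) =
     Cmult c (cis ((INR (S k) - INR M) * t))).
  { intro t; replace (Cminus (circle z0 eps t) z0) with (Cmult (RtoC eps) (cis t))
      by (unfold circle; fold (cis t); ring).
    rewrite !Cpow_mult_l.
    replace ((INR (S k) - INR M) * t) with (INR (S k) * t - INR M * t) by ring.
    rewrite -cis_div -!cis_pow; unfold c; rewrite !Cpow_S.
    field; split; apply Cpow_nz; auto; apply cis_nz. }
  destruct (Nat.eqb_spec (S k) M) as [<-|N].
  - pose proof (is_RInt_const (V := real_NormedModule V) 0 (2 * PI) (@scal C_Ring V Ci x)) as P.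
    rewrite (_ : @scal C_Ring V two_pi_i x = @scal R_Ring (real_NormedModule V) (2 * PI - 0) (@scal C_Ring V Ci x)).
    + revert P; apply is_RInt_ext; intros t _; fold (cis t).
      rewrite (scal_scal (V := V)) E Rminus_diag Rmult_0_l cis_0; f_equal.
      unfold c; field; apply Cpow_nz; auto.
    + change (@scal C_Ring V two_pi_i x = @scal C_Ring V (RtoC (2 * PI - 0)) (@scal C_Ring V Ci x)).
      rewrite Rminus_0_r (scal_scal (V := V)) //.
  - assert (hj : INR (S k) - INR M <> 0).
    { intro A; apply N, INR_eq; lra. }
    pose proof (is_RInt_cis _ (@scal C_Ring V c x) hj (cis_2PI (S k) M)) as P.
    revert P; apply is_RInt_ext; intros t _; fold (cis t).
    rewrite !(scal_scal (V := V)) E; f_equal; ring.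
Qed.

Lemma contour_bsum (f : nat -> C -> V) (I : nat -> V) z0 eps n :
  (forall i, (i < n)%nat -> is_contour_integral (f i) z0 eps (I i)) ->
  is_contour_integral (fun z => bsum (fun i => f i z) n) z0 eps (bsum I n).
Proof.
  induction n as [|n IH]; intro h; simpl; [apply contour_zero|].
  apply contour_plus; auto.
Qed.

Lemma bsum_single (x : V) (f : nat -> V) n j : (j < n)%nat -> f j = x ->
  (forall i, i <> j -> f i = zero) -> bsum f n = x.
Proof.
  intros hj hx h; induction n as [|n IH]; [lia|]; simpl.
  destruct (Nat.eq_dec n j) as [->|N].
  - rewrite bsum_zero; [rewrite hx; apply plus_zero_l | intros; apply h; lia].
  - rewrite IH; [rewrite h; auto; apply plus_zero_r | lia].
Qed.

(** Every truncation of length above [N] has the integral of its single term of exponent -1, and the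
    truncations converge uniformly on the circle. *)
Lemma contour_expands F z0 N a : expands F z0 (S N) a ->
  exists r, 0 < r /\ forall eps, 0 < eps < r ->
    is_contour_integral F z0 eps (@scal C_Ring V two_pi_i (a N)).
Proof.
  intros [K [q [hK [hq h]]]].
  assert (hq' : 0 < / q) by (apply Rinv_0_lt_compat; lra).
  exists (/ q); split; auto; intros eps [he1 he2].
  assert (hm : q * eps < 1).
  { apply Rmult_lt_compat_l with (r := q) in he2; [|lra]; rewrite Rinv_r in he2; lra. }
  apply contour_approx; auto; intros d hd.
  assert (pe : 0 < eps ^ S N) by (apply pow_lt; auto).
  destruct (pow_small (q * eps) K (d * eps ^ S N)) as [n0 hn0].
  { split; auto; apply Rmult_le_pos; lra. }
  { now apply Rmult_lt_0_compat. }
  set (n := max n0 (S N)); specialize (hn0 n ltac:(lia)).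
  exists (fun z => bsum (fun k => @scal C_Ring V (Cdiv (Cpow (Cminus z z0) k) (Cpow (Cminus z z0) (S N))) (a k)) n).
  split.
  - rewrite -(bsum_single (@scal C_Ring V two_pi_i (a N))
      (fun k => if Nat.eqb (S k) (S N) then @scal C_Ring V two_pi_i (a k) else zero) n N); [|lia| |].
    + apply contour_bsum; intros i hi; now apply contour_monomial.
    + by rewrite Nat.eqb_refl.
    + intros i hi; destruct (Nat.eqb_spec (S i) (S N)); auto; lia.
  - intros z hz; set (t := Cminus z z0) in *.
    assert (ht : t <> RtoC 0) by (intro E; rewrite E Cmod_0 in hz; lra).
    assert (tN : Cpow t (S N) <> RtoC 0) by now apply Cpow_nz.
    specialize (h t ht ltac:(rewrite hz; lra) n).
    replace (Cplus z0 t) with z in h by (unfold t; ring).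
    rewrite (bsum_ext _ (fun k => @scal C_Ring V (Cinv (Cpow t (S N))) (@scal C_Ring V (Cpow t k) (a k)))).
    + rewrite bsum_scal; fold (psum a t n).
      rewrite (_ : minus _ _ = @scal C_Ring V (Cinv (Cpow t (S N)))
        (minus (@scal C_Ring V (Cpow t (S N)) (F z)) (psum a t n))); [|vec_in V; field; auto].
      rewrite norm_scal_eq Cmod_inv // Cmod_pow hz; rewrite hz in h.
      apply Rmult_le_reg_l with (eps ^ S N); auto.
      rewrite -Rmult_assoc Rinv_r; [|lra]; rewrite Rmult_1_l.
      eapply Rle_trans; [exact h|]; lra.
    + intros i _; rewrite scal_scal; f_equal; unfold Cdiv; ring.
Qed.

(** The kernel [1/(zeta - z)] of Cauchy's formula, by its expansion in powers of
    [(z - z0) / (zeta - z0)]. *)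
Lemma contour_cauchy_kernel (x : V) z0 z eps : Cmod (Cminus z z0) < eps ->
  is_contour_integral (fun y => @scal C_Ring V (Cinv (Cminus y z)) x) z0 eps
    (@scal C_Ring V two_pi_i x).
Proof.
  intro hz; set (s := Cminus z z0) in *; pose proof (Cmod_ge_0 s) as s0.
  assert (he : 0 < eps) by lra.
  apply contour_approx; auto; intros d hd.
  assert (q0 : 0 <= Cmod s / eps < 1).
  { split.
    - apply Rmult_le_pos; auto; apply Rlt_le, Rinv_0_lt_compat; auto.
    - apply Rmult_lt_reg_r with eps; auto; unfold Rdiv; rewrite Rmult_assoc Rinv_l; lra. }
  destruct (pow_small _ (norm x / (eps - Cmod s)) d q0 hd) as [n0 hn0].
  set (n := S n0); specialize (hn0 n ltac:(lia)).
  exists (fun y => bsum (fun k => @scal C_Ring V (Cpow s k)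
    (@scal C_Ring V (Cdiv (Cpow (Cminus y z0) 0) (Cpow (Cminus y z0) (S k))) x)) n).
  split.
  - rewrite -(bsum_single (@scal C_Ring V two_pi_i x)
      (fun k => @scal C_Ring V (Cpow s k)
         (if Nat.eqb 1 (S k) then @scal C_Ring V two_pi_i x else zero)) n 0); [|lia| |].
    + apply contour_bsum; intros i hi; apply contour_scal; now apply contour_monomial.
    + simpl; vec_in V.
    + intros i hi; destruct (Nat.eqb_spec 1 (S i)); [lia | apply scal_z].
  - intros y hy; set (t := Cminus y z0) in *.
    assert (ht : t <> RtoC 0) by (intro E; rewrite E Cmod_0 in hy; lra).
    replace (Cminus y z) with (Cminus t s) by (unfold t, s; ring).
    assert (lo : eps - Cmod s <= Cmod (Cminus t s)).
    { pose proof (Cmod_triangle (Cminus t s) s) as T.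
      replace (Cplus (Cminus t s) s) with t in T by ring; lra. }
    assert (hts : Cminus t s <> RtoC 0) by (intro E; rewrite E Cmod_0 in lo; lra).
    assert (Q : forall m, minus (@scal C_Ring V (Cinv (Cminus t s)) x)
      (bsum (fun k => @scal C_Ring V (Cpow s k)
         (@scal C_Ring V (Cdiv (Cpow t 0) (Cpow t (S k))) x)) m) =
      @scal C_Ring V (Cdiv (Cpow s m) (Cmult (Cpow t m) (Cminus t s))) x).
    { induction m as [|m IH]; cbn [bsum].
      - vec_in V; simpl; field; auto.
      - rewrite (_ : minus _ _ = minus (minus (@scal C_Ring V (Cinv (Cminus t s)) x)
          (bsum (fun k => @scal C_Ring V (Cpow s k)
            (@scal C_Ring V (Cdiv (Cpow t 0) (Cpow t (S k))) x)) m))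
          (@scal C_Ring V (Cpow s m) (@scal C_Ring V (Cdiv (Cpow t 0) (Cpow t (S m))) x))); [|vec_in V].
        rewrite IH; vec_in V; simpl; field; repeat split; auto; apply Cpow_nz; auto. }
    rewrite Q norm_scal_eq Cmod_div.
    2: { apply Cmult_neq_0; auto; now apply Cpow_nz. }
    rewrite Cmod_mult !Cmod_pow hy.
    pose proof (pow_lt eps n he); pose proof (pow_le (Cmod s) n s0); pose proof (norm_ge_0 x).
    apply Rle_trans with (norm x / (eps - Cmod s) * (Cmod s / eps) ^ n); [|lra].
    unfold Rdiv at 3; rewrite Rpow_mult_distr pow_inv.
    replace (norm x / (eps - Cmod s) * (Cmod s ^ n * / eps ^ n)) with
      ((Cmod s ^ n * / eps ^ n) * / (eps - Cmod s) * norm x) by (field; lra).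
    replace (Cmod s ^ n / (eps ^ n * Cmod (Cminus t s))) with
      ((Cmod s ^ n * / eps ^ n) * / Cmod (Cminus t s)) by (field; lra).
    apply Rmult_le_compat_r; auto; apply Rmult_le_compat_l.
    + apply Rmult_le_pos; auto; apply Rlt_le, Rinv_0_lt_compat; auto.
    + apply Rinv_le_contravar; lra.
Qed.

End ContourIntegrals.

Lemma two_pi_i_nz : two_pi_i <> RtoC 0.
Proof.
  unfold two_pi_i, Ci, RtoC, Cmult; simpl; intro E; apply (f_equal snd) in E; simpl in E.
  pose proof PI_RGT_0; lra.
Qed.

Lemma rtrace_residue {H : HilbertSpace} (F : C -> Bop H H) z0 t : rtrace F z0 t ->
  exists r, 0 < r /\ forall eps, 0 < eps < r -> is_residue_trace F z0 eps t.
Proof.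
  intros [N [a [h1 h2]]].
  destruct (contour_expands (V := Bop_NormedModule H H) F z0 N a h1) as [r [hr hc]].
  exists r; split; auto; intros eps he.
  eexists; split; [apply (hc eps he)|].
  rewrite (scal_scal (V := Bop_NormedModule H H)) Cinv_l; [|apply two_pi_i_nz].
  rewrite (scal_C1 (V := Bop_NormedModule H H)); now apply ftrace_is_trace.
Qed.

(** * Resolvents *)

Section Inverses.

Context {H : HilbertSpace}.
Implicit Types T : op H H.

Lemma op_invP T : boundedly_invertible T -> is_inverse T (op_inv T).
Proof. intro h; unfold op_inv; now apply epsilon_spec. Qed.

Lemma op_inv_unique T (R : Bop H H) : is_inverse T R -> op_inv T = R.
Proof.
  intro h; destruct (op_invP T) as [h1 _]; [now exists R|].
  apply bop_ext; intro g; destruct (proj2 h g) as [d e].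
  by rewrite -{1}e h1.
Qed.

Lemma resolvent_l T z f : resolvent_set T z -> dom T f ->
  resolvent T z (minus (T f) (@scal C_Ring H z f)) = f.
Proof. intros h d; exact (proj1 (op_invP _ h) f d). Qed.

Lemma resolvent_dom T z g : resolvent_set T z -> dom T (resolvent T z g).
Proof. intro h; exact (proj1 (proj2 (op_invP _ h) g)). Qed.

Lemma resolvent_r T z g : resolvent_set T z ->
  T (resolvent T z g) = plus g (@scal C_Ring H z (resolvent T z g)).
Proof.
  intro h; pose proof (proj2 (proj2 (op_invP _ h) g)) as E; simpl in E; fold (resolvent T z) in E.
  rewrite -{2}E; vec_in H.
Qed.

Lemma resolvent_identity T z w : resolvent_set T z -> resolvent_set T w ->
  resolvent T z = bop_plus (resolvent T w)
    (bop_scal (Cminus z w) (bop_comp (resolvent T w) (resolvent T z))).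
Proof.
  intros hz hw; apply bop_ext; intro x; simpl.
  set (g := resolvent T z x).
  pose proof (resolvent_l T w g hw (resolvent_dom T z x hz)) as E.
  unfold g in E; rewrite resolvent_r // in E; fold g in E.
  rewrite (_ : minus _ _ = plus x (@scal C_Ring H (Cminus z w) g)) in E; [|vec_in H].
  rewrite bopD bopZ in E; by rewrite -{1}E.
Qed.

(** Adding the resolvent identities for [(z, w)] and [(w, z)] leaves [z - w] times the
    commutator. *)
Lemma resolvent_comm T z w x : resolvent_set T z -> resolvent_set T w ->
  resolvent T z (resolvent T w x) = resolvent T w (resolvent T z x).
Proof.
  intros hz hw; destruct (classic (z = w)) as [->|N]; auto.
  pose proof (f_equal (fun S : Bop H H => S x) (resolvent_identity T z w hz hw)) as E1.
  pose proof (f_equal (fun S : Bop H H => S x) (resolvent_identity T w z hw hz)) as E2.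
  simpl in E1, E2.
  assert (D : Cminus z w <> RtoC 0).
  { intro E; apply N; transitivity (Cplus (Cminus z w) w); [ring | rewrite E; ring]. }
  set (a := resolvent T z x) in *; set (b := resolvent T w x) in *.
  assert (E : @scal C_Ring H (Cminus z w) (minus (resolvent T z b) (resolvent T w a)) = zero).
  { transitivity (plus (minus a (plus b (@scal C_Ring H (Cminus z w) (resolvent T w a))))
      (minus b (plus a (@scal C_Ring H (Cminus w z) (resolvent T z b))))); [vec_in H|].
    rewrite -E1 -E2; vec_in H. }
  apply (minus_zero_eq (V := H)).
  rewrite (_ : minus _ _ = @scal C_Ring H (Cinv (Cminus z w))
    (@scal C_Ring H (Cminus z w) (minus (resolvent T z b) (resolvent T w a)))); [|vec_in H; field; auto].
  rewrite E; vec_in H.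
Qed.

Fixpoint bop_pow (Y : Bop H H) (n : nat) : Bop H H :=
  match n with O => bop_id H | S m => bop_comp Y (bop_pow Y m) end.

Lemma bop_pow_comm (Y : Bop H H) n x : bop_pow Y n (Y x) = Y (bop_pow Y n x).
Proof. induction n as [|n IH]; simpl; [reflexivity | by rewrite IH]. Qed.

Lemma op_norm_pow (Y : Bop H H) n : op_norm (bop_pow Y n) <= op_norm Y ^ n.
Proof.
  induction n as [|n IH]; simpl.
  - apply op_norm_le; split; [lra|]; intro x; simpl; rewrite Rmult_1_l; apply Rle_refl.
  - eapply Rle_trans; [apply op_norm_comp|]; apply Rmult_le_compat_l; auto; apply op_norm_ge_0.
Qed.

Lemma op_norm_bop_scal (c : C) (Y : Bop H H) : op_norm (bop_scal c Y) = Cmod c * op_norm Y.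
Proof. apply (norm_scal_eq (V := Bop_NormedModule H H)). Qed.

(** Iterating the identity gives the powers of [A0] with the exact remainder [t^n A0^n A(z)]. The
    family need not be the resolvent of an operator and [A0] need not be its value at [z0], so the
    regular part at an isolated singularity is covered too. *)
Lemma pseudo_resolvent_expands (A : C -> Bop H H) z0 (A0 : Bop H H) r : 0 < r ->
  (forall z, punctured z0 r z ->
    A z = bop_plus A0 (bop_scal (Cminus z z0) (bop_comp A0 (A z)))) ->
  expands (V := Bop_NormedModule H H) A z0 0 (fun k => bop_pow A0 (S k)).
Proof.
  intros hr h; set (c := op_norm A0); pose proof (op_norm_ge_0 A0) as c0; fold c in c0.
  assert (r0 : 0 < / r) by (apply Rinv_0_lt_compat; auto).
  (* The summand [2 * c] ensures [c * Cmod t <= 1 / 2], whence the bound [2 * c] for the family;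
     [/ r] keeps [t] in the disc and 1 makes the rate admissible. *)
  exists (2 * c), (1 + 2 * c + / r); split; [lra|]; split; [lra|]; intros t ht hm n.
  pose proof (Cmod_gt_0 t) as [pt _]; specialize (pt ht).
  assert (tr : Cmod t < r).
  { apply Rmult_lt_reg_l with (/ r); auto; rewrite Rinv_l; [|lra].
    assert (0 <= (1 + 2 * c) * Cmod t) by (apply Rmult_le_pos; lra); lra. }
  assert (tc : 2 * c * Cmod t <= 1).
  { assert (0 <= (1 + / r) * Cmod t) by (apply Rmult_le_pos; lra); lra. }
  specialize (h (Cplus z0 t)).
  replace (Cminus (Cplus z0 t) z0) with t in h by ring.
  specialize (h ltac:(unfold punctured; replace (Cminus (Cplus z0 t) z0) with t by ring; lra)).
  set (X := A (Cplus z0 t)) in *.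
  assert (E : forall m, minus (@scal C_Ring (Bop_NormedModule H H) (Cpow t 0) X)
     (psum (V := Bop_NormedModule H H) (fun k => bop_pow A0 (S k)) t m) =
     bop_scal (Cpow t m) (bop_comp (bop_pow A0 m) X)).
  { induction m as [|m IH].
    - unfold psum; simpl; apply bop_ext; intro x; simpl; vec_in H.
    - transitivity (minus (minus (@scal C_Ring (Bop_NormedModule H H) (Cpow t 0) X)
       (psum (V := Bop_NormedModule H H) (fun k => bop_pow A0 (S k)) t m))
       (@scal C_Ring (Bop_NormedModule H H) (Cpow t m) (bop_pow A0 (S m)))).
      + unfold psum; cbn [bsum]; vec_in (Bop_NormedModule H H).
      + rewrite IH; apply bop_ext; intro x.
        pose proof (f_equal (fun S : Bop H H => S x) h) as hx; simpl in hx.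
        simpl; rewrite {1}hx bopD bopZ -!bop_pow_comm; vec_in H. }
  assert (nX : op_norm X <= 2 * c).
  { assert (op_norm X <= c + Cmod t * (c * op_norm X)).
    { rewrite {1}h; eapply Rle_trans; [apply op_norm_triangle|]; apply Rplus_le_compat_l.
      rewrite op_norm_bop_scal; apply Rmult_le_compat_l; [lra|]; apply op_norm_comp. }
    pose proof (op_norm_ge_0 X).
    assert (2 * c * Cmod t * op_norm X <= 1 * op_norm X) by (apply Rmult_le_compat_r; auto).
    lra. }
  change (op_norm (minus (@scal C_Ring (Bop_NormedModule H H) (Cpow t 0) X)
     (psum (V := Bop_NormedModule H H) (fun k => bop_pow A0 (S k)) t n)) <=
     2 * c * ((1 + 2 * c + / r) * Cmod t) ^ n).
  rewrite E op_norm_bop_scal Cmod_pow Rpow_mult_distr.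
  pose proof (op_norm_comp (bop_pow A0 n) X) as B1.
  pose proof (op_norm_pow A0 n) as B2; fold c in B2.
  assert (B3 : c ^ n <= (1 + 2 * c + / r) ^ n) by (apply pow_incr; lra).
  pose proof (pow_le (Cmod t) n ltac:(lra)) as tn.
  replace (2 * c * ((1 + 2 * c + / r) ^ n * Cmod t ^ n)) with
    (Cmod t ^ n * ((1 + 2 * c + / r) ^ n * (2 * c))) by ring.
  apply Rmult_le_compat_l; auto; eapply Rle_trans; [exact B1|].
  apply Rmult_le_compat; try apply op_norm_ge_0; auto; lra.
Qed.

End Inverses.

Lemma is_linear_comp_l {U V W : NormedModule C_AbsRing} (S : Bop V W) :
  @is_linear C_AbsRing (Bop_NormedModule U V) (Bop_NormedModule U W) (fun X => bop_comp S X).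
Proof.
  split.
  - intros X Y; apply bop_ext; intro x; simpl; apply bopD.
  - intros k X; apply bop_ext; intro x; simpl; apply bopZ.
  - exists (op_norm S + 1); pose proof (op_norm_ge_0 S); split; [lra|]; intro X.
    change (op_norm (bop_comp S X) <= (op_norm S + 1) * op_norm X).
    pose proof (op_norm_comp S X); pose proof (op_norm_ge_0 X); lra.
Qed.

Lemma is_linear_comp_r {U V W : NormedModule C_AbsRing} (S : Bop U V) :
  @is_linear C_AbsRing (Bop_NormedModule V W) (Bop_NormedModule U W) (fun X => bop_comp X S).
Proof.
  split.
  - intros X Y; now apply bop_ext.
  - intros k X; now apply bop_ext.
  - exists (op_norm S + 1); pose proof (op_norm_ge_0 S); split; [lra|]; intro X.
    change (op_norm (bop_comp X S) <= (op_norm S + 1) * op_norm X).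
    pose proof (op_norm_comp X S); pose proof (op_norm_ge_0 X); lra.
Qed.

Section ResolventSet.

Context {H : HilbertSpace} (T : op H H) (hT : linear_op T).

Lemma op_minus_lin f g : dom T f -> dom T g ->
  dom T (minus f g) /\ T (minus f g) = minus (T f) (T g).
Proof.
  intros df dg; destruct hT as [_ [hp hs]].
  rewrite (_ : minus f g = plus f (@scal C_Ring H (RtoC (-1)) g)); [|vec_in H].
  destruct (hs (RtoC (-1)) g dg) as [d1 e1]; destruct (hp f _ df d1) as [d2 e2].
  split; auto; rewrite e2 e1; vec_in H.
Qed.

(** [T - z] is [1 - (z - z0) R] composed with [T - z0], and the first factor is inverted by a
    Neumann series for small [z - z0]. *)
Lemma resolvent_open z0 : resolvent_set T z0 ->
  exists r, 0 < r /\ forall z, Cmod (Cminus z z0) < r -> resolvent_set T z.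
Proof.
  intro h; set (R := resolvent T z0).
  pose proof (op_norm_ge_0 R) as r0.
  exists (/ (2 * (op_norm R + 1))); split; [apply Rinv_0_lt_compat; lra|]; intros z hz.
  set (t := Cminus z z0) in *.
  destruct (neumann_inverse H (bop_scal t R)) as [N [n1 n2]].
  { rewrite op_norm_bop_scal; pose proof (Cmod_ge_0 t).
    apply Rmult_lt_compat_r with (r := op_norm R + 1) in hz; [|lra].
    replace (/ (2 * (op_norm R + 1)) * (op_norm R + 1)) with (/ 2) in hz by (field; lra).
    nra. }
  simpl in n1, n2; exists (bop_comp R N); split; simpl.
  - intros f df.
    pose proof (resolvent_l T z0 f h df) as E; fold R in E.
    set (u := minus (T f) (@scal C_Ring H z0 f)) in *.
    rewrite (_ : minus (T f) _ = minus u (@scal C_Ring H t (R u))); [by rewrite n1|].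
    rewrite E; unfold u, t; vec_in H.
  - intro g; pose proof (resolvent_dom T z0 (N g) h) as d; fold R in d; split; auto.
    pose proof (resolvent_r T z0 (N g) h) as E; fold R in E.
    transitivity (minus (N g) (@scal C_Ring H t (R (N g)))); [|exact (n2 g)].
    rewrite E; unfold t; vec_in H.
Qed.

Lemma resolvent_expands z0 : resolvent_set T z0 ->
  expands (V := Bop_NormedModule H H) (resolvent T) z0 0 (fun k => bop_pow (resolvent T z0) (S k)).
Proof.
  intro h; destruct (resolvent_open z0 h) as [r [hr hz]].
  apply (pseudo_resolvent_expands _ _ _ r hr); intros z [_ z2].
  apply resolvent_identity; auto.
Qed.

Lemma resolvent_holo z0 : resolvent_set T z0 -> holo (V := Bop_NormedModule H H) (resolvent T) z0.
Proof.
  intro h; eexists; split; [apply (resolvent_expands z0 h)|]; now apply bop_ext.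
Qed.

End ResolventSet.

(** * Isolated singularities of resolvents *)

Section AllFiniteRank.

Context {H : HilbertSpace}.
Implicit Types F G : C -> Bop H H.

(** All coefficients have finite rank, also those of nonnegative index: division by [z - z0], which
    the recursion for the principal part uses, moves them into the principal part. *)
Definition finite_rank_expansion F (z0 : C) : Prop :=
  exists N a, expands (V := Bop_NormedModule H H) F z0 N a /\ forall k, has_rank_sum (a k).

Lemma finite_rank_expansion_fmero F z0 : finite_rank_expansion F z0 -> fmero F z0.
Proof. intros [N [a [h1 h2]]]; exists N, a; auto. Qed.

Lemma finite_rank_expansion_plus F G z0 :
  finite_rank_expansion F z0 -> finite_rank_expansion G z0 ->
  finite_rank_expansion (fun z => bop_plus (F z) (G z)) z0.
Proof.
  intros [N [a [h1 h2]]] [M [b [g1 g2]]].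
  apply (expands_shift M) in h1; apply (expands_shift N) in g1.
  replace (N + M)%nat with (M + N)%nat in g1 by lia.
  exists (M + N)%nat; eexists; split; [apply (expands_plus _ _ _ _ _ _ h1 g1)|].
  intro k; apply has_rank_sum_plus; simpl.
  - destruct (Nat.ltb k M); [apply has_rank_sum_zero | apply h2].
  - destruct (Nat.ltb k N); [apply has_rank_sum_zero | apply g2].
Qed.

Lemma finite_rank_expansion_const (T : Bop H H) z0 : has_rank_sum T ->
  finite_rank_expansion (fun _ => T) z0.
Proof.
  intro hT; exists 0%nat; eexists; split; [apply (expands_const (V := Bop_NormedModule H H))|].
  intros [|k]; simpl; [exact hT | apply has_rank_sum_zero].
Qed.

Lemma finite_rank_expansion_affine w F z0 : finite_rank_expansion F z0 ->
  finite_rank_expansion (fun z => bop_scal (Cminus z w) (F z)) z0.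
Proof.
  intros [N [a [h1 h2]]].
  pose proof (expands_comp _ _ _ _ _ _ _ (expands_affine (V := Bop_NormedModule H H) w (bop_id H) z0) h1) as E.
  eexists; eexists; split.
  - apply (expands_ext (V := Bop_NormedModule H H) _ _ z0 _ _ 1 ltac:(lra)) with (2 := E).
    intros; now apply bop_ext.
  - intro k; apply has_rank_sum_bsum; intros; apply has_rank_sum_comp_r, h2.
Qed.

Lemma finite_rank_expansion_div F z0 : finite_rank_expansion F z0 ->
  finite_rank_expansion (fun z => bop_scal (Cinv (Cminus z z0)) (F z)) z0.
Proof.
  intros [N [a [[K [q [hK [hq h]]]] h2]]]; exists (S N), a; split; auto.
  exists K, q; repeat split; auto; intros t ht hm n.
  eapply Rle_trans; [|apply (h t ht hm n)]; apply Req_le; f_equal; f_equal.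
  apply bop_ext; intro x; simpl.
  replace (Cminus (Cplus z0 t) z0) with t by ring.
  vec_in H; field; auto.
Qed.

End AllFiniteRank.

Lemma rank_sum_through_range {U V W : HilbertSpace} (S : Bop U V) (l : list (W * V)) :
  (forall p, In p l -> ran S (snd p)) -> exists Z : Bop W U, forall x, S (Z x) = rank_sum l x.
Proof.
  induction l as [|[a b] l IH]; intro h.
  - exists bop_zero; intro x; apply (bop0 S).
  - destruct IH as [Z hZ]; [intros; apply h; simpl; auto|].
    destruct (h (a, b)) as [d hd]; [now left|]; simpl in hd.
    destruct (mk_linear_bop W U (fun x => @scal C_Ring U (inner x a) d) (norm a * norm d)) as [D hD].
    + intros x y; rewrite inner_plus_l; vec_in U.
    + intros k x; rewrite inner_scal_l; vec_in U.
    + intro x; rewrite (norm_scal_eq (V := U)).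
      replace (norm a * norm d * norm x) with (norm x * norm a * norm d) by ring.
      apply Rmult_le_compat_r; [apply norm_ge_0 | apply cauchy_schwarz].
    + exists (bop_plus D Z); intro x; simpl; by rewrite bopD hD bopZ hd hZ.
Qed.

(** [m] minimises the rank among the powers of [Y]. *)
Lemma finite_rank_power_factor {H : HilbertSpace} (Y : Bop H H) : has_rank_sum Y ->
  exists m (Z : Bop H H), forall x, bop_pow Y (S m) x = bop_pow Y (S (S m)) (Z x).
Proof.
  intro hY.
  assert (hp : forall m, has_rank_sum (bop_pow Y (S m))).
  { intro m; now apply has_rank_sum_comp_l. }
  destruct (nat_minimum (fun n => exists m l, length l = n /\ minimal_rank_sum (bop_pow Y (S m)) l))
    as [n [[m [l [hn hl]]] hmin]].
  { destruct (minimal_rank_sum_exists _ (hp 0%nat)) as [l hl]; now exists (length l), 0%nat, l. }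
  set (g := fun p : H * H => (bop_adj Y (fst p), snd p)).
  (* Precomposing with [Y] keeps the length, and no later power has smaller rank; the new list is
     therefore again shortest, and its unchanged second components lie in the range of the next
     power. *)
  assert (hl' : minimal_rank_sum (bop_pow Y (S (S m))) (map g l)).
  { split.
    - intro x; unfold g; rewrite rank_sum_map_left -(proj1 hl); symmetry; apply bop_pow_comm.
    - intros l' h'; rewrite length_map hn.
      destruct (minimal_rank_sum_exists _ (hp (S m))) as [l2 h2].
      apply Nat.le_trans with (length l2); [|now apply h2].
      apply hmin; now exists (S m), l2. }
  destruct (rank_sum_through_range (bop_pow Y (S (S m))) l) as [Z hZ].
  { intros p hp'; apply (in_map g) in hp'; apply in_split in hp' as [l1 [l2 E]].
    unfold g at 2 in E; rewrite E in hl'.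
    destruct (minimal_rank_sum_dual _ _ _ _ _ hl') as [d [_ [_ hd]]]; now exists d. }
  exists m, Z; intro x; by rewrite hZ -(proj1 hl).
Qed.

(** * The Riesz projection, the regular part and the principal part at an isolated singularity *)

Section IsolatedSingularity.

Context {H : HilbertSpace} (F : C -> Bop H H) (z0 : C) (r : R) (hr : 0 < r).
Context (Fid : forall z w, punctured z0 r z -> punctured z0 r w ->
  F z = bop_plus (F w) (bop_scal (Cminus z w) (bop_comp (F w) (F z)))).
Context (Fcomm : forall z w x, punctured z0 r z -> punctured z0 r w -> F z (F w x) = F w (F z x)).
Context (Fholo : forall z, punctured z0 r z -> holo (V := Bop_NormedModule H H) F z).
Context (P : Bop H H).
Context (hP : forall eps, 0 < eps < r ->
  is_contour_integral (V := Bop_NormedModule H H) F z0 eps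
    (@scal C_Ring Bop_ModuleSpace (Copp two_pi_i) P)).

Lemma punctured_circle eps t : 0 < eps < r -> punctured z0 r (circle z0 eps t).
Proof. intros [e1 e2]; split; rewrite Cmod_circle; lra. Qed.

Lemma two_pi_i_scal_inj (X Y : Bop H H) :
  bop_scal (Copp two_pi_i) X = bop_scal (Copp two_pi_i) Y -> X = Y.
Proof.
  intro E; pose proof two_pi_i_nz as N.
  transitivity (bop_scal (Cinv (Copp two_pi_i)) (bop_scal (Copp two_pi_i) X)); [|rewrite E];
    apply bop_ext; intro x; simpl; vec_in H; field; auto.
Qed.

(** Multiplication by [F z] on either side passes under the integral that defines [P], and the two
    integrands agree. *)
Lemma riesz_comm z x : punctured z0 r z -> F z (P x) = P (F z x).
Proof.
  intro hz; assert (he : 0 < r / 2 < r) by lra.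
  pose proof (contour_linear _ _ _ _ _ (is_linear_comp_l (F z)) (hP _ he)) as I1.
  pose proof (contour_linear _ _ _ _ _ (is_linear_comp_r (F z)) (hP _ he)) as I2.
  apply (contour_ext _ (fun y => bop_comp (F z) (F y))) in I2; [|lra|].
  2: { intros y hy; apply bop_ext; intro v; simpl; apply Fcomm; auto; split; lra. }
  pose proof (contour_unique _ _ _ _ _ (proj1 he) I1 I2) as E.
  assert (E' : bop_comp (F z) P = bop_comp P (F z)).
  { apply two_pi_i_scal_inj; etransitivity; [|etransitivity; [exact E|]].
    - apply bop_ext; intro v; symmetry; apply (bopZ (F z)).
    - now apply bop_ext. }
  exact (f_equal (fun S : Bop H H => S x) E').
Qed.

(** The local Lipschitz bound makes [F] norm continuous along the circle, and the parameter interval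
    is compact. *)
Lemma bounded_on_circle eps : 0 < eps < r ->
  exists M, forall t, 0 <= t <= 2 * PI -> op_norm (F (circle z0 eps t)) <= M.
Proof.
  intro he.
  destruct (bounded_continuity (V := Bop_NormedModule H H) (fun t => F (circle z0 eps t)) 0 (2 * PI))
    as [M hM].
  2: { exists M; intros t ht; apply Rlt_le; exact (hM t ht). }
  intros x _; apply (filterlim_locally_ball_norm (U := Bop_NormedModule H H)); intro d.
  destruct (holo_bound _ _ (Fholo _ (punctured_circle eps x he))) as [l [K [c [hc [hK hb]]]]].
  set (s := Rmin c (d / (K + 1))).
  assert (hs : 0 < s).
  { apply Rmin_pos; auto; apply Rdiv_lt_0_compat; [apply cond_pos | lra]. }
  set (s' := s / (2 * eps)).
  assert (hs' : 0 < s') by (apply Rdiv_lt_0_compat; lra).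
  assert (cc : continuous cos x) by (apply (ex_derive_continuous cos); auto_derive; auto).
  assert (cs : continuous sin x) by (apply (ex_derive_continuous sin); auto_derive; auto).
  pose proof (proj1 (filterlim_locally _ _) cc (mkposreal _ hs')) as lc.
  pose proof (proj1 (filterlim_locally _ _) cs (mkposreal _ hs')) as ls.
  pose proof (filter_and _ _ lc ls) as L; revert L; apply filter_imp; intros y [yc ys].
  change (Rabs (cos y - cos x) < s') in yc; change (Rabs (sin y - sin x) < s') in ys.
  assert (D : Cmod (Cminus (circle z0 eps y) (circle z0 eps x)) < s).
  { replace (Cminus (circle z0 eps y) (circle z0 eps x)) with
      (Cmult (RtoC eps) (Cplus (RtoC (cos y - cos x)) (Cmult Ci (RtoC (sin y - sin x))))).
    - rewrite Cmod_mult Cmod_R Rabs_right; [|lra].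
      pose proof (Cmod_triangle (RtoC (cos y - cos x)) (Cmult Ci (RtoC (sin y - sin x)))) as T.
      rewrite Cmod_mult !Cmod_R in T.
      replace (Cmod Ci) with 1 in T.
      + assert (Q : Cmod (Cplus (RtoC (cos y - cos x)) (Cmult Ci (RtoC (sin y - sin x)))) < 2 * s') by lra.
        apply Rmult_lt_compat_l with (r := eps) in Q; [|lra].
        replace (eps * (2 * s')) with s in Q by (unfold s'; field; lra); exact Q.
      + unfold Cmod, Ci; transitivity (sqrt 1); [symmetry; apply sqrt_1 | simpl; f_equal; ring].
    - unfold circle, Cminus, Cplus, Cmult, Copp, RtoC, Ci; simpl; f_equal; ring. }
  destruct (hb (circle z0 eps y)) as [B _].
  { eapply Rlt_le_trans; [exact D | apply Rmin_l]. }
  unfold ball_norm; eapply Rle_lt_trans; [exact B|].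
  pose proof (Rmin_r c (d / (K + 1))) as S2; fold s in S2.
  pose proof (Cmod_ge_0 (Cminus (circle z0 eps y) (circle z0 eps x))).
  apply Rle_lt_trans with (K * (d / (K + 1))); [apply Rmult_le_compat_l; lra|].
  pose proof (cond_pos d).
  apply Rmult_lt_reg_r with (K + 1); [lra|].
  replace (K * (d / (K + 1)) * (K + 1)) with (K * d) by (field; lra); nra.
Qed.

(** [Q] is [1 - P]; [F] splits into the principal part [F P] and the regular part [A]. *)
Let Q : Bop H H := bop_plus (bop_id H) (bop_scal (RtoC (-1)) P).
Let A (z : C) : Bop H H := bop_comp (F z) Q.

(** Cauchy's formula for [A] on a fixed circle, obtained from
    [F(z) F(y) = (F(y) - F(z)) / (y - z)]. *)
Lemma regular_part_bounded :
  exists M d, 0 < d < r /\ 0 <= M /\ forall z, punctured z0 d z -> op_norm (A z) <= M.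
Proof.
  set (eps := r / 2); assert (he : 0 < eps < r) by (unfold eps; lra).
  destruct (bounded_on_circle eps he) as [M hM].
  assert (M0 : 0 <= M).
  { eapply Rle_trans; [apply (op_norm_ge_0 (F (circle z0 eps 0))) | apply (hM 0)].
    pose proof PI_RGT_0; lra. }
  (* For these [z] the circle stays at distance [eps / 2], so the integrand [F(y) / (y - z)] is at
     most [M / (eps / 2)]; its product with the radius is [2 * M]. *)
  exists (2 * M), (eps / 2); split; [lra|]; split; [lra|]; intros z hz.
  assert (hz' : punctured z0 r z) by (destruct hz; split; lra).
  assert (hze : Cmod (Cminus z z0) < eps) by (destruct hz; lra).
  (* [I1] integrates [F(z) F(y)] to [-2 pi i F(z) P], and [I2] integrates [F(z) / (y - z)] to
     [2 pi i F(z)]. The sum is [2 pi i A(z)], and by the resolvent identity it is the integral of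
     [F(y) / (y - z)]. *)
  pose proof (contour_linear _ _ _ _ _ (is_linear_comp_l (F z)) (hP _ he)) as I1.
  pose proof (contour_cauchy_kernel (V := Bop_NormedModule H H) (F z) z0 z eps hze) as I2.
  pose proof (contour_plus _ _ _ _ _ _ I1 I2) as I3.
  set (G := fun y => @scal C_Ring (Bop_NormedModule H H) (Cinv (Cminus y z)) (F y)).
  assert (lo : forall y, Cmod (Cminus y z0) = eps -> eps / 2 <= Cmod (Cminus y z)).
  { intros y hy; pose proof (Cmod_triangle (Cminus y z) (Cminus z z0)) as T.
    replace (Cplus (Cminus y z) (Cminus z z0)) with (Cminus y z0) in T by ring.
    destruct hz; lra. }
  assert (nz : forall y, Cmod (Cminus y z0) = eps -> Cminus y z <> RtoC 0).
  { intros y hy E; specialize (lo y hy); rewrite E Cmod_0 in lo; lra. }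
  apply (contour_ext _ G) in I3; [|lra|].
  2: { intros y hy; specialize (nz y hy); unfold G.
    assert (hy' : punctured z0 r y) by (split; lra).
    apply bop_ext; intro x.
    pose proof (f_equal (fun S : Bop H H => S x) (Fid y z hy' hz')) as E; simpl in E.
    simpl; rewrite {2}E; vec_in H; field; auto. }
  apply (contour_bound _ _ _ _ (M / (eps / 2)) (proj1 he)) in I3.
  - assert (E : plus (bop_comp (F z) (@scal C_Ring Bop_ModuleSpace (Copp two_pi_i) P))
       (@scal C_Ring (Bop_NormedModule H H) two_pi_i (F z)) =
       @scal C_Ring (Bop_NormedModule H H) two_pi_i (A z)).
    { apply bop_ext; intro x; simpl; rewrite bopD !bopZ; vec_in H. }
    assert (I4 : norm (@scal C_Ring (Bop_NormedModule H H) two_pi_i (A z)) <= 2 * PI * (eps * (M / (eps / 2)))).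
    { rewrite -E; exact I3. }
    rewrite norm_scal_eq in I4.
    change (norm (A z)) with (op_norm (A z)) in I4.
    assert (c : Cmod two_pi_i = 2 * PI).
    { pose proof PI_RGT_0; unfold two_pi_i; rewrite Cmod_mult Cmod_R Rabs_right; [|lra].
      replace (Cmod Ci) with 1; [ring|].
      unfold Cmod, Ci; transitivity (sqrt 1); [symmetry; apply sqrt_1 | simpl; f_equal; ring]. }
    rewrite c in I4; pose proof PI_RGT_0.
    apply Rmult_le_reg_l with (2 * PI); [lra|].
    eapply Rle_trans; [exact I4|]; apply Req_le; field; lra.
  - intros t ht; unfold G; rewrite norm_scal_eq.
    pose proof (Cmod_circle z0 eps t (proj1 he)) as hy.
    rewrite Cmod_inv; [|now apply nz].
    unfold Rdiv; rewrite Rmult_comm; apply Rmult_le_compat.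
    + apply norm_ge_0.
    + apply Rlt_le, Rinv_0_lt_compat; specialize (lo _ hy); lra.
    + now apply hM.
    + apply Rinv_le_contravar; [lra | now apply lo].
Qed.

(** The integral of [F S] does not depend on the radius of the circle, but it is at most a constant
    times this radius. *)
Lemma bounded_residue (S : Bop H H) M d : 0 < d < r ->
  (forall z, punctured z0 d z -> op_norm (bop_comp (F z) S) <= M) -> forall x, P (S x) = zero.
Proof.
  intros hd hM.
  assert (E : bop_scal (Copp two_pi_i) (bop_comp P S) = (zero : Bop_NormedModule H H)).
  { apply norm_small_eq; intros c hc.
    rewrite (_ : minus _ zero = bop_comp (bop_scal (Copp two_pi_i) P) S).
    2: { apply bop_ext; intro x; simpl; vec_in H. }
    set (M' := Rabs M + 1); assert (hM' : 0 < M') by (unfold M'; pose proof (Rabs_pos M); lra).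
    pose proof PI_RGT_0.
    set (eps := Rmin (d / 2) (c / (2 * PI * M'))).
    assert (h0 : 0 < eps).
    { apply Rmin_pos; [lra|]; apply Rdiv_lt_0_compat; auto; apply Rmult_lt_0_compat; lra. }
    pose proof (Rmin_l (d / 2) (c / (2 * PI * M'))) as h1; fold eps in h1.
    pose proof (Rmin_r (d / 2) (c / (2 * PI * M'))) as h2; fold eps in h2.
    pose proof (contour_linear _ _ _ _ _ (is_linear_comp_r S) (hP eps ltac:(lra))) as I.
    apply (contour_bound _ _ _ _ M' h0) in I.
    - eapply Rle_trans; [exact I|].
      apply Rle_trans with (2 * PI * ((c / (2 * PI * M')) * M')); [|apply Req_le; field; lra].
      apply Rmult_le_compat_l; [lra|]; apply Rmult_le_compat_r; lra.
    - intros t _; apply Rle_trans with M; [|unfold M'; pose proof (Rle_abs M); lra].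
      apply hM; split; rewrite Cmod_circle; lra. }
  assert (E' : bop_comp P S = bop_zero).
  { apply two_pi_i_scal_inj; rewrite E; apply bop_ext; intro x; simpl; vec_in H. }
  intro x; exact (f_equal (fun S : Bop H H => S x) E').
Qed.

(** The family [F (1 - P)] is bounded near [z0], so its residue vanishes, that is,
    [P (1 - P) = 0]. *)
Lemma riesz_idempotent x : P (P x) = P x.
Proof.
  destruct regular_part_bounded as [M [d [hd [_ hM]]]].
  pose proof (bounded_residue Q M d hd hM x) as E; simpl in E.
  rewrite bopD bopZ in E; apply (minus_zero_eq (V := H)).
  transitivity (@scal C_Ring H (RtoC (-1)) (plus (P x) (@scal C_Ring H (RtoC (-1)) (P (P x))))); [vec_in H|].
  rewrite E; vec_in H.
Qed.

(** As [P] is an idempotent commuting with [F], the family [A] satisfies the resolvent identity as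
    well. Its value at [z0] is manufactured from a nearby point [y] as
    [(1 - (z0 - y) A(y))^-1 A(y)], after which the identity holds with base point [z0]. *)
Lemma regular_part_expands : exists a, expands (V := Bop_NormedModule H H) A z0 0 a.
Proof.
  destruct regular_part_bounded as [M [d [hd [M0 hM]]]].
  (* [e] is the distance of [y] from [z0]; the second bound makes [e * op_norm (A y)] at most
     [1 / 2], as the Neumann series requires. *)
  set (e := Rmin (d / 2) (/ (2 * (M + 1)))).
  assert (e0 : 0 < e) by (apply Rmin_pos; [lra | apply Rinv_0_lt_compat; lra]).
  pose proof (Rmin_l (d / 2) (/ (2 * (M + 1)))) as e1; fold e in e1.
  pose proof (Rmin_r (d / 2) (/ (2 * (M + 1)))) as e2; fold e in e2.
  set (y := Cplus z0 (RtoC e)).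
  assert (hy : Cmod (Cminus z0 y) = e).
  { replace (Cminus z0 y) with (Copp (RtoC e)) by (unfold y; ring).
    rewrite Cmod_opp Cmod_R Rabs_right; lra. }
  assert (hyd : punctured z0 d y).
  { unfold punctured; rewrite -Cmod_opp; replace (Copp (Cminus y z0)) with (Cminus z0 y) by ring.
    split; lra. }
  assert (hyr : punctured z0 r y) by (destruct hyd; split; lra).
  destruct (neumann_inverse H (bop_scal (Cminus z0 y) (A y))) as [N [n1 n2]].
  { rewrite op_norm_bop_scal hy; specialize (hM y hyd).
    apply Rle_trans with (/ (2 * (M + 1)) * (M + 1)); [|apply Req_le; field; lra].
    apply Rmult_le_compat; try lra; apply op_norm_ge_0. }
  exists (fun k => bop_pow (bop_comp N (A y)) (S k)).
  apply (pseudo_resolvent_expands A z0 _ r hr); intros z hz.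
  apply bop_ext; intro x.
  assert (E : A z x = plus (A y x) (@scal C_Ring H (Cminus z y) (A y (A z x)))).
  { pose proof (f_equal (fun S : Bop H H => S (Q x)) (Fid z y hz hyr)) as E; simpl in E.
    unfold A; simpl; rewrite !bopD !bopZ in E |- *.
    rewrite !riesz_comm in E |- *; auto.
    rewrite !bopD !bopZ !riesz_comm; auto.
    rewrite !riesz_idempotent.
    rewrite {1}E; vec_in H. }
  change (A z x = plus (N (A y x)) (@scal C_Ring H (Cminus z z0) (N (A y (A z x))))).
  transitivity (N (minus (A z x) (@scal C_Ring H (Cminus z0 y) (A y (A z x)))));
    [symmetry; exact (n1 (A z x))|].
  rewrite (_ : minus (A z x) _ = plus (A y x) (@scal C_Ring H (Cminus z z0) (A y (A z x)))).
  - by rewrite bopD bopZ.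
  - rewrite {1}E; vec_in H.
Qed.

Context (hfr : has_rank_sum P).

Lemma principal_part_expansion : finite_rank_expansion (fun z => bop_comp (F z) P) z0.
Proof.
  set (w := Cplus z0 (RtoC (r / 2))).
  set (s := Cminus z0 w).
  assert (hs : Cmod s = r / 2).
  { replace s with (Copp (RtoC (r / 2))) by (unfold s, w; ring).
    rewrite Cmod_opp Cmod_R Rabs_right; lra. }
  assert (hw : punctured z0 r w).
  { unfold punctured; rewrite -Cmod_opp; replace (Copp (Cminus w z0)) with s by (unfold s; ring).
    split; lra. }
  (* For [F(w) = (T - w)^-1] this is [(T - z0) (T - w)^-1], a bounded substitute for [T - z0]; [Y]
     is its part on the range of [P]. *)
  set (D := bop_plus (bop_id H) (bop_scal (Copp s) (F w))).
  set (Y := bop_comp D P).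
  assert (hY : has_rank_sum Y) by now apply has_rank_sum_comp_r.
  assert (YE : forall x, Y x = minus (P x) (@scal C_Ring H s (F w (P x)))).
  { intro x; simpl; vec_in H. }
  assert (PY : forall x, P (Y x) = Y x).
  { intro x; rewrite !YE bopB bopZ -riesz_comm // riesz_idempotent //. }
  (* The resolvent identity as a recursion on the range of [P]: a factor [z - z0] on the left is
     traded for a factor [Y] on the right, up to a constant term of finite rank. *)
  assert (key : forall z x, punctured z0 r z ->
    @scal C_Ring H (Cminus z z0) (F z (P x)) =
    minus (@scal C_Ring H (Cminus z w) (F z (Y x))) (minus (P x) (Y x))).
  { intros z x hz.
    pose proof (f_equal (fun S : Bop H H => S (P x)) (Fid z w hz hw)) as E; simpl in E.
    rewrite !YE bopB bopZ (Fcomm z w) // {1 2}E; unfold s; vec_in H. }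
  destruct (finite_rank_power_factor Y hY) as [m [Z hZ]].
  set (U := bop_pow Y (S m)) in *.
  assert (PU : forall x, P (U x) = U x) by (intro x; apply PY).
  (* Here [U = U' Z] with [U' = Y U]. For [B = F U'] the recursion reads
     [(z - w) B = (P - Y) U + t B Z]; for small [t] the last term is absorbed on the left, so [B]
     and [F U = B Z] are bounded. Hence [P U], which is [U], vanishes. *)
  assert (nil : forall x, U x = zero).
  { set (U' := bop_pow Y (S (S m))) in *.
    set (c := op_norm (bop_comp (bop_plus P (bop_scal (RtoC (-1)) Y)) U)).
    (* [Cmod (z - w)] is at least [r / 2 - r / 8] and [Cmod t * op_norm Z] at most [r / 8], which
       leaves the factor [r / 4] in front of [op_norm B]. *)
    set (d := Rmin (r / 8) (r / (8 * (op_norm Z + 1)))).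
    pose proof (op_norm_ge_0 Z) as Z0.
    assert (d0 : 0 < d) by (apply Rmin_pos; [lra | apply Rdiv_lt_0_compat; lra]).
    pose proof (Rmin_l (r / 8) (r / (8 * (op_norm Z + 1)))) as d1; fold d in d1.
    pose proof (Rmin_r (r / 8) (r / (8 * (op_norm Z + 1)))) as d2; fold d in d2.
    intro x; rewrite -PU.
    apply (bounded_residue U (4 * c / r * op_norm Z) d ltac:(lra)).
    intros z hz; assert (hz' : punctured z0 r z) by (destruct hz; split; lra).
    destruct hz as [t0 t1]; set (t := Cminus z z0) in *.
    set (B := bop_comp (F z) U').
    assert (EU : bop_comp (F z) U = bop_comp B Z).
    { apply bop_ext; intro v; unfold B; simpl; f_equal; apply hZ. }
    rewrite EU; eapply Rle_trans; [apply op_norm_comp|].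
    apply Rmult_le_compat_r; auto.
    assert (EB : bop_scal (Cminus z w) B =
      bop_plus (bop_comp (bop_plus P (bop_scal (RtoC (-1)) Y)) U) (bop_scal t (bop_comp B Z))).
    { rewrite -EU; apply bop_ext; intro v.
      change (@scal C_Ring H (Cminus z w) (F z (Y (U v))) =
        plus (plus (P (U v)) (@scal C_Ring H (RtoC (-1)) (Y (U v)))) (@scal C_Ring H t (F z (U v)))).
      pose proof (key z (U v) hz') as K; rewrite !PU in K; fold t in K.
      rewrite K PU; vec_in H. }
    assert (N1 : Cmod (Cminus z w) * op_norm B <= c + Cmod t * (op_norm B * op_norm Z)).
    { rewrite -op_norm_bop_scal EB; eapply Rle_trans; [apply op_norm_triangle|].
      apply Rplus_le_compat_l; rewrite op_norm_bop_scal; apply Rmult_le_compat_l; [lra|].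
      apply op_norm_comp. }
    assert (N2 : r / 2 - Cmod t <= Cmod (Cminus z w)).
    { pose proof (Cmod_triangle (Cminus z w) (Copp t)) as T; rewrite Cmod_opp in T.
      replace (Cplus (Cminus z w) (Copp t)) with s in T by (unfold s, t; ring); lra. }
    assert (N3 : Cmod t * op_norm Z <= r / 8).
    { apply Rle_trans with (r / (8 * (op_norm Z + 1)) * (op_norm Z + 1)); [|apply Req_le; field; lra].
      apply Rmult_le_compat; lra. }
    pose proof (op_norm_ge_0 B).
    assert (N4 : r / 4 * op_norm B <= c).
    { assert ((r / 2 - Cmod t) * op_norm B <= Cmod (Cminus z w) * op_norm B) by (apply Rmult_le_compat_r; auto).
      assert (Cmod t * op_norm Z * op_norm B <= r / 8 * op_norm B) by (apply Rmult_le_compat_r; auto).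
      assert (Cmod t * op_norm B <= r / 8 * op_norm B) by (apply Rmult_le_compat_r; auto; lra).
      lra. }
    apply Rmult_le_reg_l with (r / 4); [lra|].
    eapply Rle_trans; [exact N4|]; apply Req_le; field; lra. }
  (* Descent in the power of [Y]: the recursion divided by [z - z0] expresses [F P Y^j] by
     [F P Y^(j+1)]. It starts from the vanishing power [S m] and ends at [Y^0 = 1]. *)
  assert (G : forall k, (k <= S m)%nat ->
    finite_rank_expansion (fun z => bop_comp (F z) (bop_comp P (bop_pow Y (S m - k)))) z0).
  { assert (ext : forall F1 F2 : C -> Bop H H, (forall z, punctured z0 r z -> F1 z = F2 z) ->
      finite_rank_expansion F1 z0 -> finite_rank_expansion F2 z0).
    { intros F1 F2 E [N [a [a1 a2]]]; exists N, a; split; auto.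
      apply (expands_ext (V := Bop_NormedModule H H) F1 F2 z0 N a r); auto. }
    induction k as [|k IH]; intro hk.
    - rewrite Nat.sub_0_r; fold U.
      apply (ext (fun _ => bop_zero)); [|apply finite_rank_expansion_const, has_rank_sum_zero].
      intros z _; apply bop_ext; intro x.
      change ((zero : H) = F z (P (U x))); rewrite nil (bop0 P); symmetry; exact (bop0 (F z)).
    - specialize (IH ltac:(lia)); set (j := (S m - S k)%nat).
      replace (S m - k)%nat with (S j) in IH by (unfold j; lia).
      apply (ext (fun z => bop_scal (Cinv (Cminus z z0))
        (bop_plus (bop_scal (Cminus z w) (bop_comp (F z) (bop_comp P (bop_pow Y (S j)))))
           (bop_scal (RtoC (-1)) (bop_comp (bop_plus P (bop_scal (RtoC (-1)) Y)) (bop_pow Y j)))))).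
      + intros z hz; apply bop_ext; intro x.
        pose proof (key z (bop_pow Y j x) hz) as K.
        assert (nz : Cminus z z0 <> RtoC 0).
        { destruct hz as [p _]; intro E; rewrite E Cmod_0 in p; lra. }
        set (v := bop_pow Y j x) in *.
        transitivity (@scal C_Ring H (Cinv (Cminus z z0)) (@scal C_Ring H (Cminus z z0) (F z (P v)))).
        * rewrite K.
          change (@scal C_Ring H (Cinv (Cminus z z0)) (plus (@scal C_Ring H (Cminus z w) (F z (P (Y v))))
              (@scal C_Ring H (RtoC (-1)) (plus (P v) (@scal C_Ring H (RtoC (-1)) (Y v))))) =
            @scal C_Ring H (Cinv (Cminus z z0)) (minus (@scal C_Ring H (Cminus z w) (F z (Y v))) (minus (P v) (Y v)))).
          rewrite PY; vec_in H.
        * simpl; fold v; vec_in H; field; auto.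
      + apply finite_rank_expansion_div, finite_rank_expansion_plus.
        * now apply finite_rank_expansion_affine.
        * apply finite_rank_expansion_const, has_rank_sum_scal, has_rank_sum_comp_l.
          apply has_rank_sum_plus; auto; now apply has_rank_sum_scal. }
  specialize (G (S m) (le_n _)); rewrite Nat.sub_diag in G.
  destruct G as [N [a [a1 a2]]]; exists N, a; split; auto.
Qed.

Lemma isolated_singularity_fmero : fmero F z0.
Proof.
  destruct regular_part_expands as [a ha].
  apply (fmero_ext (fun z => bop_plus (bop_comp (F z) P) (A z)) _ z0 r hr).
  - intros z _; apply bop_ext; intro x; unfold A; simpl; rewrite bopD bopZ; vec_in H.
  - apply fmero_plus.
    + apply finite_rank_expansion_fmero, principal_part_expansion.
    + exists 0%nat, a; split; auto; lia.
Qed.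

(** The coefficient of index -1 is found by comparing its contour integral with the one that defines
    [P]: it is [-P]. The shift by 1 provides this coefficient even when the expansion has no
    negative powers. *)
Lemma isolated_singularity_rtrace t : ftrace P t -> rtrace F z0 (Copp t).
Proof.
  intro ht; destruct isolated_singularity_fmero as [N [a [h _]]].
  apply (expands_shift 1) in h; simpl in h.
  eexists; eexists; split; [exact h|].
  destruct (contour_expands (V := Bop_NormedModule H H) _ _ _ _ h) as [d [hd hc]].
  set (eps := Rmin (d / 2) (r / 2)).
  assert (he : 0 < eps) by (apply Rmin_pos; lra).
  pose proof (Rmin_l (d / 2) (r / 2)) as e1; pose proof (Rmin_r (d / 2) (r / 2)) as e2.
  fold eps in e1, e2.
  pose proof (contour_unique _ _ _ _ _ he (hc eps ltac:(lra)) (hP eps ltac:(lra))) as E.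
  set (b := if Nat.ltb N 1 then _ else _) in *.
  assert (Eb : b = bop_scal (RtoC (-1)) P).
  { apply two_pi_i_scal_inj.
    transitivity (bop_scal (RtoC (-1)) (@scal C_Ring (Bop_NormedModule H H) two_pi_i b)).
    - apply bop_ext; intro x; simpl; vec_in H.
    - rewrite E; apply bop_ext; intro x; simpl; vec_in H. }
  rewrite Eb; replace (Copp t) with (Cmult (RtoC (-1)) t).
  - now apply ftrace_scal.
  - unfold Cmult, Copp, RtoC; simpl; f_equal; ring.
Qed.

End IsolatedSingularity.

(** * Boundary triples and Krein's formula *)

(** At a regular point the residue is zero and so is [m_a]. Otherwise the number chosen by [epsilon]
    in [m_a] is the dimension of the range of some Riesz projection, hence the trace of this
    idempotent; the sign is that of the residue [-P]. *)
Lemma resolvent_structure {H : HilbertSpace} (T : op H H) (z0 : C) :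
  linear_op T -> discrete_spectrum T z0 \/ resolvent_set T z0 ->
  exists r, 0 < r /\ (forall z, punctured z0 r z -> resolvent_set T z) /\
    fmero (resolvent T) z0 /\ rtrace (resolvent T) z0 (Copp (RtoC (INR (m_a z0 T)))).
Proof.
  intros hT h; unfold m_a.
  destruct (excluded_middle_informative (resolvent_set T z0)) as [hr|nr].
  - destruct (resolvent_open T z0 hr) as [r [r0 hz]].
    pose proof (resolvent_expands T z0 hr) as E.
    exists r; split; auto; split; [intros z [_ z2]; auto|]; split.
    + eexists; eexists; split; [exact E|]; lia.
    + apply (expands_shift 1) in E; eexists; eexists; split; [exact E|]; simpl.
      replace (Copp (RtoC 0)) with (RtoC 0) by (unfold Copp, RtoC; simpl; f_equal; ring).
      apply ftrace_zero.
  - destruct h as [[_ [[_ [r1 [r1p hr1]]] hn]]|h]; [|contradiction].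
    apply (epsilon_spec (inhabits 0%nat)) in hn; set (n := epsilon _ _) in *.
    destruct hn as [P [[r2 [r2p hP]] hd]].
    destruct (has_dim_rank_sum P n hd) as [hfr htr].
    set (r := Rmin r1 r2); assert (r0 : 0 < r) by now apply Rmin_pos.
    pose proof (Rmin_l r1 r2) as l1; pose proof (Rmin_r r1 r2) as l2; fold r in l1, l2.
    assert (hr : forall z, punctured z0 r z -> resolvent_set T z).
    { intros z [z1 z2]; apply hr1; split; lra. }
    assert (Fid : forall z w, punctured z0 r z -> punctured z0 r w -> resolvent T z =
      bop_plus (resolvent T w) (bop_scal (Cminus z w) (bop_comp (resolvent T w) (resolvent T z)))).
    { intros; apply resolvent_identity; auto. }
    assert (Fc : forall z w x, punctured z0 r z -> punctured z0 r w ->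
      resolvent T z (resolvent T w x) = resolvent T w (resolvent T z x)).
    { intros; apply resolvent_comm; auto. }
    assert (Fh : forall z, punctured z0 r z -> holo (V := Bop_NormedModule H H) (resolvent T) z).
    { intros; apply resolvent_holo; auto. }
    assert (hP' : forall eps, 0 < eps < r -> is_contour_integral (V := Bop_NormedModule H H)
      (resolvent T) z0 eps (@scal C_Ring Bop_ModuleSpace (Copp two_pi_i) P)).
    { intros eps he; apply hP; lra. }
    exists r; repeat split; auto.
    + apply (isolated_singularity_fmero _ z0 r r0 Fid Fc Fh P hP' hfr).
    + apply (isolated_singularity_rtrace _ z0 r r0 Fid Fc Fh P hP' hfr), htr.
      apply (riesz_idempotent _ z0 r r0 Fid Fh P hP').
Qed.

(** * Adjoints, operators with bounded inverse, families on a disc *)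

Section Adjoints.

Context {U V : HilbertSpace} (T : op U V).

Lemma adjointP g f : dom (adjoint T) g -> dom T f -> inner (T f) g = inner f (adjoint T g).
Proof.
  intros dg df; simpl in dg.
  exact (epsilon_spec (inhabits zero) _ dg f df).
Qed.

Lemma dense_inner_eq x y : densely_defined T ->
  (forall f, dom T f -> inner f x = inner f y) -> x = y.
Proof.
  intros hd h; apply (minus_zero_eq (V := U)), norm0_eq.
  apply Rle_antisym; [|apply norm_ge_0]; apply Rnot_lt_le; intro L.
  set (d := minus x y) in *.
  destruct (hd d (mkposreal _ L)) as [f [df hf]]; simpl in hf.
  assert (E : inner f d = RtoC 0) by (unfold d; rewrite inner_minus_r (h f df); ring).
  pose proof (cauchy_schwarz (minus f d) d) as B; rewrite inner_minus_l E inner_norm in B.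
  replace (Cminus (RtoC 0) (RtoC (norm d ^ 2))) with (Copp (RtoC (norm d ^ 2))) in B by ring.
  rewrite Cmod_opp Cmod_R Rabs_right in B; [|apply Rle_ge, pow2_ge_0].
  assert (norm (minus f d) * norm d < norm d * norm d) by (apply Rmult_lt_compat_r; [exact L | exact hf]).
  simpl in B; lra.
Qed.

Lemma adjoint_intro g h : densely_defined T ->
  (forall f, dom T f -> inner (T f) g = inner f h) -> dom (adjoint T) g /\ adjoint T g = h.
Proof.
  intros hd hgh; assert (dg : dom (adjoint T) g) by now exists h.
  split; auto; apply (dense_inner_eq _ _ hd); intros f df.
  by rewrite -adjointP // hgh.
Qed.

End Adjoints.

(** The adjoint of [(T - z)^-1] inverts the adjoint of [T - z]. *)
Lemma adjoint_resolvent_set {H : HilbertSpace} (T : op H H) z : densely_defined T ->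
  resolvent_set T z -> resolvent_set (adjoint T) (Cconj z).
Proof.
  intros hd hz; set (R := resolvent T z); exists (bop_adj R).
  assert (RT : forall f, dom T f -> R (T f) = plus f (@scal C_Ring H z (R f))).
  { intros f df; pose proof (resolvent_l T z f hz df) as E; fold R in E.
    rewrite bopB bopZ in E; rewrite -{2}E; vec_in H. }
  split.
  - intros g dg; simpl; apply inner_ext_r; intro x.
    pose proof (resolvent_dom T z x hz) as dx; fold R in dx.
    pose proof (resolvent_r T z x hz) as E; fold R in E.
    rewrite -bop_adjP inner_minus_r inner_scal_r Cconj_Cconj -(adjointP T g (R x) dg dx).
    rewrite E inner_plus_l inner_scal_l; ring.
  - intro g.
    destruct (adjoint_intro T (bop_adj R g) (plus g (@scal C_Ring H (Cconj z) (bop_adj R g))) hd) as [d e].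
    { intros f df; rewrite -bop_adjP RT // inner_plus_l inner_plus_r inner_scal_l inner_scal_r
        Cconj_Cconj -bop_adjP //. }
    split; [exact d|].
    change (minus (adjoint T (bop_adj R g)) (@scal C_Ring H (Cconj z) (bop_adj R g)) = g).
    rewrite e; vec_in H.
Qed.

Lemma resolvent_set_op_eq {H : HilbertSpace} (T T' : op H H) z :
  op_eq T T' -> resolvent_set T z -> resolvent_set T' z.
Proof.
  intros [e1 e2] [R [h1 h2]]; exists R; split; simpl in *.
  - intros f df; apply e1 in df; rewrite -e2 //; auto.
  - intro g; destruct (h2 g) as [d e]; split; [now apply e1|]; rewrite -e2 //.
Qed.

(** With [is_inverse_closed], this yields linearity and closedness of [Theta - M(z)] from its
    inverse instead of from a perturbation argument. *)
Lemma is_inverse_linear {H : HilbertSpace} (T : op H H) (R : Bop H H) :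
  is_inverse T R -> linear_op T.
Proof.
  intros [h1 h2].
  assert (e : forall g, T (R g) = g) by (intro g; apply h2).
  repeat split.
  - rewrite -(bop0 R); apply h2.
  - rewrite -(h1 f H0) -(h1 g H1) -bopD; apply h2.
  - rewrite -{1}(h1 f H0) -{1}(h1 g H1) -bopD; apply e.
  - rewrite -(h1 f H0) -bopZ; apply h2.
  - rewrite -{1}(h1 f H0) -bopZ; apply e.
Qed.

Lemma ball_norm_lt {V : NormedModule C_AbsRing} (x : V) (d : R) : 0 < d ->
  exists e : posreal, forall y, ball x e y -> norm (minus y x) < d.
Proof.
  intro hd; pose proof (norm_factor_gt_0 (K := C_AbsRing) (V := V)) as nf.
  assert (he : 0 < d / (@norm_factor C_AbsRing V)) by (apply Rdiv_lt_0_compat; auto).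
  exists (mkposreal _ he); intros y hy.
  apply (norm_compat2 (K := C_AbsRing) (V := V)) in hy; simpl in hy.
  replace (norm_factor * (d / norm_factor)) with d in hy by (field; lra); exact hy.
Qed.

(** The graph of [T] is the reversed graph of the continuous [R]: if [R g] differs from [f], a whole
    ball around [(f, g)] avoids it. *)
Lemma is_inverse_closed {H : HilbertSpace} (T : op H H) (R : Bop H H) :
  is_inverse T R -> closed_op T.
Proof.
  intros [h1 h2] [f g] hx; simpl.
  assert (E : R g = f).
  { apply NNPP; intro N; apply hx; clear hx.
    set (e := norm (minus (R g) f)).
    assert (he : 0 < e).
    { apply (norm_pos (V := H)); intro E; now apply N, (minus_zero_eq (V := H)). }
    pose proof (op_norm_ge_0 R) as r0.
    destruct (ball_norm_lt (V := H) f (e / 2)) as [d1 hd1]; [lra|].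
    destruct (ball_norm_lt (V := H) g (e / (2 * (op_norm R + 1)))) as [d2 hd2].
    { apply Rdiv_lt_0_compat; lra. }
    exists (mkposreal _ (Rmin_stable_in_posreal d1 d2)); intros [f' g'] [b1 b2] [p1 p2]; simpl in *.
    specialize (hd1 f' (ball_le _ _ _ (Rmin_l d1 d2) _ b1)).
    specialize (hd2 g' (ball_le _ _ _ (Rmin_r d1 d2) _ b2)).
    assert (E : R g' = f') by (rewrite -p2; auto).
    assert (L : e <= norm (R (minus g' g)) + norm (minus f' f)).
    { rewrite Rplus_comm; unfold e; rewrite bopB E.
      eapply Rle_trans; [|apply (norm_minus_le (V := H))]; apply Req_le; f_equal; vec_in H. }
    pose proof (bop_le R (minus g' g)) as L2.
    assert (L3 : op_norm R * norm (minus g' g) <= e / 2).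
    { apply Rle_trans with ((op_norm R + 1) * (e / (2 * (op_norm R + 1)))); [|apply Req_le; field; lra].
      pose proof (norm_ge_0 (minus g' g)).
      apply Rmult_le_compat; auto; [lra | apply Rlt_le; exact hd2]. }
    apply (Rlt_irrefl e); eapply Rle_lt_trans; [exact L|].
    apply Rlt_le_trans with (e / 2 + e / 2); [|lra].
    apply Rplus_le_lt_compat; [eapply Rle_trans; [exact L2 | exact L3] | exact hd1]. }
  rewrite -E; apply h2.
Qed.

Lemma is_derive_unique_C {V : NormedModule C_AbsRing} (f : C -> V) z l l' :
  @is_derive C_AbsRing V f z l -> @is_derive C_AbsRing V f z l' -> l = l'.
Proof.
  intros [_ h] [_ h']; apply norm_small_eq; intros eps he.
  assert (he2 : 0 < eps / 2) by lra.
  specialize (h z (fun P p => p) (mkposreal _ he2)).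
  specialize (h' z (fun P p => p) (mkposreal _ he2)).
  pose proof (filter_and _ _ h h') as [d hd]; simpl in hd.
  set (s := RtoC (d / 2)); set (y := Cplus z s).
  pose proof (cond_pos d) as d0.
  assert (cs : Cmod s = d / 2) by (unfold s; rewrite Cmod_R Rabs_right; lra).
  assert (ys : Cminus y z = s) by (unfold y; ring).
  assert (hb : ball (z : AbsRing_UniformSpace C_AbsRing) d y).
  { change (Cmod (Cminus y z) < d); rewrite ys cs; lra. }
  destruct (hd y hb) as [a b].
  change (norm (minus (minus (f y) (f z)) (@scal C_Ring V (Cminus y z) l)) <= eps / 2 * Cmod (Cminus y z)) in a.
  change (norm (minus (minus (f y) (f z)) (@scal C_Ring V (Cminus y z) l')) <= eps / 2 * Cmod (Cminus y z)) in b.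
  rewrite ys cs in a b.
  assert (L : Cmod s * norm (minus l l') <= eps * (d / 2)).
  { rewrite -norm_scal_eq.
    rewrite (_ : @scal C_Ring V s (minus l l') =
      minus (minus (minus (f y) (f z)) (@scal C_Ring V s l')) (minus (minus (f y) (f z)) (@scal C_Ring V s l)));
      [|vec_in V].
    eapply Rle_trans; [apply norm_minus_le|]; lra. }
  rewrite cs in L; apply Rmult_le_reg_l with (d / 2); lra.
Qed.

Lemma bop_dense_eq {U V : HilbertSpace} (W : U -> Prop) (S T : Bop U V) :
  (forall (x : U) (eps : posreal), exists f, W f /\ norm (minus f x) < eps) ->
  (forall f, W f -> S f = T f) -> S = T.
Proof.
  intros hW h; apply bop_ext; intro x; apply (norm_small_eq (V := V)); intros eps he.
  pose proof (op_norm_ge_0 S) as s0; pose proof (op_norm_ge_0 T) as t0.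
  set (K := op_norm S + op_norm T + 1).
  assert (hd : 0 < eps / K) by (apply Rdiv_lt_0_compat; unfold K; lra).
  destruct (hW x (mkposreal _ hd)) as [f [wf hf]]; simpl in hf.
  assert (E : minus (S x) (T x) = minus (T (minus f x)) (S (minus f x))).
  { rewrite !bopB (h f wf); vec_in V. }
  assert (L : norm (minus (S x) (T x)) <= norm (T (minus f x)) + norm (S (minus f x))).
  { rewrite E; apply (norm_minus_le (V := V)). }
  pose proof (bop_le S (minus f x)); pose proof (bop_le T (minus f x)).
  pose proof (norm_ge_0 (minus f x)) as n0.
  eapply Rle_trans; [exact L|].
  apply Rle_trans with (K * (eps / K)); [|apply Req_le; field; unfold K; lra].
  apply Rle_trans with (K * norm (minus f x)).
  - unfold K; paths; lra.
  - apply Rmult_le_compat_l; [unfold K; lra | apply Rlt_le; exact hf].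
Qed.

Lemma punctured_open z0 r z : punctured z0 r z ->
  exists d, 0 < d /\ forall y, Cmod (Cminus y z) < d -> punctured z0 r y.
Proof.
  intros [h1 h2]; exists (Rmin (Cmod (Cminus z z0)) (r - Cmod (Cminus z z0))).
  split; [apply Rmin_pos; lra|]; intros y hy.
  pose proof (Rmin_l (Cmod (Cminus z z0)) (r - Cmod (Cminus z z0))).
  pose proof (Rmin_r (Cmod (Cminus z z0)) (r - Cmod (Cminus z z0))).
  pose proof (Cmod_triangle (Cminus y z) (Cminus z z0)) as T1.
  pose proof (Cmod_triangle (Cminus y z0) (Copp (Cminus y z))) as T2.
  rewrite Cmod_opp in T2.
  replace (Cplus (Cminus y z) (Cminus z z0)) with (Cminus y z0) in T1 by ring.
  replace (Cplus (Cminus y z0) (Copp (Cminus y z))) with (Cminus z z0) in T2 by ring.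
  split; lra.
Qed.

Lemma open_disc_punctured z0 r z : open_disc z0 r z -> z <> z0 -> punctured z0 r z.
Proof.
  intros h N; split; auto; apply Cmod_gt_0; intro E; apply N.
  transitivity (Cplus (Cminus z z0) z0); [ring | rewrite E; ring].
Qed.

(** Transfers regularity from an explicit family [F] to one defined by [epsilon], such as [op_inv]
    or [deriv_closure], which is known only off [z0]. At the other points of the disc the expansion
    has no negative powers. *)
Lemma fmero_family {H : HilbertSpace} (F F' : C -> Bop H H) z0 r : 0 < r ->
  (forall z, punctured z0 r z -> F' z = F z) ->
  (forall z, punctured z0 r z -> holo (V := Bop_NormedModule H H) F z) -> fmero F z0 ->
  analytic_on (V := Bop_NormedModule H H) F' (fun z => open_disc z0 r z /\ ~ z = z0) /\
  finitely_meromorphic_on F' (open_disc z0 r).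
Proof.
  intros hr E hF hm.
  assert (hF' : forall z, punctured z0 r z -> holo (V := Bop_NormedModule H H) F' z).
  { intros z hz; destruct (punctured_open z0 r z hz) as [d [hd hp]].
    apply (holo_ext (V := Bop_NormedModule H H) F F' z d); auto.
    intros y hy; symmetry; apply E; auto. }
  assert (an : analytic_on (V := Bop_NormedModule H H) F' (punctured z0 r)).
  { intros z hz; apply holo_ex_derive; auto. }
  assert (fm : forall z, open_disc z0 r z -> finitely_meromorphic_at F' z).
  { intros z hz; destruct (classic (z = z0)) as [->|N].
    - apply (fmero_finitely_meromorphic F' z0 r); auto.
      apply (fmero_ext F F' z0 r); auto; intros; symmetry; auto.
    - apply open_disc_punctured in hz; auto.
      destruct (punctured_open z0 r z hz) as [d [hd hp]].
      apply (fmero_finitely_meromorphic F' z d); auto.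
      + intros y [_ hy]; apply an; auto.
      + destruct (hF' z hz) as [a [a1 _]]; exists 0%nat, a; split; auto; lia. }
  split; [|split].
  - intros z [z1 z2]; apply an; now apply open_disc_punctured.
  - intros z hz; destruct (fm z hz) as [N [a [a1 _]]]; now exists N, a.
  - intros z hz _; auto.
Qed.

Lemma fmero_factor {H : HilbertSpace} (F : C -> Bop H H) w z0 : fmero F z0 ->
  fmero (fun z => bop_plus (bop_id H) (bop_scal (Cminus z w) (F z))) z0.
Proof.
  intro h; apply fmero_plus; [apply fmero_const|].
  apply (fmero_ext (fun z => bop_comp (bop_scal (Cminus z w) (bop_id H)) (F z)) _ z0 1); [lra| |].
  - intros; now apply bop_ext.
  - apply fmero_comp; auto; apply fmero_affine.
Qed.

Lemma holo_factor {H : HilbertSpace} (F : C -> Bop H H) w z :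
  holo (V := Bop_NormedModule H H) F z ->
  holo (V := Bop_NormedModule H H) (fun z => bop_plus (bop_id H) (bop_scal (Cminus z w) (F z))) z.
Proof.
  intro h; apply (holo_plus (V := Bop_NormedModule H H) (fun _ => bop_id H)); [apply holo_const|].
  apply (holo_ext (V := Bop_NormedModule H H) (fun z => bop_comp (bop_scal (Cminus z w) (bop_id H)) (F z)) _ z 1); [lra| |].
  - intros; now apply bop_ext.
  - apply holo_comp; auto.
    apply (holo_affine (V := Bop_NormedModule H H) w (bop_id H)).
Qed.

Section BoundaryTriple.

Context {H G : HilbertSpace} (S A0 : op H H) (Gamma0 Gamma1 : H -> G).
Context (hSdense : densely_defined S) (hA0 : self_adjoint A0)
  (hG : boundary_triple S Gamma0 Gamma1)
  (hA0G : op_eq A0 (op_restr (adjoint S) (fun f => Gamma0 f = zero))).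

Local Notation D := (dom (adjoint S)).
Local Notation R0 := (resolvent A0).

Lemma adjoint_plus f g : D f -> D g ->
  D (plus f g) /\ adjoint S (plus f g) = plus (adjoint S f) (adjoint S g).
Proof.
  intros df dg; apply adjoint_intro; auto; intros h dh.
  by rewrite !inner_plus_r !(adjointP S).
Qed.

Lemma adjoint_scal (k : C) f : D f ->
  D (@scal C_Ring H k f) /\ adjoint S (@scal C_Ring H k f) = @scal C_Ring H k (adjoint S f).
Proof.
  intros df; apply adjoint_intro; auto; intros h dh.
  by rewrite !inner_scal_r !(adjointP S).
Qed.

Lemma adjoint_minus f g : D f -> D g ->
  D (minus f g) /\ adjoint S (minus f g) = minus (adjoint S f) (adjoint S g).
Proof.
  intros df dg; destruct (adjoint_scal (RtoC (-1)) g dg) as [d1 e1].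
  destruct (adjoint_plus f _ df d1) as [d2 e2].
  rewrite (_ : minus f g = plus f (@scal C_Ring H (RtoC (-1)) g)); [|vec_in H].
  split; auto; rewrite e2 e1; vec_in H.
Qed.

Lemma boundary_map_lin (Gm : H -> G) : linear_op (mkOp D Gm) ->
  (forall f g, D f -> D g -> Gm (plus f g) = plus (Gm f) (Gm g)) /\
  (forall (k : C) f, D f -> Gm (@scal C_Ring H k f) = @scal C_Ring G k (Gm f)) /\
  (forall f g, D f -> D g -> Gm (minus f g) = minus (Gm f) (Gm g)).
Proof.
  intros [_ [hp hs]].
  assert (P : forall f g, D f -> D g -> Gm (plus f g) = plus (Gm f) (Gm g)).
  { intros f g df dg; apply (hp f g df dg). }
  assert (Q : forall (k : C) f, D f -> Gm (@scal C_Ring H k f) = @scal C_Ring G k (Gm f)).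
  { intros k f df; apply (hs k f df). }
  repeat split; auto; intros f g df dg.
  rewrite (_ : minus f g = plus f (@scal C_Ring H (RtoC (-1)) g)); [|vec_in H].
  rewrite P ?Q //; [vec_in G | now apply adjoint_scal].
Qed.

Let lin0 := boundary_map_lin Gamma0 (bt_linear0 _ _ _ hG).
Let lin1 := boundary_map_lin Gamma1 (bt_linear1 _ _ _ hG).

Lemma A0_dom f : dom A0 f <-> D f /\ Gamma0 f = zero.
Proof. apply hA0G. Qed.

Lemma A0_adjoint f : dom A0 f -> A0 f = adjoint S f.
Proof. intro df; now apply hA0G. Qed.

Lemma A0_conj z : resolvent_set A0 z -> resolvent_set A0 (Cconj z).
Proof.
  intro hz; destruct hA0 as [_ [hd [e1 e2]]].
  apply (resolvent_set_op_eq (adjoint A0)); [split|].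
  - intro f; symmetry; apply e1.
  - intros f df; symmetry; apply e2, e1, df.
  - now apply adjoint_resolvent_set.
Qed.

Lemma R0_boundary z h : resolvent_set A0 z ->
  D (R0 z h) /\ Gamma0 (R0 z h) = zero /\
  adjoint S (R0 z h) = plus h (@scal C_Ring H z (R0 z h)).
Proof.
  intro hz; pose proof (resolvent_dom A0 z h hz) as d.
  destruct (proj1 (A0_dom _) d) as [d1 d2]; repeat split; auto.
  rewrite -A0_adjoint // resolvent_r //.
Qed.

(** The difference lies in the kernel of [Gamma0], hence in the domain of [A0], where [A0 - z] is
    injective. *)
Lemma eigen_unique z f g : resolvent_set A0 z ->
  eigenspace (adjoint S) z f -> eigenspace (adjoint S) z g -> Gamma0 f = Gamma0 g -> f = g.
Proof.
  intros hz [df ef] [dg eg] E.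
  destruct (adjoint_minus f g df dg) as [d e].
  assert (da : dom A0 (minus f g)).
  { apply A0_dom; split; auto; rewrite (proj2 (proj2 lin0)) // E; vec_in G. }
  pose proof (resolvent_l A0 z _ hz da) as X; rewrite A0_adjoint // e ef eg in X.
  apply (minus_zero_eq (V := H)); rewrite -X.
  rewrite (_ : minus _ _ = zero); [exact (bop0 (R0 z)) | vec_in H].
Qed.

(** [S^* - z] maps [f] to [(w - z) f], and the added vector of the domain of [A0] compensates for
    this without changing [Gamma0]. The change of [Gamma1] is the source of the formula for
    [M(z) - M(w)]. *)
Lemma eigen_move z w f : resolvent_set A0 z -> eigenspace (adjoint S) w f ->
  let g := plus f (@scal C_Ring H (Cminus z w) (R0 z f)) in
  eigenspace (adjoint S) z g /\ Gamma0 g = Gamma0 f /\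
  Gamma1 g = plus (Gamma1 f) (@scal C_Ring G (Cminus z w) (Gamma1 (R0 z f))).
Proof.
  intros hz [df ef] g.
  destruct (R0_boundary z f hz) as [d1 [d2 d3]].
  destruct (adjoint_scal (Cminus z w) _ d1) as [d4 d5].
  destruct (adjoint_plus f _ df d4) as [d6 d7].
  repeat split; auto.
  - unfold g; rewrite d7 d5 d3 ef; vec_in H.
  - unfold g; rewrite (proj1 lin0) // (proj1 (proj2 lin0)) // d2; vec_in G.
  - unfold g; rewrite (proj1 lin1) // (proj1 (proj2 lin1)) //.
Qed.

(** Any vector with the prescribed value of [Gamma0] becomes an eigenvector after subtraction of a
    vector of the domain of [A0]. *)
Lemma eigen_exists z phi : resolvent_set A0 z ->
  exists f, eigenspace (adjoint S) z f /\ Gamma0 f = phi.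
Proof.
  intro hz; destruct (bt_onto _ _ _ hG phi zero) as [f [df [f0 _]]].
  set (h := minus (adjoint S f) (@scal C_Ring H z f)).
  destruct (R0_boundary z h hz) as [d1 [d2 d3]].
  destruct (adjoint_minus f _ df d1) as [d4 d5].
  exists (minus f (R0 z h)); repeat split; auto.
  - rewrite d5 d3; unfold h at 1; vec_in H.
  - rewrite (proj2 (proj2 lin0)) // f0 d2; vec_in G.
Qed.

(** Green's identity for [f] and [R0 (Cconj z) h]. It makes gamma(z) and X(conj z) formal adjoints
    of each other, as needed for their boundedness. *)
Lemma eigen_pairing z f h : resolvent_set A0 (Cconj z) -> eigenspace (adjoint S) z f ->
  inner f h = inner (Gamma0 f) (Gamma1 (R0 (Cconj z) h)).
Proof.
  intros hz [df ef]; destruct (R0_boundary (Cconj z) h hz) as [d1 [d2 d3]].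
  pose proof (bt_green _ _ _ hG f _ df d1) as E.
  rewrite ef d2 d3 inner_zero_r inner_scal_l inner_plus_r inner_scal_r Cconj_Cconj in E.
  set (a := inner f h) in *; set (b := inner (Gamma0 f) _) in *.
  transitivity (Copp (Cminus (RtoC 0) b)); [rewrite -E|]; ring.
Qed.

(** The symmetry of the Weyl function, M(conj z) being the adjoint of M(z), stated on
    eigenvectors. *)
Lemma eigen_symmetric z f g : eigenspace (adjoint S) z f -> eigenspace (adjoint S) (Cconj z) g ->
  inner (Gamma1 f) (Gamma0 g) = inner (Gamma0 f) (Gamma1 g).
Proof.
  intros [df ef] [dg eg]; pose proof (bt_green _ _ _ hG f g df dg) as E.
  rewrite ef eg inner_scal_l inner_scal_r Cconj_Cconj in E.
  set (a := inner (Gamma1 f) _) in *; set (b := inner (Gamma0 f) _) in *.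
  transitivity (Cplus (Cminus a b) b); [|rewrite -E]; ring.
Qed.

Lemma gamma_field_exists z : resolvent_set A0 z ->
  (exists Y : Bop G H, forall phi, eigenspace (adjoint S) z (Y phi) /\ Gamma0 (Y phi) = phi) /\
  (exists X : Bop H G, forall h, X h = Gamma1 (R0 z h)).
Proof.
  intro hz; pose proof (A0_conj z hz) as hz'.
  assert (sel : forall y, resolvent_set A0 y -> exists f : G -> H,
    forall phi, eigenspace (adjoint S) y (f phi) /\ Gamma0 (f phi) = phi).
  { intros y hy.
    exists (fun phi => proj1_sig (constructive_indefinite_description _ (eigen_exists y phi hy))).
    intro phi; exact (proj2_sig (constructive_indefinite_description _ (eigen_exists y phi hy))). }
  split.
  - destruct (sel z hz) as [f hf].
    destruct (hellinger_toeplitz G H f (fun h => Gamma1 (R0 (Cconj z) h))) as [Y hY].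
    + intros phi h; destruct (hf phi) as [e1 e2].
      by rewrite (eigen_pairing z _ h hz' e1) e2.
    + exists Y; intro phi; by rewrite hY.
  - destruct (sel (Cconj z) hz') as [f hf].
    destruct (hellinger_toeplitz H G (fun h => Gamma1 (R0 z h)) f) as [X hX].
    + intros h phi; destruct (hf phi) as [e1 e2].
      rewrite (inner_conj _ (f phi)) (eigen_pairing (Cconj z) _ h) ?Cconj_Cconj //.
      rewrite e2 -inner_conj //.
    + now exists X.
Qed.

Lemma weyl_eigen z f : resolvent_set A0 z -> eigenspace (adjoint S) z f ->
  weyl S Gamma0 Gamma1 z (Gamma0 f) = Gamma1 f.
Proof.
  intros hz hf; simpl.
  set (Q := fun g => eigenspace (adjoint S) z g /\ Gamma0 g = Gamma0 f).
  assert (ex : exists g, Q g) by now exists f.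
  pose proof (epsilon_spec (inhabits zero) Q ex) as [e1 e2].
  f_equal; now apply (eigen_unique z).
Qed.

Lemma weyl_dom z phi : resolvent_set A0 z -> dom (weyl S Gamma0 Gamma1 z) phi.
Proof. intro hz; exact (eigen_exists z phi hz). Qed.

Section Extension.

Context (B : op H H) (Theta : op G G).
Context (hTheta : linear_op Theta) (hBT : op_eq B (boundary_restr S Gamma0 Gamma1 Theta)).

Lemma B_boundary z h : resolvent_set B z ->
  let f := resolvent B z h in
  D f /\ dom Theta (Gamma0 f) /\ Gamma1 f = Theta (Gamma0 f) /\
  adjoint S f = plus h (@scal C_Ring H z f).
Proof.
  intros hz f; pose proof (resolvent_dom B z h hz) as d; fold f in d.
  destruct (proj1 (proj1 hBT f) d) as [d1 [d2 d3]]; repeat split; auto.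
  assert (E : B f = adjoint S f) by exact (proj2 hBT f d).
  transitivity (B f); [symmetry; exact E | now apply resolvent_r].
Qed.

(** Surjectivity of [Theta - M(z)]. A vector [f0] with boundary values [0] and [chi] is subtracted
    from the vector [g] of the domain of [B] for which [g - f0] is an eigenvector; [g] satisfies the
    boundary condition, so exactly [chi] is left over. *)
Lemma theta_solve z chi : resolvent_set B z ->
  exists f, eigenspace (adjoint S) z f /\ dom Theta (Gamma0 f) /\
    minus (Theta (Gamma0 f)) (Gamma1 f) = chi.
Proof.
  intro hz; destruct (bt_onto _ _ _ hG zero chi) as [f0 [df0 [e0 e1]]].
  destruct (B_boundary z (minus (adjoint S f0) (@scal C_Ring H z f0)) hz) as [d1 [d2 [d3 d4]]].
  set (g := resolvent B z _) in *.
  destruct (adjoint_minus g f0 d1 df0) as [d5 d6].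
  assert (g0 : Gamma0 (minus g f0) = Gamma0 g).
  { rewrite (proj2 (proj2 lin0)) // e0; vec_in G. }
  exists (minus g f0); repeat split; auto.
  - rewrite d6 d4; vec_in H.
  - by rewrite g0.
  - rewrite g0 (proj2 (proj2 lin1)) // e1 d3; vec_in G.
Qed.

(** By linearity of [Theta] the difference satisfies the boundary condition of [B], and [B - z] is
    injective. *)
Lemma theta_injective z f g : resolvent_set A0 z -> resolvent_set B z ->
  eigenspace (adjoint S) z f -> eigenspace (adjoint S) z g ->
  dom Theta (Gamma0 f) -> dom Theta (Gamma0 g) ->
  minus (Theta (Gamma0 f)) (Gamma1 f) = minus (Theta (Gamma0 g)) (Gamma1 g) -> f = g.
Proof.
  intros hz hb [df ef] [dg eg] tf tg E.
  destruct (adjoint_minus f g df dg) as [d e].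
  destruct (op_minus_lin Theta hTheta _ _ tf tg) as [td te].
  assert (q : Gamma0 (minus f g) = minus (Gamma0 f) (Gamma0 g)) by now apply lin0.
  assert (db : dom B (minus f g)).
  { apply hBT; split; [exact d|]; rewrite q; split; [exact td|].
    rewrite te (proj2 (proj2 lin1)) //.
    apply (minus_zero_eq (V := G)).
    transitivity (minus (minus (Theta (Gamma0 g)) (Gamma1 g)) (minus (Theta (Gamma0 f)) (Gamma1 f)));
      [|rewrite E]; vec_in G. }
  pose proof (resolvent_l B z _ hb db) as X.
  assert (EB : B (minus f g) = adjoint S (minus f g)) by exact (proj2 hBT _ db).
  rewrite EB e ef eg in X.
  apply (minus_zero_eq (V := H)); rewrite -X.
  rewrite (_ : minus _ _ = zero); [exact (bop0 (resolvent B z)) | vec_in H].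
Qed.

End Extension.

(** * Krein's formula and the index for one extension *)

Section KreinFormula.

Context (B : op H H) (Theta : op G G).
Context (hB : linear_op B) (hTheta : linear_op Theta) (hBT : op_eq B (boundary_restr S Gamma0 Gamma1 Theta)).

(** Pointwise solutions exist for [Theta] at [w] and for its adjoint at the conjugate of [w]. By
    [eigen_symmetric] these two inverses are formal adjoints of each other, hence bounded. *)
Lemma theta_inverse_exists w (Y : Bop G H) :
  densely_defined B -> densely_defined Theta -> linear_op (adjoint Theta) ->
  op_eq (adjoint B) (boundary_restr S Gamma0 Gamma1 (adjoint Theta)) ->
  resolvent_set A0 w -> resolvent_set B w ->
  (forall phi, eigenspace (adjoint S) w (Y phi) /\ Gamma0 (Y phi) = phi) ->
  exists L : Bop G G, forall chi, dom Theta (L chi) /\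
    minus (Theta (L chi)) (Gamma1 (Y (L chi))) = chi.
Proof.
  intros hBd hTd hT' hBT' hwA hwB hY.
  assert (hwB' := adjoint_resolvent_set B w hBd hwB).
  pose (f := fun chi => proj1_sig (constructive_indefinite_description _
    (theta_solve B Theta hBT w chi hwB))).
  assert (hf : forall chi, eigenspace (adjoint S) w (f chi) /\ dom Theta (Gamma0 (f chi)) /\
    minus (Theta (Gamma0 (f chi))) (Gamma1 (f chi)) = chi).
  { intro chi; exact (proj2_sig (constructive_indefinite_description _
      (theta_solve B Theta hBT w chi hwB))). }
  pose (g := fun chi => proj1_sig (constructive_indefinite_description _
    (theta_solve (adjoint B) (adjoint Theta) hBT' (Cconj w) chi hwB'))).
  assert (hg : forall chi, eigenspace (adjoint S) (Cconj w) (g chi) /\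
    dom (adjoint Theta) (Gamma0 (g chi)) /\
    minus (adjoint Theta (Gamma0 (g chi))) (Gamma1 (g chi)) = chi).
  { intro chi; exact (proj2_sig (constructive_indefinite_description _
      (theta_solve (adjoint B) (adjoint Theta) hBT' (Cconj w) chi hwB'))). }
  clearbody f g.
  destruct (hellinger_toeplitz G G (fun chi => Gamma0 (f chi)) (fun chi => Gamma0 (g chi))) as [L hL].
  - intros x y; destruct (hf x) as [f1 [f2 f3]], (hg y) as [g1 [g2 g3]].
    rewrite -{1}g3 -{2}f3 inner_minus_l inner_minus_r.
    by rewrite (adjointP Theta _ _ g2 f2) (eigen_symmetric w _ _ f1 g1).
  - exists L; intro chi; destruct (hf chi) as [f1 [f2 f3]], (hY (L chi)) as [y1 y2].
    rewrite hL in y1 y2 |- *; split; auto.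
    by rewrite (eigen_unique w _ _ hwA y1 f1 y2).
Qed.

(** The bounded operator [(T - w) (T - z)^-1], which carries objects from the point w to the point
    z. *)
Definition resolvent_factor (T : op H H) (w z : C) : Bop H H :=
  bop_plus (bop_id H) (bop_scal (Cminus z w) (resolvent T z)).

Context (w : C) (hwA : resolvent_set A0 w) (hwB : resolvent_set B w).
Context (Y : Bop G H) (hY : forall phi, eigenspace (adjoint S) w (Y phi) /\ Gamma0 (Y phi) = phi).
Context (X : Bop H G) (hX : forall h, X h = Gamma1 (R0 w h)).
Context (L : Bop G G) (hL : forall chi, dom Theta (L chi) /\
  minus (Theta (L chi)) (Gamma1 (Y (L chi))) = chi).

(** [Yz], [Xz] and [Lz] are gamma(z), X(z) and L(z). [YL] and [LX] are gamma(z) L(z) and L(z) X(z),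
    expressed by the resolvent of [B] alone. The formula for [Lz] results from applying [Gamma0] to
    [YL z chi], since [Gamma0 (B - z)^-1] is [LX z]. *)
Let EA := resolvent_factor A0 w.
Let EB := resolvent_factor B w.
Let M z := weyl S Gamma0 Gamma1 z.
Let N z := op_minus Theta (M z).
Let Yz z : Bop G H := bop_comp (EA z) Y.
Let Xz z : Bop H G := bop_comp X (EA z).
Let YL z : Bop G H := bop_comp (EB z) (bop_comp Y L).
Let LX z : Bop H G := bop_comp (bop_comp L X) (EB z).
Let Lz z : Bop G G := bop_plus L (bop_scal (Cminus z w) (bop_comp (LX z) (bop_comp Y L))).

Lemma Yz_eigen z phi : resolvent_set A0 z ->
  eigenspace (adjoint S) z (Yz z phi) /\ Gamma0 (Yz z phi) = phi.
Proof.
  intro hz; destruct (hY phi) as [y1 y2].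
  destruct (eigen_move z w (Y phi) hz y1) as [e1 [e2 _]].
  split; [exact e1 | etransitivity; [exact e2 | exact y2]].
Qed.

Lemma Yz_unique z f : resolvent_set A0 z -> eigenspace (adjoint S) z f -> Yz z (Gamma0 f) = f.
Proof.
  intros hz hf; destruct (Yz_eigen z (Gamma0 f) hz) as [y1 y2]; now apply (eigen_unique z).
Qed.

Lemma Xz_eq z h : resolvent_set A0 z -> Xz z h = Gamma1 (R0 z h).
Proof.
  intro hz; unfold Xz, EA, resolvent_factor; cbn [bop_comp bop_fun]; rewrite hX; f_equal.
  pose proof (f_equal (fun T : Bop H H => T h) (resolvent_identity A0 z w hz hwA)) as E; simpl in E.
  rewrite E; simpl; by rewrite bopD bopZ.
Qed.

(** Eigenvectors at [z] are moved to [y] with the same [Gamma0]; the change of [Gamma1] is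
    [(y - z) X(y) gamma(z)]. *)
Lemma weyl_diff y z phi : resolvent_set A0 y -> resolvent_set A0 z ->
  M y phi = plus (M z phi) (@scal C_Ring G (Cminus y z) (Xz y (Yz z phi))).
Proof.
  intros hy hz; destruct (Yz_eigen z phi hz) as [y1 y2].
  destruct (eigen_move y z (Yz z phi) hy y1) as [e1 [e2 e3]].
  rewrite y2 in e2; unfold M.
  rewrite -{1}e2 weyl_eigen // e3 Xz_eq //.
  rewrite -{3}y2 weyl_eigen //.
Qed.

(** At w, the difference of the two resolvents is an eigenvector on which [Theta Gamma0 - Gamma1]
    equals [X k], so it is the one produced by [L]. The resolvent identity of [B] extends the
    equality to z. *)
Lemma LX_eq z h : resolvent_set B z -> LX z h = Gamma0 (resolvent B z h).
Proof.
  intro hz.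
  assert (at_w : forall k, L (X k) = Gamma0 (resolvent B w k)).
  { intro k; destruct (B_boundary B Theta hBT w k hwB) as [d1 [d2 [d3 d4]]].
    destruct (R0_boundary w k hwA) as [a1 [a2 a3]].
    destruct (adjoint_minus _ _ d1 a1) as [m1 m2].
    set (f := minus (resolvent B w k) (R0 w k)) in *.
    assert (f0 : Gamma0 f = Gamma0 (resolvent B w k)).
    { unfold f; rewrite (proj2 (proj2 lin0)) // a2; vec_in G. }
    assert (f1 : Gamma1 f = minus (Gamma1 (resolvent B w k)) (X k)).
    { unfold f; rewrite (proj2 (proj2 lin1)) // hX //. }
    assert (fe : eigenspace (adjoint S) w f).
    { split; [exact m1|]; rewrite m2 d4 a3; unfold f; vec_in H. }
    destruct (hL (X k)) as [l1 l2], (hY (L (X k))) as [y1 y2].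
    rewrite -f0 -y2; f_equal; apply (theta_injective B Theta hTheta hBT w); auto.
    - by rewrite y2.
    - by rewrite f0.
    - rewrite y2 l2 f0 f1 d3; vec_in G. }
  unfold LX, EB, resolvent_factor; cbn [bop_comp bop_fun]; rewrite at_w; f_equal.
  pose proof (f_equal (fun T : Bop H H => T h) (resolvent_identity B z w hz hwB)) as E; simpl in E.
  rewrite E; simpl; by rewrite bopD bopZ.
Qed.

(** The move of [eigen_move] with [B] in place of [A0]: the added vector satisfies the boundary
    condition of [B], so the value [chi] of [Theta Gamma0 - Gamma1] is kept while the eigenvalue
    changes from w to z. *)
Lemma YL_eigen z chi : resolvent_set B z ->
  let f := YL z chi in
  eigenspace (adjoint S) z f /\ Gamma0 f = Lz z chi /\ dom Theta (Gamma0 f) /\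
  minus (Theta (Gamma0 f)) (Gamma1 f) = chi.
Proof.
  intros hz f; set (h := Y (L chi)).
  destruct (hY (L chi)) as [[y1 y2] y3], (hL chi) as [l1 l2]; fold h in y1, y2, y3, l2.
  destruct (B_boundary B Theta hBT z h hz) as [d1 [d2 [d3 d4]]].
  destruct (adjoint_scal (Cminus z w) _ d1) as [s1 s2].
  destruct (adjoint_plus h _ y1 s1) as [p1 p2].
  assert (fE : f = plus h (@scal C_Ring H (Cminus z w) (resolvent B z h))) by reflexivity.
  assert (f0 : Gamma0 f = plus (L chi) (@scal C_Ring G (Cminus z w) (Gamma0 (resolvent B z h)))).
  { rewrite fE (proj1 lin0) // (proj1 (proj2 lin0)) // y3 //. }
  destruct hTheta as [_ [tp ts]].
  destruct (ts (Cminus z w) _ d2) as [t1 t2]; destruct (tp _ _ l1 t1) as [t3 t4].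
  repeat split.
  - by rewrite fE.
  - rewrite fE p2 s2 d4 y2; vec_in H.
  - rewrite f0 -LX_eq //.
  - by rewrite f0.
  - rewrite f0 t4 t2 -d3 fE (proj1 lin1) // (proj1 (proj2 lin1)) // -{2}l2; vec_in G.
Qed.

Lemma N_inverse z : resolvent_set A0 z -> resolvent_set B z -> is_inverse (N z) (Lz z).
Proof.
  intros hz hb.
  assert (sur : forall chi, dom (N z) (Lz z chi) /\ N z (Lz z chi) = chi).
  { intro chi; destruct (YL_eigen z chi hb) as [e1 [e2 [e3 e4]]].
    rewrite -e2; split; [split; [exact e3 | now apply weyl_dom]|].
    transitivity (minus (Theta (Gamma0 (YL z chi))) (M z (Gamma0 (YL z chi)))); [reflexivity|].
    unfold M; rewrite weyl_eigen //. }
  split; auto; intros phi [dphi _].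
  destruct (Yz_eigen z phi hz) as [y1 y2].
  destruct (YL_eigen z (N z phi) hb) as [e1 [e2 [e3 e4]]].
  rewrite -e2 -{2}y2; f_equal; apply (theta_injective B Theta hTheta hBT z); auto; rewrite ?y2 //.
  rewrite e4 -(weyl_eigen z) // y2 //.
Qed.

Lemma YL_eq z chi : resolvent_set A0 z -> resolvent_set B z -> Yz z (Lz z chi) = YL z chi.
Proof.
  intros hz hb; destruct (YL_eigen z chi hb) as [e1 [e2 _]].
  rewrite -e2; now apply Yz_unique.
Qed.

Lemma krein z h : resolvent_set A0 z -> resolvent_set B z ->
  Yz z (LX z h) = minus (resolvent B z h) (R0 z h).
Proof.
  intros hz hb; rewrite LX_eq //.
  destruct (B_boundary B Theta hBT z h hb) as [d1 [d2 [d3 d4]]].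
  destruct (R0_boundary z h hz) as [a1 [a2 a3]].
  destruct (adjoint_minus _ _ d1 a1) as [m1 m2].
  rewrite (_ : Gamma0 (resolvent B z h) = Gamma0 (minus (resolvent B z h) (R0 z h))).
  - apply Yz_unique; auto; split; auto; rewrite m2 d4 a3; vec_in H.
  - rewrite (proj2 (proj2 lin0)) // a2; vec_in G.
Qed.

Lemma LzXz z h : resolvent_set A0 z -> resolvent_set B z -> Lz z (Xz z h) = LX z h.
Proof.
  intros hz hb; destruct (B_boundary B Theta hBT z h hb) as [d1 [d2 [d3 d4]]].
  destruct (R0_boundary z h hz) as [a1 [a2 a3]].
  destruct (adjoint_minus _ _ d1 a1) as [m1 m2].
  set (f := minus (resolvent B z h) (R0 z h)) in *.
  assert (f0 : Gamma0 f = Gamma0 (resolvent B z h)).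
  { unfold f; rewrite (proj2 (proj2 lin0)) // a2; vec_in G. }
  assert (f1 : Gamma1 f = minus (Gamma1 (resolvent B z h)) (Xz z h)).
  { unfold f; rewrite (proj2 (proj2 lin1)) // Xz_eq //. }
  assert (fe : eigenspace (adjoint S) z f).
  { split; [exact m1|]; rewrite m2 d4 a3; unfold f; vec_in H. }
  rewrite LX_eq // -f0.
  destruct (N_inverse z hz hb) as [n1 _].
  rewrite -(n1 (Gamma0 f)); [f_equal | split; [by rewrite f0 | now apply weyl_dom]].
  transitivity (minus (Theta (Gamma0 f)) (M z (Gamma0 f))); [|reflexivity].
  unfold M; rewrite weyl_eigen // f1 f0 d3; vec_in G.
Qed.

Context (hTd : densely_defined Theta) (z0 : C) (r : R) (hr : 0 < r).
Context (hzA : forall z, punctured z0 r z -> resolvent_set A0 z)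
  (hzB : forall z, punctured z0 r z -> resolvent_set B z).

(** The derivative [-M'(z)], suggested by [weyl_diff] as the two points merge. *)
Let Dz z : Bop G G := bop_scal (RtoC (-1)) (bop_comp (Xz z) (Yz z)).

Lemma holo_EA z : punctured z0 r z -> holo (V := Bop_NormedModule H H) EA z.
Proof. intro hz; apply (holo_factor R0); apply resolvent_holo; auto. Qed.

Lemma holo_EB z : punctured z0 r z -> holo (V := Bop_NormedModule H H) EB z.
Proof. intro hz; apply (holo_factor (resolvent B)); apply resolvent_holo; auto. Qed.

Lemma holo_Xz z : punctured z0 r z -> holo (V := Bop_NormedModule H G) Xz z.
Proof.
  intro hz; apply (holo_comp (fun _ => X) EA); [|now apply holo_EA].
  apply (holo_const (V := Bop_NormedModule H G)).
Qed.

Lemma holo_Dz z : punctured z0 r z -> holo (V := Bop_NormedModule G G) Dz z.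
Proof.
  intro hz.
  apply (holo_ext (V := Bop_NormedModule G G) (fun z => bop_comp (bop_scal (RtoC (-1)) (bop_id G))
    (bop_comp (Xz z) (Yz z))) _ z 1); [lra | intros; now apply bop_ext|].
  apply (holo_comp (fun _ => bop_scal (RtoC (-1)) (bop_id G)) (fun z => bop_comp (Xz z) (Yz z)));
    [apply (holo_const (V := Bop_NormedModule G G))|].
  apply (holo_comp Xz Yz); [now apply holo_Xz|].
  apply (holo_comp EA (fun _ => Y)); [now apply holo_EA | apply (holo_const (V := Bop_NormedModule G H))].
Qed.

Lemma holo_Lz z : punctured z0 r z -> holo (V := Bop_NormedModule G G) Lz z.
Proof.
  intro hz; apply (holo_plus (V := Bop_NormedModule G G) (fun _ => L));
    [apply (holo_const (V := Bop_NormedModule G G))|].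
  apply (holo_ext (V := Bop_NormedModule G G) (fun z => bop_comp (bop_scal (Cminus z w) (bop_id G))
    (bop_comp (LX z) (bop_comp Y L))) _ z 1); [lra | intros; now apply bop_ext|].
  apply (holo_comp (fun z => bop_scal (Cminus z w) (bop_id G)) (fun z => bop_comp (LX z) (bop_comp Y L)));
    [apply (holo_affine (V := Bop_NormedModule G G) w (bop_id G))|].
  apply (holo_comp LX (fun _ => bop_comp Y L)); [|apply (holo_const (V := Bop_NormedModule G H))].
  apply (holo_comp (fun _ => bop_comp L X) EB); [apply (holo_const (V := Bop_NormedModule H G))|].
  now apply holo_EB.
Qed.

(** The difference quotient involves [X(y) gamma(z)]; replacing [X(y)] by [X(z)] costs a term of
    order [y - z], so the remainder is quadratic. *)
Lemma N_deriv z : punctured z0 r z -> is_deriv_closure N z (Dz z).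
Proof.
  intros hz phi _.
  destruct (punctured_open z0 r z hz) as [d [hd hp]].
  destruct (holo_bound _ _ (holo_Xz z hz)) as [l [K [d' [hd' [hK hb]]]]].
  apply (is_derive_quadratic G _ z _ (K * norm (Yz z phi)) (Rmin d d')); [now apply Rmin_pos|].
  intros y hy.
  assert (hyd : Cmod (Cminus y z) < d) by (eapply Rlt_le_trans; [exact hy | apply Rmin_l]).
  destruct (hb y) as [b _]; [eapply Rlt_le_trans; [exact hy | apply Rmin_r]|].
  change (op_norm (minus (Xz y) (Xz z)) <= K * Cmod (Cminus y z)) in b.
  pose proof (weyl_diff y z phi (hzA y (hp y hyd)) (hzA z hz)) as E.
  change (norm (minus (minus (minus (Theta phi) (M y phi)) (minus (Theta phi) (M z phi)))
    (@scal C_Ring G (Cminus y z) (@scal C_Ring G (RtoC (-1)) (Xz z (Yz z phi))))) <=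
    K * norm (Yz z phi) * Cmod (Cminus y z) ^ 2).
  rewrite E.
  rewrite (_ : minus _ _ = @scal C_Ring G (Copp (Cminus y z)) (minus (Xz y (Yz z phi)) (Xz z (Yz z phi)))); [|vec_in G].
  rewrite (norm_scal_eq (V := G)) Cmod_opp.
  pose proof (bop_le (minus (Xz y) (Xz z)) (Yz z phi)) as b2.
  change (norm (minus (Xz y (Yz z phi)) (Xz z (Yz z phi))) <=
    op_norm (minus (Xz y) (Xz z)) * norm (Yz z phi)) in b2.
  replace (K * norm (Yz z phi) * Cmod (Cminus y z) ^ 2) with
    (Cmod (Cminus y z) * (K * Cmod (Cminus y z) * norm (Yz z phi))) by ring.
  apply Rmult_le_compat_l; [apply Cmod_ge_0|].
  eapply Rle_trans; [exact b2|]; apply Rmult_le_compat_r; [apply norm_ge_0 | exact b].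
Qed.

Lemma N_dom z phi : punctured z0 r z -> dom (N z) phi <-> dom Theta phi.
Proof.
  intro hz; split; [now intros [d _]|]; intro d; split; auto; apply weyl_dom; auto.
Qed.

Lemma N_deriv_closure z : punctured z0 r z -> deriv_closure N z = Dz z.
Proof.
  intro hz; pose proof (N_deriv z hz) as h.
  assert (h' : is_deriv_closure N z (deriv_closure N z)).
  { unfold deriv_closure; apply epsilon_spec; now exists (Dz z). }
  apply (bop_dense_eq (dom Theta)); [exact hTd|]; intros phi d.
  apply (N_dom z) in d; auto.
  exact (is_derive_unique_C _ z _ _ (h' phi d) (h phi d)).
Qed.

Lemma N_op_inv z : punctured z0 r z -> op_inv (N z) = Lz z.
Proof. intro hz; apply op_inv_unique, N_inverse; auto. Qed.

Context (fA : fmero R0 z0) (fB : fmero (resolvent B) z0).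

Lemma fmero_Xz : fmero Xz z0.
Proof.
  apply (fmero_comp (fun _ => X) EA); [apply fmero_const | now apply (fmero_factor R0)].
Qed.

Lemma fmero_Yz : fmero Yz z0.
Proof.
  apply (fmero_comp EA (fun _ => Y)); [now apply (fmero_factor R0) | apply fmero_const].
Qed.

Lemma fmero_YL : fmero YL z0.
Proof.
  apply (fmero_comp EB (fun _ => bop_comp Y L));
    [now apply (fmero_factor (resolvent B)) | apply fmero_const].
Qed.

Lemma fmero_LX : fmero LX z0.
Proof.
  apply (fmero_comp (fun _ => bop_comp L X) EB);
    [apply fmero_const | now apply (fmero_factor (resolvent B))].
Qed.

Lemma index_conditions_extension :
  index_conditions N (open_disc z0 r) (fun z => z = z0).
Proof.
  assert (fD : fmero Dz z0).
  { apply fmero_scal, fmero_comp; [exact fmero_Xz | exact fmero_Yz]. }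
  assert (fL : fmero Lz z0).
  { apply (fmero_plus (fun _ => L)); [apply fmero_const|].
    apply (fmero_ext (fun z => bop_comp (bop_scal (Cminus z w) (bop_id G)) (bop_comp (LX z) (bop_comp Y L)))
      _ z0 1); [lra | intros; now apply bop_ext|].
    apply fmero_comp; [apply fmero_affine|].
    apply (fmero_comp LX (fun _ => bop_comp Y L)); [exact fmero_LX | apply fmero_const]. }
  destruct (fmero_family Lz (fun z => op_inv (N z)) z0 r hr N_op_inv holo_Lz fL) as [c1 c2].
  destruct (fmero_family Dz (deriv_closure N) z0 r hr N_deriv_closure holo_Dz fD) as [e1 e2].
  assert (inv : forall z, punctured z0 r z -> is_inverse (N z) (Lz z)).
  { intros z hz; apply N_inverse; auto. }
  split; auto.
  - intros z h1 h2; pose proof (open_disc_punctured z0 r z h1 h2) as hz.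
    split; [now apply (is_inverse_linear _ (Lz z)), inv|].
    split; [|now apply (is_inverse_closed _ (Lz z)), inv].
    intros x eps; destruct (hTd x eps) as [f [df hf]]; exists f; split; auto.
    now apply N_dom.
  - exists (dom Theta); intros z h1 h2 f; apply N_dom; now apply open_disc_punctured.
  - intros z h1 h2; exists (Lz z); apply inv; now apply open_disc_punctured.
  - intros phi hphi z [h1 h2]; exists (Dz z phi).
    apply (N_deriv z (open_disc_punctured z0 r z h1 h2)); auto.
  - intros z h1 h2; exists (Dz z); apply N_deriv; now apply open_disc_punctured.
Qed.

Lemma index_extension a b : rtrace R0 z0 a -> rtrace (resolvent B) z0 b ->
  exists e, 0 < e /\ forall eps, 0 < eps < e -> is_index N z0 eps (Cminus a b).
Proof.
  intros ha hb.
  assert (hd : rtrace (fun z => bop_plus (resolvent B z) (bop_scal (RtoC (-1)) (R0 z))) z0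
    (Cplus b (Cmult (RtoC (-1)) a))).
  { now apply rtrace_plus; [|apply rtrace_scal]. }
  assert (key : forall F : C -> Bop H H, (forall z h, punctured z0 r z -> F z h = minus (resolvent B z h) (R0 z h)) ->
    forall t, rtrace F z0 t -> Cmult (RtoC (-1)) t = Cminus a b).
  { intros F hF t ht.
    rewrite (rtrace_unique F z0 t (Cplus b (Cmult (RtoC (-1)) a))); auto.
    - unfold Cmult, Cminus, Cplus, Copp, RtoC; simpl; f_equal; ring.
    - apply (rtrace_ext (fun z => bop_plus (resolvent B z) (bop_scal (RtoC (-1)) (R0 z))) F z0 r); auto.
      intros z hz; apply bop_ext; intro h; rewrite hF //; simpl; vec_in H. }
  (* The triple products are grouped so that exchanging the two factors gives gamma L X in both
     cases, an operator in [H] known from Krein's formula. *)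
  destruct (rtrace_cyclic Xz YL z0 fmero_Xz fmero_YL) as [t [t1 t2]].
  destruct (rtrace_cyclic LX Yz z0 fmero_LX fmero_Yz) as [s [s1 s2]].
  assert (et : Cmult (RtoC (-1)) t = Cminus a b).
  { apply (key (fun z => bop_comp (YL z) (Xz z))); auto; intros z h hz.
    change (YL z (Xz z h) = minus (resolvent B z h) (R0 z h)).
    rewrite -YL_eq ?LzXz ?krein; auto. }
  assert (es : Cmult (RtoC (-1)) s = Cminus a b).
  { apply (key (fun z => bop_comp (Yz z) (LX z))); auto; intros z h hz; apply krein; auto. }
  apply (rtrace_scal (RtoC (-1))) in t1, s1; rewrite et in t1; rewrite es in s1.
  apply (rtrace_ext _ (fun z => bop_comp (deriv_closure N z) (op_inv (N z))) z0 r) in t1; auto.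
  2: { intros z hz; rewrite N_deriv_closure // N_op_inv //; apply bop_ext; intro x.
    change (@scal C_Ring G (RtoC (-1)) (Xz z (YL z x)) = @scal C_Ring G (RtoC (-1)) (Xz z (Yz z (Lz z x)))).
    rewrite YL_eq; auto. }
  apply (rtrace_ext _ (fun z => bop_comp (op_inv (N z)) (deriv_closure N z)) z0 r) in s1; auto.
  2: { intros z hz; rewrite N_deriv_closure // N_op_inv //; apply bop_ext; intro x.
    change (@scal C_Ring G (RtoC (-1)) (LX z (Yz z x)) = Lz z (@scal C_Ring G (RtoC (-1)) (Xz z (Yz z x)))).
    rewrite bopZ LzXz; auto. }
  destruct (rtrace_residue _ _ _ t1) as [r1 [r1p h1]], (rtrace_residue _ _ _ s1) as [r2 [r2p h2]].
  exists (Rmin r1 r2); split; [now apply Rmin_pos|]; intros eps he.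
  pose proof (Rmin_l r1 r2); pose proof (Rmin_r r1 r2).
  split; [apply h1 | apply h2]; lra.
Qed.

End KreinFormula.

Lemma index_theta (B : op H H) (Theta : op G G) z0 r :
  0 < r -> dd_closed B -> dd_closed Theta -> linear_op (adjoint Theta) ->
  op_eq B (boundary_restr S Gamma0 Gamma1 Theta) ->
  op_eq (adjoint B) (boundary_restr S Gamma0 Gamma1 (adjoint Theta)) ->
  (forall z, punctured z0 r z -> resolvent_set A0 z) ->
  (forall z, punctured z0 r z -> resolvent_set B z) ->
  fmero R0 z0 -> fmero (resolvent B) z0 ->
  let N z := op_minus Theta (weyl S Gamma0 Gamma1 z) in
  index_conditions N (open_disc z0 r) (fun z => z = z0) /\
  forall a b, rtrace R0 z0 a -> rtrace (resolvent B) z0 b ->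
    exists e, 0 < e /\ forall eps, 0 < eps < e -> is_index N z0 eps (Cminus a b).
Proof.
  intros hr [lB [dB _]] [lT [dT _]] lT' hBT hBT' hzA hzB fA fB N.
  (* An arbitrary base point of the punctured disc, regular for both [A0] and [B]. *)
  set (w := Cplus z0 (RtoC (r / 2))).
  assert (hw : punctured z0 r w).
  { unfold punctured, w; replace (Cminus (Cplus z0 (RtoC (r / 2))) z0) with (RtoC (r / 2)) by ring.
    rewrite Cmod_R Rabs_right; lra. }
  destruct (gamma_field_exists w (hzA w hw)) as [[Y hY] [X hX]].
  destruct (theta_inverse_exists B Theta hBT w Y) as [L hL]; auto.
  split.
  - apply (index_conditions_extension B Theta) with (w := w) (Y := Y) (X := X) (L := L); auto.
  - intros a b; apply (index_extension B Theta) with (w := w) (Y := Y) (X := X) (L := L) (r := r); auto.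
Qed.

End BoundaryTriple.

Theorem theorem4p3 (H G : HilbertSpace)
  (B1 B2 S A0 : op H H) (Gamma0 Gamma1 : H -> G) (Theta1 Theta2 : op G G) (z0 : C)
  (hsep : separable H)
  (hB1 : dd_closed B1) (hB2 : dd_closed B2)
  (hrho : exists z, resolvent_set B1 z /\ resolvent_set B2 z)
  (hS : op_eq S (op_inter B1 B2))
  (hSdense : densely_defined S) (hSsymm : symmetric S) (hSdef : equal_deficiency S)
  (hA0 : self_adjoint A0) (hSA0 : op_ext S A0)
  (hSB1 : op_eq S (op_inter A0 B1)) (hSB2 : op_eq S (op_inter A0 B2))
  (hSB1' : op_eq S (op_inter A0 (adjoint B1))) (hSB2' : op_eq S (op_inter A0 (adjoint B2)))
  (hG : boundary_triple S Gamma0 Gamma1)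
  (hT1 : dd_closed Theta1) (hT2 : dd_closed Theta2)
  (hT1' : dd_closed (adjoint Theta1)) (hT2' : dd_closed (adjoint Theta2))
  (hA0G : op_eq A0 (op_restr (adjoint S) (fun f => Gamma0 f = zero)))
  (hB1T : op_eq B1 (boundary_restr S Gamma0 Gamma1 Theta1))
  (hB2T : op_eq B2 (boundary_restr S Gamma0 Gamma1 Theta2))
  (hB1T' : op_eq (adjoint B1) (boundary_restr S Gamma0 Gamma1 (adjoint Theta1)))
  (hB2T' : op_eq (adjoint B2) (boundary_restr S Gamma0 Gamma1 (adjoint Theta2)))
  (hz1 : discrete_spectrum B1 z0 \/ resolvent_set B1 z0)
  (hz2 : discrete_spectrum B2 z0 \/ resolvent_set B2 z0)
  (hz0 : discrete_spectrum A0 z0 \/ resolvent_set A0 z0) :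
  let N1 z := op_minus Theta1 (weyl S Gamma0 Gamma1 z) in
  let N2 z := op_minus Theta2 (weyl S Gamma0 Gamma1 z) in
  exists eps0 : R, (0 < eps0)%R /\
    index_conditions N1 (open_disc z0 eps0) (fun z => z = z0) /\
    index_conditions N2 (open_disc z0 eps0) (fun z => z = z0) /\
    exists eps1 : R, (0 < eps1)%R /\
      forall eps : R, (0 < eps < eps1)%R ->
        exists i1 i2 : C,
          is_index N1 z0 eps i1 /\ is_index N2 z0 eps i2 /\
          Cminus i1 i2 = Cminus (RtoC (INR (m_a z0 B1))) (RtoC (INR (m_a z0 B2))).
Proof.
  destruct (resolvent_structure A0 z0 (proj1 hA0) hz0) as [r0 [p0 [q0 [f0 t0]]]].
  destruct (resolvent_structure B1 z0 (proj1 hB1) hz1) as [r1 [p1 [q1 [f1 t1]]]].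
  destruct (resolvent_structure B2 z0 (proj1 hB2) hz2) as [r2 [p2 [q2 [f2 t2]]]].
  set (r := Rmin r0 (Rmin r1 r2)).
  assert (hr : 0 < r) by (repeat apply Rmin_pos; auto).
  pose proof (Rmin_l r0 (Rmin r1 r2)) as l0; pose proof (Rmin_r r0 (Rmin r1 r2)) as l12.
  pose proof (Rmin_l r1 r2) as l1; pose proof (Rmin_r r1 r2) as l2; fold r in l0, l12.
  assert (sub : forall s z, r <= s -> punctured z0 r z -> punctured z0 s z).
  { intros s z hs [a b]; split; lra. }
  destruct (index_theta S A0 Gamma0 Gamma1 hSdense hA0 hG hA0G B1 Theta1 z0 r) as [c1 i1];
    auto; try apply hT1'.
  { intros z hz; apply q1, (sub r1); auto; lra. }
  destruct (index_theta S A0 Gamma0 Gamma1 hSdense hA0 hG hA0G B2 Theta2 z0 r) as [c2 i2];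
    auto; try apply hT2'.
  { intros z hz; apply q2, (sub r2); auto; lra. }
  intros N1 N2; exists r; split; [exact hr|]; split; [exact c1|]; split; [exact c2|].
  destruct (i1 _ _ t0 t1) as [e1 [pe1 h1]], (i2 _ _ t0 t2) as [e2 [pe2 h2]].
  exists (Rmin e1 e2); split; [now apply Rmin_pos|]; intros eps he.
  pose proof (Rmin_l e1 e2); pose proof (Rmin_r e1 e2).
  (* The traces of the residues are minus the multiplicities, so each index is that of [B_j] minus
     that of [A0], and the latter cancels. *)
  eexists; eexists; split; [apply (h1 eps); lra|]; split; [apply (h2 eps); lra|]; ring.
Qed.
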